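(* Let $(X^n)_{n\in\omega}$ be a sequence of reals (subsets of $\omega$) of strictly increasing Turing degree such that (i) whenever $T$ is a binary tree computable in $X^n$ whose set of infinite branches has positive measure, some infinite path through $T$ is computable in $X^{n+1}$; and (ii) no infinite path through the Kleene tree is computable in any $X^n$. Let $M$, $R$ and $M[\mathrm{App}]$ be constructed from the sequence $R_n := X^n$ as described in the context. Then $$\langle\rangle \models_{App} \neg\,\text{D-FAN}.$$
   Context: The meta-theory is ZFC, with ground universe $V$. Trees and principles. A binary tree is a set $T$ of finite 0-1 sequences closed under initial segments; an infinite path (branch) through $T$ is an infinite 0-1 sequence all of whose finite initial segments are in $T$. Measure is the usual coin-tossing measure on infinite binary sequences. The Kleene tree is the standard computable, infinite binary tree with no computable infinite path (e.g. $s\in K$ iff there is no $e<|s|$ such that the $e$-th Turing machine on input $e$ halts within $|s|$ steps with output $s(e)$). $T$ is decidable if for all finite binary sequences $b$, $b\in T$ or $b\notin T$. D-FAN (Decidable Fan Theorem) is the statement: if a decidable binary tree $T$ has no infinite path, then $T$ is finite. (A sequence $(X^n)$ as in the claim was constructed by Yu and Simpson.) The Kripke model $M$. $M$ is the full Kripke model over the partial order $\omega^{<\omega}$ (ordered by extension, root $\langle\rangle$). Inductively, a set of $M$ is a function $f$ from $\omega^{<\omega}$ to sets of sets of $M$ with $f(\sigma)\subseteq f(\tau)$ whenever $\sigma\subseteq\tau$. By mutual induction, $\sigma\models h\in f$ iff there is $h'\in f(\sigma)$ with $\sigma\models h=h'$, and $\sigma\models f=g$ iff for all $\tau\supseteq\sigma$,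 every $h\in f(\tau)$ satisfies $\tau\models h\in g$ and every $h\in g(\tau)$ satisfies $\tau\models h\in f$. The other connectives and quantifiers are interpreted by the usual Kripke forcing clauses. $M\models$ IZF. Each $x\in V$ has a canonical image $\check x\in M$, $\check x(\sigma)=\{\check y\mid y\in x\}$, often identified with $x$. The oracle $R$. Given reals $R_n$ ($n\in\omega$) of strictly increasing Turing degree, let $(R_n^i)_{i\in\omega}$ list all reals differing from $R_n$ in only finitely many places. In $M$ define the set of natural numbers $R$ by $R(\langle\rangle)=\emptyset$ and, for $\sigma$ of length $n$, $R(\sigma^\frown i)=R(\sigma)\cup\{\langle n,s\rangle\mid s\in R_n^i\}$ (numbers identified with their images in $M$). The realizability model $M[\mathrm{App}]$. In $M$, let App be the applicative structure of indices of functions Turing computable in the oracle $R$: its elements are the natural numbers, and $e\cdot m\simeq k$ iff there is a finite correct computation of the $e$-th oracle machine on input $m$ with output $k$, where an oracle query ''$s\in R$?'' may be passed only if $s\in R$ or $s\notin R$ holds and the corresponding answer is used. $M[\mathrm{App}]$ is the induced realizability model of set theory, built inside $M$: its elements are, inductively, sets of pairs $(e,a)$ with $e\in\omega$ and $a$ an element of $M[\mathrm{App}]$. Realizability $e\Vdash_r\phi$ is: $e\Vdash_r a\in b$ iff there is $c$ with $((e)_0,c)\in b$ and $(e)_1\Vdash_r a=c$; $e\Vdash_r a=b$ iff for all $(f,c)\in a$, $(e)_0\cdot f\Vdash_r c\in b$ and for all $(f,c)\in b$, $(e)_1\cdot f\Vdash_r c\in a$; the usual Kleene clauses for $\wedge,\vee,\to,\bot$;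 and $e\Vdash_r\forall x\phi$ (resp. $\exists x\phi$) iff $e\Vdash_r\phi(a)$ for all (resp. some) $a$. $M[\mathrm{App}]\models\phi$ means some $e$ realizes $\phi$. $M[\mathrm{App}]\models$ IZF. The number $n$ is represented by $\bar n=\{(m,\bar m)\mid m<n\}$ and $\omega$ by $\{(n,\bar n)\mid n\in\omega\}$. Notation: $\sigma\models_{App}\phi$ abbreviates $\sigma\models$ ''$M[\mathrm{App}]\models\phi$'' (forcing in $M$ at node $\sigma$). *)

(* Defs.v *)
From Stdlib Require Import Reals Arith List.
From Stdlib Require Cantor.
From Coquelicot Require Import Coquelicot.
Import ListNotations.
Open Scope nat_scope.

(** * Oracle Turing machines *)

(** Multi-tape machines over the alphabet {blank = false, mark = true}.  The
    tapes are two-way infinite, indexed by [nat] (a machine mentions only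
    finitely many of them), and initially blank except for the input.  A tape
    is [(l, r)]: [l] is the content to the left of the head, nearest cell first,
    and [r] the scanned cell followed by the content to its right; cells beyond
    the lists are blank. *)
Definition tape := (list bool * list bool)%type.

Inductive move := Left | Right | Stay.

Definition scanned (t : tape) : bool := hd false (snd t).

Definition write (w : bool) (t : tape) : tape := (fst t, w :: tl (snd t)).

Definition shift (d : move) (t : tape) : tape :=
  match d with
  | Left => (tl (fst t), hd false (fst t) :: snd t)
  | Right => (scanned t :: fst t, tl (snd t))
  | Stay => t
  end.

Definition marks (t : tape) : nat :=
  count_occ Bool.bool_dec (fst t ++ snd t) true.

(** Symbol to write, head movement, next state. *)
Definition action := (bool * move * nat)%type.

(** Each state either scans one tape and acts according to the symbol read, or
    asks whether the number of marks on one tape belongs to the oracle. *)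
Inductive instr :=
| Scan (j : nat) (on_blank on_mark : action)
| Query (j : nat) (on_yes on_no : nat).

(** State [q] executes the [q]-th instruction; the machine has halted in the
    states without an instruction. *)
Definition machine := list instr.

Definition config := (nat * (nat -> tape))%type.

Definition set_tape (ts : nat -> tape) (j : nat) (t : tape) : nat -> tape :=
  fun i => if Nat.eqb i j then t else ts i.

(** An oracle is given by its available answers: [O s true] means that the query
    "s?" may be answered yes, [O s false] that it may be answered no.  A
    computation asking a query without available answer gets stuck. *)
Definition oracle := nat -> bool -> Prop.

Inductive step (O : oracle) (p : machine) : config -> config -> Prop :=
| step_scan q ts j a0 a1 w d q' :
    nth_error p q = Some (Scan j a0 a1) ->
    (if scanned (ts j) then a1 else a0) = (w, d, q') ->
    step O p (q, ts) (q', set_tape ts j (shift d (write w (ts j))))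
| step_query q ts j qy qn b :
    nth_error p q = Some (Query j qy qn) ->
    O (marks (ts j)) b ->
    step O p (q, ts) ((if b then qy else qn), ts).

Inductive steps (O : oracle) (p : machine) : nat -> config -> config -> Prop :=
| steps_0 c : steps O p 0 c c
| steps_S n c c' c'' :
    step O p c c' -> steps O p n c' c'' -> steps O p (S n) c c''.

(** Numbers are input and output in unary on tape 0. *)
Definition start (m : nat) : config :=
  (0, fun j => if Nat.eqb j 0 then ([], repeat true m) else ([], [])).

Definition halts_with (p : machine) (c : config) (k : nat) : Prop :=
  nth_error p (fst c) = None /\ marks (snd c 0) = k.

(** [<a, b>], [(e)_0] and [(e)_1]. *)
Definition npair (a b : nat) : nat := Cantor.to_nat (a, b).
Definition nfst (e : nat) : nat := fst (Cantor.of_nat e).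
Definition nsnd (e : nat) : nat := snd (Cantor.of_nat e).

Definition decode_action (a : nat) : action :=
  (negb (Nat.eqb (nfst a) 0),
   match nfst (nsnd a) with 0 => Left | 1 => Right | _ => Stay end,
   nsnd (nsnd a)).

Definition decode_instr (c : nat) : instr :=
  let j := nfst (nsnd c) in
  let x := nfst (nsnd (nsnd c)) in
  let y := nsnd (nsnd (nsnd c)) in
  if Nat.eqb (nfst c) 0
  then Scan j (decode_action x) (decode_action y)
  else Query j x y.

(** The [e]-th machine: [e = <len, <c_0, <c_1, ...>>>], where [c_q] codes the
    [q]-th instruction for [q < len].  Every machine has an index. *)
Definition decode_machine (e : nat) : machine :=
  map (fun q => decode_instr (nfst (Nat.iter q nsnd (nsnd e))))
      (seq 0 (nfst e)).

Definition computes_in (O : oracle) (n e m k : nat) : Prop :=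
  exists c, steps O (decode_machine e) n (start m) c /\
            halts_with (decode_machine e) c k.

Definition computes (O : oracle) (e m k : nat) : Prop :=
  exists n, computes_in O n e m k.

(** * Reals, Turing reducibility, trees and measure *)

(** Reals are subsets of [nat], or infinite binary sequences, given by their
    characteristic functions. *)
Definition Real := nat -> bool.

Definition answers (X : Real) : oracle := fun s b => X s = b.

Definition computable_in (X Y : Real) : Prop :=
  exists e, forall m, computes (answers X) e m (Nat.b2n (Y m)).

Definition turing_lt (X Y : Real) : Prop :=
  computable_in Y X /\ ~ computable_in X Y.

Definition differ_finitely (X Y : Real) : Prop :=
  exists l : list nat, forall s, X s <> Y s -> In s l.

(** A bijection between finite binary sequences and natural numbers. *)
Fixpoint code (s : list bool) : nat :=
  match s with
  | [] => 0
  | b :: s' => 2 * code s' + 1 + Nat.b2n b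
  end.

Definition binary_tree (T : list bool -> Prop) : Prop :=
  forall s t, T (s ++ t) -> T s.

Definition tree_computable_in (X : Real) (T : list bool -> Prop) : Prop :=
  exists e, forall s,
    (T s -> computes (answers X) e (code s) 1) /\
    (~ T s -> computes (answers X) e (code s) 0).

Definition initial (x : Real) (n : nat) : list bool := map x (seq 0 n).

Definition path (T : list bool -> Prop) (x : Real) : Prop :=
  forall n, T (initial x n).

Definition cylinder (s : list bool) (x : Real) : Prop :=
  initial x (length s) = s.

(** Coin-tossing measure, as the (outer) measure extending
    [cylinder s |-> 2 ^ (- length s)]. *)
Definition coin_measure (A : Real -> Prop) : Rbar :=
  Glb_Rbar (fun r : R =>
    exists c : nat -> list bool,
      (forall x, A x -> exists i, cylinder (c i) x) /\
      is_series (fun i => ((/ 2) ^ length (c i))%R) r).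

(** Turing machines without oracle are taken to be those with oracle the empty
    set. *)
Definition kleene_tree (s : list bool) : Prop :=
  ~ exists e n, e < length s /\ n <= length s /\
      computes_in (answers (fun _ => false)) n e e (Nat.b2n (nth e s false)).

(** * The full Kripke model over [nat^{<omega}] *)

Definition node := list nat.

Definition extends (s t : node) : Prop := exists r, t = s ++ r.

(** [mkM A B _ f] is the function sending [s] to [{f a | B a s}].  The ground
    universe is that of the sets indexed by types [A : Type]. *)
Inductive M : Type :=
| mkM (A : Type) (B : A -> node -> Prop)
      (B_mono : forall a s t, extends s t -> B a s -> B a t) (f : A -> M).

Definition elt (x : M) (s : node) (y : M) : Prop :=
  match x with mkM A B _ f => exists a, B a s /\ f a = y end.

(** Statements about M, interpreted by the nodes forcing them. *)
Definition kprop := node -> Prop.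

Definition kand (P Q : kprop) : kprop := fun s => P s /\ Q s.
Definition kor (P Q : kprop) : kprop := fun s => P s \/ Q s.
Definition kimp (P Q : kprop) : kprop :=
  fun s => forall t, extends s t -> P t -> Q t.
Definition kfalse : kprop := fun _ => False.
Definition kneg (P : kprop) : kprop := kimp P kfalse.
(** The domain ([M], or [nat] for the internal natural numbers) is the same at
    all nodes. *)
Definition kall {D : Type} (P : D -> kprop) : kprop :=
  fun s => forall t, extends s t -> forall x, P x t.
Definition kex {D : Type} (P : D -> kprop) : kprop := fun s => exists x, P x s.

(** Membership and equality are defined by recursion on sets of M; since the
    clauses are positive and M is well-founded, the solution is the inductively
    defined one. *)
Inductive kin : M -> M -> kprop :=
| kin_intro h f h' s : elt f s h' -> keq h h' s -> kin h f s
with keq : M -> M -> kprop :=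
| keq_intro f g s :
    (forall t, extends s t -> forall h, elt f t h -> kin h g t) ->
    (forall t, extends s t -> forall h, elt g t h -> kin h f t) ->
    keq f g s.

(** [{f a | a : A}] at every node. *)
Definition const_set {A : Type} (f : A -> M) : M :=
  mkM A (fun _ _ => True) (fun _ _ _ _ H => H) f.

Definition empty : M := const_set (fun x : Empty_set => match x with end).

Definition adjoin (x y : M) : M :=
  match x with
  | mkM A B B_mono f =>
      mkM (option A)
        (fun o s => match o with Some a => B a s | None => True end)
        (fun o => match o with
                  | Some a => B_mono a
                  | None => fun _ _ _ H => H
                  end)
        (fun o => match o with Some a => f a | None => y end)
  end.

Definition upair (x y : M) : M := const_set (fun b : bool => if b then x else y).

(** Kuratowski pairs in M. *)
Definition opair (x y : M) : M := upair (upair x x) (upair x y).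

(** The canonical image of the von Neumann numeral [n]. *)
Fixpoint num (n : nat) : M :=
  match n with
  | 0 => empty
  | S k => adjoin (num k) (num k)
  end.

(** * The oracle R *)

(** [L n i] is the real [R_n^i]. *)
Inductive R_at (L : nat -> nat -> Real) : node -> nat -> Prop :=
| R_old s i k : R_at L s k -> R_at L (s ++ [i]) k
| R_new s i m : L (length s) i m = true ->
    R_at L (s ++ [i]) (npair (length s) m).

Lemma R_at_mono L k s t : extends s t -> R_at L s k -> R_at L t k.
Proof.
  intros [r ->] H; induction r as [|i r IH] using rev_ind.
  - now rewrite app_nil_r.
  - rewrite app_assoc; now apply R_old.
Qed.

Definition R_set (L : nat -> nat -> Real) : M :=
  mkM nat (fun k s => R_at L s k) (R_at_mono L) num.

(** * The realizability model M[App] *)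

(** The answers to oracle queries available at a node of M. *)
Definition R_answers (L : nat -> nat -> Real) (s : node) : oracle :=
  fun n b =>
    if b then kin (num n) (R_set L) s else kneg (kin (num n) (R_set L)) s.

(** [e . m ~ k]; finite computations are the same in M as in the ground
    universe. *)
Definition app_eq (L : nat -> nat -> Real) (e m k : nat) : kprop :=
  fun s => computes (R_answers L s) e m k.

Inductive in_MApp : M -> kprop :=
| in_MApp_intro x s :
    kall (fun h => kimp (kin h x)
      (kex (fun e => kex (fun a =>
         kand (keq h (opair (num e) a)) (in_MApp a))))) s ->
    in_MApp x s.

(** As for [kin] and [keq], the recursive clauses are positive and well-founded. *)
Inductive rlz_in (L : nat -> nat -> Real) : nat -> M -> M -> kprop :=
| rlz_in_intro e a b s :
    kex (fun c => kand (kin (opair (num (nfst e)) c) b)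
                       (rlz_eq L (nsnd e) a c)) s ->
    rlz_in L e a b s
with rlz_eq (L : nat -> nat -> Real) : nat -> M -> M -> kprop :=
| rlz_eq_intro e a b s :
    kall (fun f => kall (fun c => kimp (kin (opair (num f) c) a)
      (kex (fun k => kand (app_eq L (nfst e) f k) (rlz_in L k c b))))) s ->
    kall (fun f => kall (fun c => kimp (kin (opair (num f) c) b)
      (kex (fun k => kand (app_eq L (nsnd e) f k) (rlz_in L k c a))))) s ->
    rlz_eq L e a b s.

(** Set-theoretic formulas with parameters in [V]; binders are meta-level
    functions. *)
Inductive formula (V : Type) : Type :=
| Mem (x y : V)
| Eq (x y : V)
| Bot
| And (p q : formula V)
| Or (p q : formula V)
| Imp (p q : formula V)
| All (p : V -> formula V)
| Ex (p : V -> formula V).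
Arguments Mem {V}. Arguments Eq {V}. Arguments Bot {V}. Arguments And {V}.
Arguments Or {V}. Arguments Imp {V}. Arguments All {V}. Arguments Ex {V}.

Fixpoint realizes (L : nat -> nat -> Real) (e : nat) (p : formula M) : kprop :=
  match p with
  | Mem a b => rlz_in L e a b
  | Eq a b => rlz_eq L e a b
  | Bot => kfalse
  | And p q => kand (realizes L (nfst e) p) (realizes L (nsnd e) q)
  | Or p q =>
      if Nat.eqb (nfst e) 0 then realizes L (nsnd e) p
      else realizes L (nsnd e) q
  | Imp p q =>
      kall (fun f => kimp (realizes L f p)
        (kex (fun k => kand (app_eq L e f k) (realizes L k q))))
  | All p => kall (fun a => kimp (in_MApp a) (realizes L e (p a)))
  | Ex p => kex (fun a => kand (in_MApp a) (realizes L e (p a)))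
  end.

Definition models_App (L : nat -> nat -> Real) (p : formula M) : kprop :=
  kex (fun e => realizes L e p).

(** The natural numbers of M[App]. *)
Fixpoint bar (n : nat) : M :=
  match n with
  | 0 => empty
  | S k => adjoin (bar k) (opair (num k) (bar k))
  end.

Definition omega_bar : M := const_set (fun n => opair (num n) (bar n)).

(** * The Decidable Fan Theorem as a set-theoretic formula *)

Section Formulas.
Context {V : Type}.

Definition Neg (p : formula V) := Imp p Bot.
Definition Iff (p q : formula V) := And (Imp p q) (Imp q p).
Definition AllIn (a : V) (p : V -> formula V) :=
  All (fun x => Imp (Mem x a) (p x)).
Definition ExIn (a : V) (p : V -> formula V) :=
  Ex (fun x => And (Mem x a) (p x)).
Definition Sub (a b : V) := AllIn a (fun x => Mem x b).

(** z = {a, b} *)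
Definition IsUpair (z a b : V) :=
  All (fun w => Iff (Mem w z) (Or (Eq w a) (Eq w b))).

(** p = (a, b) *)
Definition IsPair (p a b : V) :=
  All (fun z => Iff (Mem z p) (Or (IsUpair z a a) (IsUpair z a b))).

(** (a, b) is an element of f *)
Definition PairIn (a b f : V) := ExIn f (fun p => IsPair p a b).

(** f is a function from d to the class C *)
Definition IsFun (f d : V) (C : V -> formula V) :=
  And (AllIn f (fun p =>
         ExIn d (fun i => Ex (fun j => And (C j) (IsPair p i j)))))
  (And (AllIn d (fun i => Ex (fun j => And (C j) (PairIn i j f))))
       (All (fun i => All (fun j => All (fun j' =>
          Imp (PairIn i j f) (Imp (PairIn i j' f) (Eq j j'))))))).

Definition IsInj (f : V) :=
  All (fun i => All (fun i' => All (fun j =>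
    Imp (PairIn i j f) (Imp (PairIn i' j f) (Eq i i'))))).

Context (zero one omega : V).

Definition IsBit (j : V) := Or (Eq j zero) (Eq j one).

Definition IsBinSeq (s : V) := ExIn omega (fun n => IsFun s n IsBit).

(** s is a finite initial segment of the finite or infinite sequence t *)
Definition IsInitSeg (s t : V) := And (IsBinSeq s) (Sub s t).

Definition IsBinTree (T : V) :=
  And (AllIn T IsBinSeq)
      (AllIn T (fun t => All (fun s => Imp (IsInitSeg s t) (Mem s T)))).

Definition IsDecidable (T : V) :=
  All (fun b => Imp (IsBinSeq b) (Or (Mem b T) (Neg (Mem b T)))).

Definition IsPath (T x : V) :=
  And (IsFun x omega IsBit)
      (All (fun s => Imp (IsInitSeg s x) (Mem s T))).

(** T is in bijection with a natural number *)
Definition IsFinite (T : V) :=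
  ExIn omega (fun n => Ex (fun f =>
    And (IsFun f n (fun t => Mem t T))
    (And (IsInj f)
         (AllIn T (fun t => ExIn n (fun i => PairIn i t f)))))).

Definition D_FAN : formula V :=
  All (fun T =>
    Imp (And (IsBinTree T) (And (IsDecidable T) (Neg (Ex (IsPath T)))))
        (IsFinite T)).

End Formulas.

(* Main.v *)
From Stdlib Require Import Reals List.
From Coquelicot Require Import Coquelicot.
From Stdlib Require Import Arith Lia FunctionalExtensionality.
From Stdlib Require Import Classical ClassicalEpsilon.
(* Imported last, because [num] and [And] are also names of the libraries above. *)
Require Import Defs.
Import ListNotations.
Open Scope nat_scope.

(** The Kleene tree itself refutes the fan theorem.  Suppose that some number
    realizes the fan theorem at some node.  Let [kleeneA] be the set of
    M[App] whose elements are the sequences [seqA w] with [w] in the Kleene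
    tree, each with the number [seq_code w] as realizer.  For this set the
    hypotheses of the fan theorem are realized and its conclusion is not.

    It is a decidable tree ([kleeneA_tree], [kleeneA_decidable]).  A realizer
    of the statement that [x] is a finite binary sequence is an algorithm for
    the length and the bits of [x], from which [code_of_is_bin_seq] computes a
    number [seq_code w] and a realizer of [x = seqA w].  Whether [w] is in the
    Kleene tree is a matter of bounded simulation ([kleene_code]), so the
    membership of [x] is decided; its realizer is the pair of [seq_code w] and
    the realizer of the equation.  Initial segments are treated in the same way.

    It has no path ([kleeneA_path]).  A realizer at node [s] of the statement
    that [x] is a path is in particular an algorithm for the bits of [x], with
    the oracle answers available at [s].  At [s] a query on column [m] of the
    oracle is answered only if [m < length s]: later columns can still be chosen
    so as to contain any given number.  The columns that are answered are finite
    modifications of [X m] with [m < length s], hence computable from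
    [X (length s)] ([R_answers_reduction]).  So a path realized at [s] would
    give a path through the Kleene tree computable from [X (length s)], and
    there is none.  Therefore any number realizes that there is no path.

    It is not finite ([kleeneA_not_finite]).  The Kleene tree has sequences of
    all lengths; if the tree is enumerated below [n], two of them have the same
    index, hence are equal by single-valuedness, and [rlz_seqA_inj] shows that
    realized equality of sequences is true equality.

    The realizers have to be programs for the machines of the model.  These are
    reached through a small language of combinators, [prog], compiled to counter
    programs and then to tape machines.  Three facts about indices suffice
    afterwards: the s-m-n theorem [smn_correct], a universal program [univ], and
    the recursion theorem, which provides realizers of the reflexivity and
    transitivity of equality.  All of them are used only in one direction, from
    the intended value to the existence of a computation. *)

(** * Counter programs and their compilation to machines *)

Definition store := nat -> nat.

Definition upd (st : store) (j v : nat) : store :=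
  fun i => if Nat.eqb i j then v else st i.

Inductive cmd :=
| Skip
| Inc (j : nat)
| Dec (j : nat)
| Seq (c d : cmd)
| Loop (j : nat) (c : cmd)
| Ask (j i : nat).

Inductive run (O : oracle) : cmd -> store -> store -> Prop :=
| run_skip st : run O Skip st st
| run_inc j st : run O (Inc j) st (upd st j (S (st j)))
| run_dec j st : run O (Dec j) st (upd st j (pred (st j)))
| run_seq c d st st1 st2 :
    run O c st st1 -> run O d st1 st2 -> run O (Seq c d) st st2
| run_loop_end j c st : st j = 0 -> run O (Loop j c) st st
| run_loop j c st st1 st2 :
    st j <> 0 -> run O c st st1 -> run O (Loop j c) st1 st2 ->
    run O (Loop j c) st st2
| run_ask j i st b :
    O (st j) b -> run O (Ask j i) st (upd st i (st i + Nat.b2n b)).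

Fixpoint len (c : cmd) : nat :=
  match c with
  | Skip => 0
  | Inc _ => 1
  | Dec _ | Ask _ _ => 2
  | Seq c d => len c + len d
  | Loop _ c => 3 + len c
  end.

(** Jumps are absolute, so the code depends on the state [b] where it starts;
    it is left at state [b + len c].  To test a counter, the head steps left,
    onto the last mark if there is one, and back. *)
Fixpoint asm (c : cmd) (b : nat) : list instr :=
  match c with
  | Skip => []
  | Inc j => [Scan j (true, Right, S b) (true, Right, S b)]
  | Dec j => [Scan j (false, Left, S b) (false, Left, S b);
              Scan j (false, Right, S (S b)) (false, Stay, S (S b))]
  | Seq c d => asm c b ++ asm d (b + len c)
  | Loop j c =>
      [Scan j (false, Left, S b) (false, Left, S b);
       Scan j (false, Right, b + (3 + len c)) (true, Right, S (S b))] ++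
      asm c (S (S b)) ++ [Scan j (false, Stay, b) (false, Stay, b)]
  | Ask j i => [Query j (S b) (S (S b));
                Scan i (true, Right, S (S b)) (true, Right, S (S b))]
  end.

Lemma length_asm c b : length (asm c b) = len c.
Proof.
  revert b; induction c; intros b; simpl; rewrite ?length_app; simpl;
    rewrite ?IHc, ?IHc1, ?IHc2; lia.
Qed.

(** A counter is a unary numeral with the head on the blank after it.  The
    other blanks are left behind by earlier head movements. *)
Definition holds (t : tape) (v : nat) : Prop :=
  exists a b, t = (repeat true v ++ repeat false a, repeat false b).

Lemma tl_repeat {A} (x : A) n : tl (repeat x n) = repeat x (pred n).
Proof. now destruct n. Qed.

Lemma hd_repeat {A} (x : A) n : hd x (repeat x n) = x.
Proof. now destruct n. Qed.

Local Ltac tape_simpl :=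
  unfold scanned, shift, write; cbn [fst snd];
  repeat (progress (rewrite ?tl_repeat, ?hd_repeat; cbn [hd tl repeat app fst snd])).

Lemma holds_blank t v : holds t v -> scanned t = false.
Proof. intros (a & b & ->); apply hd_repeat. Qed.

Lemma holds_inc t v : holds t v -> holds (shift Right (write true t)) (S v).
Proof.
  intros (a & b & ->); exists a, (pred b); now tape_simpl.
Qed.

Lemma holds_stay t v : holds t v -> holds (shift Stay (write false t)) v.
Proof.
  intros (a & b & ->); exists a, (S (pred b)); now tape_simpl.
Qed.

Lemma holds_test_0 t : holds t 0 ->
  scanned (shift Left (write false t)) = false /\
  holds (shift Right (write false (shift Left (write false t)))) 0.
Proof.
  intros (a & b & ->); split; [now tape_simpl|].
  exists (S (pred a)), (S (pred b)); now tape_simpl.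
Qed.

Lemma holds_test_S t v : holds t (S v) ->
  scanned (shift Left (write false t)) = true /\
  holds (shift Right (write true (shift Left (write false t)))) (S v) /\
  holds (shift Stay (write false (shift Left (write false t)))) v.
Proof.
  intros (a & b & ->); split; [now tape_simpl|split].
  - exists a, (S (pred b)); now tape_simpl.
  - exists a, (S (S (pred b))); now tape_simpl.
Qed.

Lemma count_repeat b n :
  count_occ Bool.bool_dec (repeat b n) true = if b then n else 0.
Proof.
  induction n as [|n IH]; destruct b; cbn; auto.
Qed.

Lemma holds_marks t v : holds t v -> marks t = v.
Proof.
  intros (a & b & ->); unfold marks; cbn.
  rewrite !count_occ_app, !count_repeat; lia.
Qed.

Definition agree (ts : nat -> tape) (st : store) : Prop :=
  forall j, holds (ts j) (st j).

Lemma agree_set ts st j t v :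
  agree ts st -> holds t v -> agree (set_tape ts j t) (upd st j v).
Proof.
  intros H Ht i; unfold set_tape, upd; destruct (Nat.eqb i j); auto.
Qed.

Lemma agree_set2 ts st j t t' v :
  agree ts st -> holds t' v ->
  agree (set_tape (set_tape ts j t) j t') (upd st j v).
Proof.
  intros H Ht i; unfold set_tape, upd; destruct (Nat.eqb i j); auto.
Qed.

Lemma set_tape_same ts j t : set_tape ts j t j = t.
Proof. unfold set_tape; now rewrite Nat.eqb_refl. Qed.

Lemma upd_id st j : upd st j (st j) = st.
Proof.
  apply functional_extensionality; intros i; unfold upd.
  destruct (Nat.eqb_spec i j); congruence.
Qed.

Definition reach (O : oracle) (p : machine) (c c' : config) : Prop :=
  exists n, steps O p n c c'.

Lemma reach_refl O p c : reach O p c c.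
Proof. exists 0; constructor. Qed.

Lemma reach_step O p c c' c'' :
  step O p c c' -> reach O p c' c'' -> reach O p c c''.
Proof. intros H [n Hn]; exists (S n); econstructor; eauto. Qed.

Lemma reach_trans O p c c' c'' :
  reach O p c c' -> reach O p c' c'' -> reach O p c c''.
Proof.
  intros [n Hn]; revert c''; induction Hn; intros c3 H3; auto.
  eapply reach_step; eauto.
Qed.

Definition installed (p : machine) (b : nat) (l : list instr) : Prop :=
  forall i x, nth_error l i = Some x -> nth_error p (b + i) = Some x.

Lemma installed_app p b l1 l2 :
  installed p b (l1 ++ l2) ->
  installed p b l1 /\ installed p (b + length l1) l2.
Proof.
  intros H; split; intros i x Hx.
  - apply H; rewrite nth_error_app1; auto.
    apply nth_error_Some; congruence.
  - rewrite <- Nat.add_assoc; apply H.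
    rewrite nth_error_app2 by lia; now replace (_ + i - _) with i by lia.
Qed.

Lemma installed_cons p b x l :
  installed p b (x :: l) -> nth_error p b = Some x /\ installed p (S b) l.
Proof.
  intros H; split.
  - rewrite <- (Nat.add_0_r b); now apply H.
  - intros i y Hy; replace (S b + i) with (b + S i) by lia; now apply H.
Qed.

Lemma scan_reach O p q ts j a0 a1 w d q' c t :
  nth_error p q = Some (Scan j a0 a1) ->
  (if scanned (ts j) then a1 else a0) = (w, d, q') ->
  shift d (write w (ts j)) = t ->
  reach O p (q', set_tape ts j t) c -> reach O p (q, ts) c.
Proof.
  intros H1 H2 <-; apply reach_step; now apply step_scan with a0 a1.
Qed.

Lemma asm_correct O c st st' : run O c st st' ->
  forall p b ts, installed p b (asm c b) -> agree ts st ->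
  exists ts', reach O p (b, ts) (b + len c, ts') /\ agree ts' st'.
Proof.
  induction 1 as [st|j st|j st|c d st st1 st2 H1 IH1 H2 IH2|j c st Hj
    |j c st st1 st2 Hj H1 IH1 H2 IH2|j i st b Hb];
    intros p b0 ts Hp Hts; cbn [asm] in Hp.
  - exists ts; split; auto; cbn; rewrite Nat.add_0_r; apply reach_refl.
  - apply installed_cons in Hp as [Hp _].
    pose proof (Hts j) as Hj.
    eexists; split; [|apply agree_set, holds_inc; eassumption].
    eapply scan_reach; [eassumption| | |].
    + now rewrite (holds_blank _ _ Hj).
    + reflexivity.
    + cbn; rewrite Nat.add_1_r; apply reach_refl.
  - apply installed_cons in Hp as [Hp0 Hp].
    apply installed_cons in Hp as [Hp1 _].
    pose proof (Hts j) as Hj; cbn; replace (b0 + 2) with (S (S b0)) by lia.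
    destruct (st j) as [|v] eqn:E.
    + destruct (holds_test_0 _ Hj) as [Hs Ht].
      eexists; split; [|apply agree_set2; [eassumption|apply Ht]].
      eapply scan_reach;
        [eassumption|now rewrite (holds_blank _ _ Hj)|reflexivity|].
      eapply scan_reach;
        [eassumption|now rewrite set_tape_same, Hs| |apply reach_refl].
      now rewrite set_tape_same.
    + destruct (holds_test_S _ _ Hj) as (Hs & _ & Ht).
      eexists; split; [|apply agree_set2; [eassumption|apply Ht]].
      eapply scan_reach;
        [eassumption|now rewrite (holds_blank _ _ Hj)|reflexivity|].
      eapply scan_reach;
        [eassumption|now rewrite set_tape_same, Hs| |apply reach_refl].
      now rewrite set_tape_same.
  - apply installed_app in Hp as [Hp1 Hp2]; rewrite length_asm in Hp2.
    destruct (IH1 _ _ _ Hp1 Hts) as (ts1 & R1 & A1).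
    destruct (IH2 _ _ _ Hp2 A1) as (ts2 & R2 & A2).
    exists ts2; split; auto; cbn [len]; rewrite Nat.add_assoc.
    eapply reach_trans; eauto.
  - apply installed_cons in Hp as [Hp0 Hp].
    apply installed_cons in Hp as [Hp1 _].
    pose proof (Hts j) as H; rewrite Hj in H.
    destruct (holds_test_0 _ H) as [Hs Ht].
    eexists; split.
    + eapply scan_reach;
        [eassumption|now rewrite (holds_blank _ _ H)|reflexivity|].
      eapply scan_reach;
        [eassumption|now rewrite set_tape_same, Hs| |apply reach_refl].
      rewrite set_tape_same; reflexivity.
    + rewrite <- (upd_id st j), Hj; now apply agree_set2.
  - assert (Hp' := Hp).
    apply installed_cons in Hp as [Hp0 Hp].
    apply installed_cons in Hp as [Hp1 Hp].
    apply installed_app in Hp as [Hp2 Hp3]; rewrite length_asm in Hp3.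
    apply installed_cons in Hp3 as [Hp3 _].
    pose proof (Hts j) as H; destruct (st j) as [|v] eqn:E; [lia|].
    destruct (holds_test_S _ _ H) as (Hs & Ht & _).
    destruct (IH1 p (S (S b0)) (set_tape
      (set_tape ts j (shift Left (write false (ts j)))) j
      (shift Right (write true (shift Left (write false (ts j)))))))
      as (ts1 & R1 & A1); auto.
    { rewrite <- (upd_id st j), E; now apply agree_set2. }
    destruct (IH2 p b0 (set_tape ts1 j (shift Stay (write false (ts1 j)))))
      as (ts2 & R2 & A2); auto.
    { rewrite <- (upd_id st1 j); apply agree_set, holds_stay; auto. }
    exists ts2; split; auto.
    eapply scan_reach;
      [eassumption|now rewrite (holds_blank _ _ H)|reflexivity|].
    eapply scan_reach; [eassumption|now rewrite set_tape_same, Hs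
      |rewrite set_tape_same; reflexivity|].
    eapply reach_trans; [exact R1|].
    eapply scan_reach;
      [eassumption|now rewrite (holds_blank _ _ (A1 j))|reflexivity|exact R2].
  - apply installed_cons in Hp as [Hp0 Hp].
    apply installed_cons in Hp as [Hp1 _].
    pose proof (Hts j) as Hj; pose proof (Hts i) as Hi.
    assert (Hq : step O p (b0, ts) ((if b then S b0 else S (S b0)), ts)).
    { eapply step_query; [exact Hp0|]; now rewrite (holds_marks _ _ Hj). }
    cbn; replace (b0 + 2) with (S (S b0)) by lia; destruct b; cbn.
    + eexists; split; [|apply agree_set; [eassumption|]].
      * eapply reach_step; [exact Hq|].
        eapply scan_reach; [eassumption|now rewrite (holds_blank _ _ Hi)
          |reflexivity|apply reach_refl].
      * rewrite Nat.add_1_r; now apply holds_inc.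
    + exists ts; split; [eapply reach_step; [exact Hq|apply reach_refl]|].
      now rewrite Nat.add_0_r, upd_id.
Qed.

(** ** Counter programs for moving, copying and Cantor's pairing *)

Lemma run_eq O c st st1 st2 : run O c st st1 -> st1 = st2 -> run O c st st2.
Proof. now intros H <-. Qed.

Ltac split_eqb :=
  repeat match goal with
  | |- context [Nat.eqb ?x ?y] => destruct (Nat.eqb_spec x y); try lia
  end.

Ltac store_eq :=
  apply functional_extensionality; intro; unfold upd; split_eqb; subst;
  try lia; try congruence.

Definition transfer (a b : nat) : cmd := Loop a (Seq (Dec a) (Inc b)).

Definition clear (a : nat) : cmd := Loop a (Dec a).

Definition spread (a b t : nat) : cmd :=
  Loop a (Seq (Dec a) (Seq (Inc b) (Inc t))).

Lemma run_transfer O a b st : a <> b ->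
  run O (transfer a b) st (upd (upd st a 0) b (st a + st b)).
Proof.
  intros Hab; remember (st a) as n eqn:E; revert st E.
  induction n as [|n IH]; intros st E.
  - eapply run_eq; [now apply run_loop_end|store_eq].
  - eapply run_eq.
    + eapply run_loop; [congruence| |apply IH].
      * eapply run_seq; constructor.
      * unfold upd; split_eqb; cbn; lia.
    + store_eq.
Qed.

Lemma run_clear O a st : run O (clear a) st (upd st a 0).
Proof.
  remember (st a) as n eqn:E; revert st E.
  induction n as [|n IH]; intros st E.
  - eapply run_eq; [now apply run_loop_end|store_eq].
  - eapply run_eq.
    + eapply run_loop; [congruence| |apply IH].
      * constructor.
      * unfold upd; split_eqb; cbn; lia.
    + store_eq.
Qed.

Lemma run_spread O a b t st : a <> b -> a <> t -> b <> t ->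
  run O (spread a b t) st
    (upd (upd (upd st a 0) b (st a + st b)) t (st a + st t)).
Proof.
  intros Hab Hat Hbt; remember (st a) as n eqn:E; revert st E.
  induction n as [|n IH]; intros st E.
  - eapply run_eq; [now apply run_loop_end|store_eq].
  - eapply run_eq.
    + eapply run_loop; [congruence| |apply IH].
      * eapply run_seq; [|eapply run_seq]; constructor.
      * unfold upd; split_eqb; cbn; lia.
    + store_eq.
Qed.

Definition copy (a b t : nat) : cmd := Seq (spread a b t) (transfer t a).

Lemma run_copy O a b t st : a <> b -> a <> t -> b <> t -> st t = 0 ->
  run O (copy a b t) st (upd st b (st a + st b)).
Proof.
  intros Hab Hat Hbt Ht; eapply run_eq.
  - eapply run_seq; [now apply run_spread|apply run_transfer; lia].
  - store_eq.
Qed.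

Definition triangle (n : nat) : nat := nat_rec _ 0 (fun i m => S i + m) n.

(** Cantor's pairing is [b + triangle (b + a)]; the triangular number is the
    sum of the values taken by a counter on its way down to zero. *)
Definition pack (a b j : nat) : cmd :=
  Seq (spread b a j) (Loop a (Seq (spread a b j) (Seq (Dec b) (transfer b a)))).

Lemma run_triangle O a b j st : a <> b -> a <> j -> b <> j -> st b = 0 ->
  run O (Loop a (Seq (spread a b j) (Seq (Dec b) (transfer b a)))) st
    (upd (upd st a 0) j (triangle (st a) + st j)).
Proof.
  intros Hab Haj Hbj Hb; remember (st a) as n eqn:E; revert st E Hb.
  induction n as [|n IH]; intros st E Hb.
  - eapply run_eq; [now apply run_loop_end|store_eq; cbn; lia].
  - eapply run_eq.
    + eapply run_loop; [congruence| |apply IH].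
      * eapply run_seq; [now apply run_spread|].
        eapply run_seq; [constructor|apply run_transfer; lia].
      * unfold upd; split_eqb; cbn; lia.
      * unfold upd; split_eqb; cbn; lia.
    + change (triangle (S n)) with (S n + triangle n); store_eq.
Qed.

Lemma run_pack O a b j st : a <> b -> a <> j -> b <> j -> st j = 0 ->
  run O (pack a b j) st
    (upd (upd (upd st a 0) b 0) j (npair (st a) (st b))).
Proof.
  intros Hab Haj Hbj Hj; eapply run_eq.
  - eapply run_seq; [apply run_spread; lia|apply run_triangle; auto].
    unfold upd; split_eqb.
  - change (npair (st a) (st b)) with (st b + triangle (st b + st a)).
    unfold upd; split_eqb; store_eq.
Qed.

(** One step along the antidiagonals for each unit of counter [j]: from
    [(S x, y)] to [(x, S y)], and from [(0, y)] to [(S y, 0)].  The counter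
    [3 + j] is the flag that selects the second case. *)
Definition unpack (j : nat) : cmd :=
  Loop j
    (Seq (Dec j)
    (Seq (Inc (3 + j))
    (Seq (Loop (1 + j)
            (Seq (Dec (1 + j))
            (Seq (Inc (2 + j))
            (Seq (Dec (3 + j)) (transfer (1 + j) (4 + j))))))
    (Seq (transfer (4 + j) (1 + j))
         (Loop (3 + j)
            (Seq (Dec (3 + j))
            (Seq (transfer (2 + j) (1 + j)) (Inc (1 + j))))))))).

Definition put3 (st : store) (j x y z : nat) : store :=
  upd (upd (upd st j x) (1 + j) y) (2 + j) z.

Lemma run_unpack_from O j st k n : st (3 + j) = 0 -> st (4 + j) = 0 ->
  run O (unpack j)
    (put3 st j n (nfst k) (nsnd k))
    (put3 st j 0 (nfst (n + k)) (nsnd (n + k))).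
Proof.
  intros H3 H4; revert k; induction n as [|n IH]; intros k.
  - apply run_loop_end; unfold put3, upd; split_eqb.
  - replace (S n + k) with (n + S k) by lia.
    eapply run_loop; [unfold put3, upd; split_eqb| |apply IH].
    unfold nfst, nsnd; change (Cantor.of_nat (S k)) with
      (let '(x, y) := Cantor.of_nat k in
       match x with S x => (x, S y) | _ => (S y, 0) end).
    destruct (Cantor.of_nat k) as [[|x] y]; cbn [fst snd].
    + eapply run_eq.
      * eapply run_seq; [constructor|].
        eapply run_seq; [constructor|].
        eapply run_seq; [apply run_loop_end; unfold put3, upd; split_eqb|].
        eapply run_seq; [apply run_transfer; lia|].
        eapply run_loop; [unfold put3, upd; split_eqb| |].
        -- eapply run_seq; [constructor|].
           eapply run_seq; [apply run_transfer; lia|constructor].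
        -- apply run_loop_end; unfold put3, upd; split_eqb.
      * unfold put3, upd; split_eqb; store_eq.
    + eapply run_eq.
      * eapply run_seq; [constructor|].
        eapply run_seq; [constructor|].
        eapply run_seq.
        { eapply run_loop; [unfold put3, upd; split_eqb| |].
          - eapply run_seq; [constructor|].
            eapply run_seq; [constructor|].
            eapply run_seq; [constructor|apply run_transfer; lia].
          - apply run_loop_end; unfold put3, upd; split_eqb. }
        eapply run_seq; [apply run_transfer; lia|].
        apply run_loop_end; unfold put3, upd; split_eqb.
      * unfold put3, upd; split_eqb; store_eq.
Qed.

Lemma run_unpack O j st : (forall i, j < i -> st i = 0) ->
  run O (unpack j) st (put3 st j 0 (nfst (st j)) (nsnd (st j))).
Proof.
  intros H; rewrite <- (Nat.add_0_r (st j)).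
  replace st with (put3 st j (st j) (nfst 0) (nsnd 0)) at 1.
  - apply run_unpack_from; apply H; lia.
  - unfold put3; store_eq; rewrite H by lia; reflexivity.
Qed.

(** * A combinator language for partial functions on numbers *)

Inductive prog :=
| PId
| PZero
| PSucc
| PPred
| PFst
| PSnd
| PPair (f g : prog)
| PComp (f g : prog)
| PIf (t f g : prog)
| PWhile (t f : prog)
| PAsk.

(** Only sufficient conditions for a value are ever needed, so [ev] is a
    relation that need not be functional when the oracle is not. *)
Inductive ev (O : oracle) : prog -> nat -> nat -> Prop :=
| ev_id m : ev O PId m m
| ev_zero m : ev O PZero m 0
| ev_succ m : ev O PSucc m (S m)
| ev_pred m : ev O PPred m (pred m)
| ev_fst m : ev O PFst m (nfst m)
| ev_snd m : ev O PSnd m (nsnd m)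
| ev_pair f g m x y :
    ev O f m x -> ev O g m y -> ev O (PPair f g) m (npair x y)
| ev_comp f g m x y : ev O g m x -> ev O f x y -> ev O (PComp f g) m y
| ev_if_S t f g m v x : ev O t m (S v) -> ev O f m x -> ev O (PIf t f g) m x
| ev_if_0 t f g m x : ev O t m 0 -> ev O g m x -> ev O (PIf t f g) m x
| ev_while_end t f m : ev O t m 0 -> ev O (PWhile t f) m m
| ev_while t f m v x y :
    ev O t m (S v) -> ev O f m x -> ev O (PWhile t f) x y ->
    ev O (PWhile t f) m y
| ev_ask m b : O m b -> ev O PAsk m (Nat.b2n b).

(** [cmd_of c j] applies [c] to counter [j], using as scratch the counters
    above [j], which are zero before and after. *)
Fixpoint cmd_of (c : prog) (j : nat) : cmd :=
  match c with
  | PId => Skip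
  | PZero => clear j
  | PSucc => Inc j
  | PPred => Dec j
  | PFst => Seq (unpack j) (Seq (clear (2 + j)) (transfer (1 + j) j))
  | PSnd => Seq (unpack j) (Seq (clear (1 + j)) (transfer (2 + j) j))
  | PPair f g =>
      Seq (copy j (1 + j) (2 + j))
      (Seq (cmd_of f (1 + j))
      (Seq (transfer j (2 + j))
      (Seq (cmd_of g (2 + j)) (pack (1 + j) (2 + j) j))))
  | PComp f g => Seq (cmd_of g j) (cmd_of f j)
  | PIf t f g =>
      Seq (copy j (1 + j) (2 + j))
      (Seq (cmd_of t (1 + j))
      (Seq (transfer j (2 + j))
      (Seq (Inc j)
      (Seq (Loop (1 + j)
              (Seq (clear (1 + j)) (Seq (Dec j) (cmd_of f (2 + j)))))
      (Seq (Loop j (Seq (Dec j) (cmd_of g (2 + j))))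
           (transfer (2 + j) j))))))
  | PWhile t f =>
      Seq (Seq (copy j (1 + j) (2 + j)) (cmd_of t (1 + j)))
        (Loop (1 + j)
           (Seq (Seq (clear (1 + j)) (cmd_of f j))
                (Seq (copy j (1 + j) (2 + j)) (cmd_of t (1 + j)))))
  | PAsk => Seq (Ask j (1 + j)) (Seq (clear j) (transfer (1 + j) j))
  end.

Ltac upd_simpl := unfold put3, upd; split_eqb.

Lemma cmd_of_correct O c m k : ev O c m k ->
  forall j st, st j = m -> (forall i, j < i -> st i = 0) ->
  run O (cmd_of c j) st (upd st j k).
Proof.
  induction 1 as [m|m|m|m|m|m|f g m x y Hf IHf Hg IHg|f g m x y Hg IHg Hf IHf
    |t f g m v x Ht IHt Hf IHf|t f g m x Ht IHt Hg IHg|t f m Ht IHt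
    |t f m v x y Ht IHt Hf IHf Hw IHw|m b Hb];
    intros j st Hj H0; cbn [cmd_of].
  - rewrite <- Hj, upd_id; constructor.
  - apply run_clear.
  - rewrite <- Hj; constructor.
  - rewrite <- Hj; constructor.
  - eapply run_eq.
    + eapply run_seq; [apply run_unpack; auto|].
      eapply run_seq; [apply run_clear|apply run_transfer; lia].
    + upd_simpl; rewrite Hj; store_eq; rewrite H0; lia.
  - eapply run_eq.
    + eapply run_seq; [apply run_unpack; auto|].
      eapply run_seq; [apply run_clear|apply run_transfer; lia].
    + upd_simpl; rewrite Hj; store_eq; rewrite H0; lia.
  - eapply run_eq.
    + eapply run_seq; [apply run_copy; try lia; apply H0; lia|].
      rewrite (H0 (1 + j)) by lia; rewrite Nat.add_0_r.
      eapply run_seq.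
      { apply IHf; [upd_simpl|intros i Hi; upd_simpl; apply H0; lia]. }
      eapply run_seq; [apply run_transfer; lia|].
      eapply run_seq.
      { apply IHg; [upd_simpl; rewrite (H0 (2 + j)) by lia; lia
        |intros i Hi; upd_simpl; apply H0; lia]. }
      apply run_pack; try lia; upd_simpl.
    + upd_simpl; store_eq; rewrite H0; lia.
  - eapply run_eq.
    + eapply run_seq; [now apply IHg|].
      apply IHf; [upd_simpl|intros i Hi; upd_simpl; apply H0; lia].
    + store_eq.
  - eapply run_eq.
    + eapply run_seq; [apply run_copy; try lia; apply H0; lia|].
      rewrite (H0 (1 + j)) by lia; rewrite Nat.add_0_r.
      eapply run_seq.
      { apply IHt; [upd_simpl|intros i Hi; upd_simpl; apply H0; lia]. }
      eapply run_seq; [apply run_transfer; lia|].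
      eapply run_seq; [constructor|].
      eapply run_seq.
      { eapply run_loop; [upd_simpl| |apply run_loop_end].
        - eapply run_seq; [apply run_clear|].
          eapply run_seq; [constructor|].
          apply IHf; [upd_simpl; rewrite (H0 (2 + j)) by lia; lia
            |intros i Hi; upd_simpl; apply H0; lia].
        - upd_simpl. }
      eapply run_seq; [apply run_loop_end; upd_simpl|].
      apply run_transfer; lia.
    + upd_simpl; store_eq; rewrite H0; lia.
  - eapply run_eq.
    + eapply run_seq; [apply run_copy; try lia; apply H0; lia|].
      rewrite (H0 (1 + j)) by lia; rewrite Nat.add_0_r.
      eapply run_seq.
      { apply IHt; [upd_simpl|intros i Hi; upd_simpl; apply H0; lia]. }
      eapply run_seq; [apply run_transfer; lia|].
      eapply run_seq; [constructor|].
      eapply run_seq; [apply run_loop_end; upd_simpl|].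
      eapply run_seq.
      { eapply run_loop; [upd_simpl| |apply run_loop_end].
        - eapply run_seq; [constructor|].
          apply IHg; [upd_simpl; rewrite (H0 (2 + j)) by lia; lia
            |intros i Hi; upd_simpl; apply H0; lia].
        - upd_simpl. }
      apply run_transfer; lia.
    + upd_simpl; store_eq; rewrite H0; lia.
  - eapply run_eq.
    + eapply run_seq.
      * eapply run_seq; [apply run_copy; try lia; apply H0; lia|].
        rewrite (H0 (1 + j)) by lia; rewrite Nat.add_0_r.
        apply IHt; [upd_simpl|intros i Hi; upd_simpl; apply H0; lia].
      * apply run_loop_end; upd_simpl.
    + store_eq; rewrite H0; lia.
  - cbn [cmd_of] in IHw.
    assert (Hx : run O (Seq (clear (1 + j)) (cmd_of f j))
      (upd st (1 + j) (S v)) (upd st j x)).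
    { eapply run_eq; [eapply run_seq; [apply run_clear|apply IHf]|].
      - upd_simpl.
      - intros i Hi; upd_simpl; apply H0; lia.
      - store_eq; rewrite H0; lia. }
    specialize (IHw j (upd st j x)); upd_simpl.
    pose proof (IHw ltac:(upd_simpl)
      ltac:(intros i Hi; upd_simpl; apply H0; lia)) as Hw'.
    inversion Hw' as [| | |? ? ? stm ? Hm1 Hm2| | | ]; subst.
    eapply run_eq.
    + eapply run_seq.
      * eapply run_seq; [apply run_copy; try lia; apply H0; lia|].
        rewrite (H0 (1 + j)) by lia; rewrite Nat.add_0_r.
        apply IHt; [upd_simpl|intros i Hi; upd_simpl; apply H0; lia].
      * eapply run_loop; [upd_simpl| |exact Hm2].
        eapply run_seq; [|exact Hm1].
        eapply run_eq; [|reflexivity].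
        replace (upd (upd st (1 + j) (st j)) (1 + j) (S v))
          with (upd st (1 + j) (S v)) by store_eq.
        exact Hx.
    + store_eq.
  - eapply run_eq.
    + eapply run_seq; [apply run_ask; rewrite Hj; exact Hb|].
      eapply run_seq; [apply run_clear|apply run_transfer; lia].
    + upd_simpl; rewrite (H0 (1 + j)) by lia; store_eq; rewrite H0; lia.
Qed.

(** * Total computable functions *)

Lemma nfst_npair a b : nfst (npair a b) = a.
Proof. unfold nfst, npair; now rewrite Cantor.cancel_of_to. Qed.

Lemma nsnd_npair a b : nsnd (npair a b) = b.
Proof. unfold nsnd, npair; now rewrite Cantor.cancel_of_to. Qed.

Lemma npair_eta e : npair (nfst e) (nsnd e) = e.
Proof.
  unfold npair, nfst, nsnd; rewrite <- surjective_pairing.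
  apply Cantor.cancel_to_of.
Qed.

Ltac np := repeat progress rewrite ?nfst_npair, ?nsnd_npair.

Lemma iter_S {A} n (f : A -> A) x : Nat.iter (S n) f x = f (Nat.iter n f x).
Proof. reflexivity. Qed.

Lemma iter_S_r {A} n (f : A -> A) x :
  Nat.iter (S n) f x = Nat.iter n f (f x).
Proof. apply Nat.iter_succ_r. Qed.

Lemma ev_fst_eq O m k : nfst m = k -> ev O PFst m k.
Proof. intros <-; constructor. Qed.

Lemma ev_snd_eq O m k : nsnd m = k -> ev O PSnd m k.
Proof. intros <-; constructor. Qed.

(** Programs are kept in [Type], so that they can be extracted from lemmas
    without any choice. *)
Definition total (f : nat -> nat) : Type :=
  {c : prog | forall O m, ev O c m (f m)}.

Lemma total_ext f g : (forall m, f m = g m) -> total f -> total g.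
Proof. intros H [c Hc]; exists c; intros; rewrite <- H; auto. Qed.

Lemma total_id : total (fun m => m).
Proof. exists PId; constructor. Qed.

Lemma total_comp f g : total f -> total g -> total (fun m => f (g m)).
Proof.
  intros [c Hc] [d Hd]; exists (PComp c d); intros; econstructor; eauto.
Qed.

Fixpoint const (n : nat) : prog :=
  match n with 0 => PZero | S n => PComp PSucc (const n) end.

Lemma ev_const O n m : ev O (const n) m n.
Proof. induction n; cbn; econstructor; eauto; constructor. Qed.

Lemma total_const n : total (fun _ => n).
Proof. exists (const n); intros; apply ev_const. Qed.

Lemma total_pair f g :
  total f -> total g -> total (fun m => npair (f m) (g m)).
Proof.
  intros [c Hc] [d Hd]; exists (PPair c d); intros; econstructor; eauto.
Qed.

Lemma total_S f : total f -> total (fun m => S (f m)).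
Proof. apply (total_comp S); exists PSucc; constructor. Qed.

Lemma total_pred f : total f -> total (fun m => pred (f m)).
Proof. apply (total_comp pred); exists PPred; constructor. Qed.

Lemma total_nfst f : total f -> total (fun m => nfst (f m)).
Proof. apply (total_comp nfst); exists PFst; constructor. Qed.

Lemma total_nsnd f : total f -> total (fun m => nsnd (f m)).
Proof. apply (total_comp nsnd); exists PSnd; constructor. Qed.

Lemma total_if t f g : total t -> total f -> total g ->
  total (fun m => if Nat.eqb (t m) 0 then f m else g m).
Proof.
  intros [t' Ht] [f' Hf] [g' Hg]; exists (PIf t' g' f'); intros O m.
  specialize (Ht O m); destruct (t m) as [|v]; cbn.
  - now apply ev_if_0.
  - now apply ev_if_S with v.
Qed.

Definition total2 (F : nat -> nat -> nat) : Type :=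
  total (fun m => F (nfst m) (nsnd m)).

Lemma total2_app F f g :
  total2 F -> total f -> total g -> total (fun m => F (f m) (g m)).
Proof.
  intros HF Hf Hg.
  apply (total_ext (fun m => F (nfst (npair (f m) (g m)))
                               (nsnd (npair (f m) (g m))))).
  - intros m; now rewrite nfst_npair, nsnd_npair.
  - exact (total_comp _ _ HF (total_pair _ _ Hf Hg)).
Qed.

(** Iteration, with [m] as a parameter of the step. *)
Lemma total_iter n F x : total n -> total2 F -> total x ->
  total (fun m => Nat.iter (n m) (F m) (x m)).
Proof.
  intros Hn HF Hx.
  (* state: remaining steps, parameter, current value *)
  set (step := fun s => npair (pred (nfst s))
    (npair (nfst (nsnd s)) (F (nfst (nsnd s)) (nsnd (nsnd s))))).
  assert (Hs : total step).
  { apply total_pair; [apply total_pred, total_nfst, total_id|].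
    apply total_pair; [apply total_nfst, total_nsnd, total_id|].
    apply total2_app; auto; repeat apply total_nfst || apply total_nsnd;
      apply total_id. }
  assert (Hi : total (fun m => npair (n m) (npair m (x m)))).
  { repeat apply total_pair; auto using total_id. }
  destruct Hs as [cs Hs], Hi as [ci Hi].
  exists (PComp (PComp PSnd PSnd) (PComp (PWhile PFst cs) ci)); intros O m.
  assert (H : forall k y, ev O (PWhile PFst cs) (npair k (npair m y))
    (npair 0 (npair m (Nat.iter k (F m) y)))).
  { induction k as [|k IH]; intros y.
    - apply ev_while_end, ev_fst_eq, nfst_npair.
    - eapply ev_while with (v := k).
      + apply ev_fst_eq, nfst_npair.
      + apply Hs.
      + unfold step; np; cbn [pred].
        rewrite iter_S_r; apply IH. }
  econstructor; [econstructor; [apply Hi|apply H]|].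
  econstructor; [constructor|].
  rewrite nsnd_npair; apply ev_snd_eq, nsnd_npair.
Qed.

(** Reduces [total] goals for explicit expressions to the constants in them;
    the data base [total] holds the lemmas on defined functions. *)
Create HintDb total.
Ltac total_tac :=
  lazymatch goal with
  | |- total2 _ => unfold total2; cbv beta; total_tac
  | |- total (fun m => m) => apply total_id
  | |- total (fun _ => ?n) => apply (total_const n)
  | |- total (fun m => S (@?f m)) => apply (total_S f); total_tac
  | |- total (fun m => pred (@?f m)) => apply (total_pred f); total_tac
  | |- total (fun m => nfst (@?f m)) => apply (total_nfst f); total_tac
  | |- total (fun m => nsnd (@?f m)) => apply (total_nsnd f); total_tac
  | |- total (fun m => npair (@?f m) (@?g m)) =>
      apply (total_pair f g); total_tac
  | |- total (fun m => if Nat.eqb (@?t m) 0 then (@?f m) else (@?g m)) =>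
      apply (total_if t f g); total_tac
  | |- total (fun m => Nat.iter (@?n m) (@?F m) (@?x m)) =>
      apply (total_iter n F x); total_tac
  | |- total (fun m => ?F (@?f m) (@?g m)) =>
      apply (total2_app F f g); [solve [auto with total]|total_tac|total_tac]
  | |- total (fun m => ?F (@?f m)) =>
      apply (total_comp F f); [solve [auto with total]|total_tac]
  | |- _ => solve [auto with total]
  end.

Lemma total_fst : total nfst.
Proof. exact (total_nfst _ total_id). Qed.

Lemma total_snd : total nsnd.
Proof. exact (total_nsnd _ total_id). Qed.

Lemma total_predn : total pred.
Proof. exact (total_pred _ total_id). Qed.
#[export] Hint Resolve total_fst total_snd total_predn : total.

Lemma total2_add : total2 Nat.add.
Proof.
  apply (total_ext (fun m => Nat.iter (nfst m) (fun x => S x) (nsnd m))).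
  - intros m; induction (nfst m); cbn; auto.
  - total_tac.
Qed.
#[export] Hint Resolve total2_add : total.

Lemma total2_sub : total2 Nat.sub.
Proof.
  apply (total_ext (fun m => Nat.iter (nsnd m) (fun x => pred x) (nfst m))).
  - intros m; induction (nsnd m) as [|k IH]; rewrite ?iter_S, ?IH; cbn; lia.
  - total_tac.
Qed.
#[export] Hint Resolve total2_sub : total.

Definition halve (n : nat) : nat :=
  Nat.iter n (fun s => if Nat.eqb (nsnd s) 0 then npair (nfst s) 1
                       else npair (S (nfst s)) 0) (npair 0 0).

Lemma halve_spec n : halve n = npair (Nat.div2 n) (Nat.b2n (Nat.odd n)).
Proof.
  unfold halve; induction n as [|n IH]; [reflexivity|].
  rewrite iter_S, IH.
  rewrite nsnd_npair, nfst_npair, Nat.odd_succ, <- Nat.negb_odd.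
  replace (Nat.div2 (S n)) with (Nat.div2 n + Nat.b2n (Nat.odd n)).
  - destruct (Nat.odd n); cbn [Nat.b2n Nat.eqb negb];
      rewrite ?Nat.add_0_r, ?Nat.add_1_r; reflexivity.
  - pose proof (Nat.div2_odd n); pose proof (Nat.div2_odd (S n)).
    rewrite Nat.odd_succ, <- Nat.negb_odd in H0.
    destruct (Nat.odd n); cbn [Nat.b2n negb] in *; lia.
Qed.

Lemma total_halve : total halve.
Proof. unfold halve; total_tac. Qed.

Lemma total_div2 : total Nat.div2.
Proof.
  apply (total_ext (fun m => nfst (halve m))).
  - intros m; now rewrite halve_spec, nfst_npair.
  - apply total_nfst, total_halve.
Qed.
#[export] Hint Resolve total_div2 : total.

Definition oddn (n : nat) : nat := Nat.b2n (Nat.odd n).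

Lemma total_oddn : total oddn.
Proof.
  apply (total_ext (fun m => nsnd (halve m))).
  - intros m; now rewrite halve_spec, nsnd_npair.
  - apply total_nsnd, total_halve.
Qed.
#[export] Hint Resolve total_oddn : total.

Definition ndist (a b : nat) : nat := (a - b) + (b - a).

Lemma total2_ndist : total2 ndist.
Proof. unfold ndist; total_tac. Qed.
#[export] Hint Resolve total2_ndist : total.

Lemma ndist_eqb a b : Nat.eqb (ndist a b) 0 = Nat.eqb a b.
Proof.
  unfold ndist; destruct (Nat.eqb_spec (a - b + (b - a)) 0),
    (Nat.eqb_spec a b); auto; lia.
Qed.

Definition sg (n : nat) : nat := if Nat.eqb n 0 then 0 else 1.

Lemma total_sg : total sg.
Proof. unfold sg; total_tac. Qed.
#[export] Hint Resolve total_sg : total.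

(** ** Streams of numbers coded by nested pairs *)

(** Every number codes a stream that is eventually zero, because 0 is the pair
    of 0 and 0. *)
Definition sget (z i : nat) : nat := nfst (Nat.iter i nsnd z).

Lemma total2_sget : total2 sget.
Proof.
  unfold sget.
  apply (total_ext (fun m => nfst (Nat.iter (nsnd m) (fun x => nsnd x) (nfst m)))).
  - reflexivity.
  - total_tac.
Qed.
#[export] Hint Resolve total2_sget : total.

Lemma sget_0 z : sget z 0 = nfst z.
Proof. reflexivity. Qed.

Lemma sget_S z i : sget z (S i) = sget (nsnd z) i.
Proof. unfold sget; now rewrite iter_S_r. Qed.

Lemma sget_zero i : sget 0 i = 0.
Proof. induction i as [|i IH]; [reflexivity|rewrite sget_S; exact IH]. Qed.

Fixpoint sset (z i v : nat) : nat :=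
  match i with
  | 0 => npair v (nsnd z)
  | S i => npair (nfst z) (sset (nsnd z) i v)
  end.

Lemma sget_sset z i v j :
  sget (sset z i v) j = if Nat.eqb j i then v else sget z j.
Proof.
  revert z j; induction i as [|i IH]; intros z [|j]; cbn [sset].
  - now rewrite sget_0, nfst_npair.
  - now rewrite !sget_S, nsnd_npair.
  - now rewrite !sget_0, nfst_npair.
  - rewrite !sget_S, nsnd_npair, IH; reflexivity.
Qed.

(** The prefix before [i] is moved to an accumulator, last entry first, and
    then back. *)
Lemma total_sset z i v : total z -> total i -> total v ->
  total (fun m => sset (z m) (i m) (v m)).
Proof.
  intros Hz Hi Hv.
  set (down := fun s => npair (npair (nfst (nsnd s)) (nfst s))
    (nsnd (nsnd s))).
  set (up := fun s => npair (nsnd (nfst s)) (npair (nfst (nfst s)) (nsnd s))).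
  set (mid := fun w s => npair (nfst s) (npair w (nsnd (nsnd s)))).
  assert (H : forall w k a y, Nat.iter k (fun s => up s)
    (mid w (Nat.iter k (fun s => down s) (npair a y))) = npair a (sset y k w)).
  { intros w; induction k as [|k IH]; intros a y.
    - unfold mid; cbn [Nat.iter nat_rect sset]; np; reflexivity.
    - rewrite iter_S, iter_S_r.
      replace (down (npair a y)) with (npair (npair (nfst y) a) (nsnd y))
        by (unfold down; np; reflexivity).
      rewrite IH; unfold up; np; reflexivity. }
  apply (total_ext (fun m => nsnd (Nat.iter (i m) (fun s => up s)
    (mid (v m) (Nat.iter (i m) (fun s => down s) (npair 0 (z m))))))).
  - intros m; rewrite H; apply nsnd_npair.
  - unfold up, down, mid; cbv beta; total_tac.
Qed.

(** * Indices: the s-m-n theorem *)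

Definition enc_action (a : action) : nat :=
  let '(w, d, q) := a in
  npair (Nat.b2n w)
    (npair (match d with Left => 0 | Right => 1 | Stay => 2 end) q).

Definition enc_instr (i : instr) : nat :=
  match i with
  | Scan j a0 a1 =>
      npair 0 (npair j (npair (enc_action a0) (enc_action a1)))
  | Query j x y => npair 1 (npair j (npair x y))
  end.

Definition push (l : list instr) (z : nat) : nat :=
  fold_right (fun i z => npair (enc_instr i) z) z l.

Definition enc_machine (p : machine) : nat := npair (length p) (push p 0).

Lemma decode_enc_action a : decode_action (enc_action a) = a.
Proof.
  destruct a as [[w d] q]; unfold decode_action, enc_action; np.
  now destruct w, d.
Qed.

Lemma decode_enc_instr i : decode_instr (enc_instr i) = i.
Proof.
  destruct i; unfold decode_instr, enc_instr; np; cbn;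
    now rewrite ?decode_enc_action.
Qed.

Lemma decode_enc_machine p : decode_machine (enc_machine p) = p.
Proof.
  unfold decode_machine, enc_machine; np.
  change (map (fun q => decode_instr (sget (push p 0) q)) (seq 0 (length p))
    = p).
  induction p as [|i p IH]; [reflexivity|]; cbn [length seq map push fold_right].
  fold (push p 0); f_equal.
  - rewrite sget_0; np; apply decode_enc_instr.
  - rewrite <- IH at 2; rewrite <- seq_shift, map_map; apply map_ext; intros q.
    rewrite sget_S; np; reflexivity.
Qed.

Lemma push_app l l' z : push (l ++ l') z = push l (push l' z).
Proof. apply fold_right_app. Qed.

(** All that varies with the base address is that address itself, so the code
    of a fixed command is a computable function of where it is placed. *)
Lemma total_push_asm c : forall b z, total b -> total z ->
  total (fun m => push (asm c (b m)) (z m)).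
Proof.
  induction c; intros b z Hb Hz; cbn [asm];
    try (cbn [push fold_right enc_instr enc_action Nat.b2n]; total_tac).
  - apply (total_ext (fun m =>
      push (asm c1 (b m)) (push (asm c2 (b m + len c1)) (z m)))).
    + intros m; now rewrite push_app.
    + apply IHc1; auto; apply IHc2; auto; total_tac.
  - apply (total_ext (fun m =>
      push [Scan j (false, Left, S (b m)) (false, Left, S (b m));
            Scan j (false, Right, b m + (3 + len c))
              (true, Right, S (S (b m)))]
        (push (asm c (S (S (b m))))
           (push [Scan j (false, Stay, b m) (false, Stay, b m)] (z m))))).
    + intros m; now rewrite !push_app.
    + cbn [push fold_right enc_instr enc_action Nat.b2n].
      assert (total (fun m => push (asm c (S (S (b m))))
        (push [Scan j (false, Stay, b m) (false, Stay, b m)] (z m)))).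
      { apply (IHc (fun m => S (S (b m))) (fun m =>
          push [Scan j (false, Stay, b m) (false, Stay, b m)] (z m)));
          cbn [push fold_right enc_instr enc_action Nat.b2n]; total_tac. }
      cbn [push fold_right enc_instr enc_action Nat.b2n] in *.
      repeat apply total_pair; auto; total_tac.
Qed.

Definition load_instr (i : nat) : instr :=
  Scan 1 (true, Right, S i) (true, Right, S i).

(** The parameter is part of the code, one instruction for each unit. *)
Definition load (a : nat) : list instr := map load_instr (seq 0 a).

Lemma total_push_load z : total z -> total (fun a => push (load a) (z a)).
Proof.
  intros Hz.
  set (F := fun s => npair (pred (nfst s))
    (npair (enc_instr (load_instr (pred (nfst s)))) (nsnd s))).
  apply (total_ext (fun a =>
    nsnd (Nat.iter a (fun s => F s) (npair a (z a))))).
  - intros a; enough (H : forall k, k <= a ->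
      Nat.iter k (fun s => F s) (npair a (z a)) =
      npair (a - k) (push (map load_instr (seq (a - k) k)) (z a))).
    { rewrite H, Nat.sub_diag by lia; apply nsnd_npair. }
    induction k as [|k IH]; intros Hk.
    + now rewrite Nat.sub_0_r.
    + rewrite iter_S, IH by lia; unfold F; np.
      replace (pred (a - k)) with (a - S k) by lia; cbn [seq map push fold_right].
      now replace (S (a - S k)) with (a - k) by lia.
  - unfold F, load_instr; cbn [enc_instr enc_action Nat.b2n]; total_tac.
Qed.

Definition smn_cmd (c : prog) : cmd :=
  Seq (transfer 0 2) (Seq (pack 1 2 0) (cmd_of c 0)).

(** The head of tape 0 starts at the left end of the input; the instruction
    between the two parts moves it to the right end, as in a counter. *)
Definition smn_machine (c : prog) (a : nat) : machine :=
  load a ++ Scan 0 (false, Stay, S a) (true, Right, a) ::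
  asm (smn_cmd c) (S a).

Definition smn (c : prog) (a : nat) : nat := enc_machine (smn_machine c a).

Lemma total_smn c : total (smn c).
Proof.
  apply (total_ext (fun a => npair (S (a + len (smn_cmd c)))
    (push (load a) (push [Scan 0 (false, Stay, S a) (true, Right, a)]
       (push (asm (smn_cmd c) (S a)) 0))))).
  - intros a; unfold smn, enc_machine, smn_machine; f_equal.
    + rewrite length_app; unfold load; rewrite length_map, length_seq.
      cbn [length]; rewrite length_asm; lia.
    + rewrite push_app; symmetry; apply f_equal, (push_app [_]).
  - apply total_pair; [total_tac|].
    apply (total_push_load (fun a => push _ (push _ 0))).
    cbn [push fold_right enc_instr enc_action Nat.b2n].
    apply total_pair; [total_tac|].
    apply (total_push_asm (smn_cmd c) (fun a => S a) (fun _ => 0)); total_tac.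
Qed.

Lemma installed_self p : installed p 0 p.
Proof. intros i x H; exact H. Qed.

Lemma reach_load O p a m : installed p 0 (load a) ->
  exists ts, reach O p (start m) (a, ts) /\
    ts 0 = ([], repeat true m) /\ holds (ts 1) a /\
    forall j, 1 < j -> holds (ts j) 0.
Proof.
  intros Hp; enough (H : forall i, i <= a ->
    exists ts, reach O p (start m) (i, ts) /\
      ts 0 = ([], repeat true m) /\ holds (ts 1) i /\
      forall j, 1 < j -> holds (ts j) 0) by (apply H; lia).
  induction i as [|i IH]; intros Hi.
  - eexists; split; [apply reach_refl|]; cbn; split; [reflexivity|split].
    + now exists 0, 0.
    + intros [|[|j]] Hj; try lia; now exists 0, 0.
  - destruct IH as (ts & R & H0 & H1 & H2); [lia|].
    eexists; split; [|split; [|split]].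
    + eapply reach_trans; [exact R|].
      eapply scan_reach; [|now rewrite (holds_blank _ _ H1)|reflexivity
        |apply reach_refl].
      apply (Hp i (load_instr i)).
      unfold load; rewrite nth_error_map, nth_error_seq.
      destruct (Nat.ltb_spec i a); [reflexivity|lia].
    + exact H0.
    + rewrite set_tape_same; now apply holds_inc.
    + intros [|[|j]] Hj; try lia; apply H2; lia.
Qed.

Lemma reach_rewind O p a q ts l r :
  nth_error p a = Some (Scan 0 (false, Stay, q) (true, Right, a)) ->
  ts 0 = (repeat true l, repeat true r) ->
  exists ts', reach O p (a, ts) (q, ts') /\ holds (ts' 0) (l + r) /\
    forall j, 0 < j -> ts' j = ts j.
Proof.
  intros Hp; revert l ts; induction r as [|r IH]; intros l ts H.
  - eexists; split; [|split].
    + eapply scan_reach; [exact Hp| |reflexivity|apply reach_refl].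
      now rewrite H.
    + rewrite set_tape_same, H, Nat.add_0_r; exists 0, 1.
      cbn; now rewrite app_nil_r.
    + intros [|j] Hj; [lia|reflexivity].
  - destruct (IH (S l) (set_tape ts 0 (shift Right (write true (ts 0)))))
      as (ts' & R & H0 & H1).
    + now rewrite set_tape_same, H.
    + exists ts'; split; [|split].
      * eapply scan_reach; [exact Hp| |reflexivity|exact R]; now rewrite H.
      * now rewrite Nat.add_succ_r.
      * intros [|j] Hj; [lia|]; now rewrite H1.
Qed.

Lemma smn_correct O c a m k :
  ev O c (npair a m) k -> computes O (smn c a) m k.
Proof.
  intros He; unfold computes, computes_in, smn.
  rewrite decode_enc_machine; set (p := smn_machine c a).
  assert (Hlen : length p = S a + len (smn_cmd c)).
  { unfold p, smn_machine, load.
    rewrite length_app, length_map, length_seq; cbn [length].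
    rewrite length_asm; lia. }
  destruct (installed_app p 0 (load a) _ (installed_self p)) as [I1 I2].
  replace (0 + length (load a)) with a in I2
    by (unfold load; now rewrite length_map, length_seq).
  apply installed_cons in I2 as [I2 I3].
  destruct (reach_load O p a m I1) as (ts1 & R1 & H0 & H1 & H2).
  destruct (reach_rewind O p a (S a) ts1 0 m I2 H0) as (ts2 & R2 & K0 & K1).
  set (st := fun j => match j with 0 => m | 1 => a | _ => 0 end).
  assert (Hst : agree ts2 st).
  { intros [|[|j]]; cbn; [exact K0| |]; rewrite K1 by lia; auto.
    apply H2; lia. }
  assert (Hrun : run O (smn_cmd c) st (upd (upd (upd st 0 0) 1 0) 0 k)).
  { eapply run_eq.
    - eapply run_seq; [apply run_transfer; lia|].
      eapply run_seq; [apply run_pack; try lia; reflexivity|].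
      eapply cmd_of_correct; [exact He| |].
      { unfold upd, st; cbn [Nat.eqb]; now rewrite Nat.add_0_r. }
      intros [|[|[|i]]] Hi; cbn; lia.
    - apply functional_extensionality; intros [|[|[|i]]]; reflexivity. }
  destruct (asm_correct O _ _ _ Hrun p (S a) ts2 I3 Hst) as (ts3 & R3 & A3).
  destruct (reach_trans _ _ _ _ _ R1 (reach_trans _ _ _ _ _ R2 R3)) as [n Hn].
  exists n; eexists; split; [exact Hn|]; split.
  - apply nth_error_None; cbn [fst]; lia.
  - exact (holds_marks _ _ (A3 0)).
Qed.

Definition index (c : prog) : nat := smn (PComp c PSnd) 0.

Lemma index_correct O c m k : ev O c m k -> computes O (index c) m k.
Proof.
  intros H; apply smn_correct; econstructor; [apply ev_snd_eq, nsnd_npair|auto].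
Qed.

(** * A universal program *)

(** Half-tapes are coded in binary, the cell next to the head being the last
    digit.  Blanks at the far end do not change the code, and a head movement is
    a doubling on one side and a halving on the other. *)
Definition bits (l : list bool) : nat :=
  fold_right (fun b n => Nat.b2n b + (n + n)) 0 l.

Lemma b2n_double_odd b n : oddn (Nat.b2n b + (n + n)) = Nat.b2n b.
Proof.
  unfold oddn; replace (Nat.b2n b + (n + n)) with (Nat.b2n b + 2 * n) by lia.
  rewrite Nat.odd_add_mul_2; now destruct b.
Qed.

Lemma b2n_double_div2 b n : Nat.div2 (Nat.b2n b + (n + n)) = n.
Proof.
  pose proof (Nat.div2_odd (Nat.b2n b + (n + n))) as H.
  pose proof (b2n_double_odd b n) as H'; unfold oddn in H'; lia.
Qed.

Lemma oddn_bits l : oddn (bits l) = Nat.b2n (hd false l).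
Proof. destruct l; [reflexivity|apply b2n_double_odd]. Qed.

Lemma div2_bits l : Nat.div2 (bits l) = bits (tl l).
Proof. destruct l; [reflexivity|apply b2n_double_div2]. Qed.

Definition pop (n : nat) : nat :=
  nfst (Nat.iter n (fun s => npair (nfst s + oddn (nsnd s))
                                   (Nat.div2 (nsnd s))) (npair 0 n)).

Lemma total_pop : total pop.
Proof. unfold pop; total_tac. Qed.
#[export] Hint Resolve total_pop : total.

Lemma pop_bits l : pop (bits l) = count_occ Bool.bool_dec l true.
Proof.
  unfold pop; enough (H : forall k a, bits l <= k ->
    nfst (Nat.iter k (fun s => npair (nfst s + oddn (nsnd s))
      (Nat.div2 (nsnd s))) (npair a (bits l))) =
    a + count_occ Bool.bool_dec l true) by (rewrite H; lia).
  assert (Z : forall k a, nfst (Nat.iter k (fun s =>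
    npair (nfst s + oddn (nsnd s)) (Nat.div2 (nsnd s))) (npair a 0)) = a).
  { induction k as [|k IH]; intros a; [apply nfst_npair|].
    rewrite iter_S_r; np; cbn [oddn]; change (oddn 0) with 0.
    rewrite Nat.add_0_r; apply IH. }
  induction l as [|b l IH]; intros k a Hk; [rewrite Z; cbn; lia|].
  destruct k as [|k].
  - cbn [bits fold_right] in Hk; fold (bits l) in Hk.
    destruct b; cbn [Nat.b2n] in Hk; [lia|].
    specialize (IH 0 0 ltac:(lia)); cbn [Nat.iter nat_rect] in IH |- *.
    rewrite nfst_npair in IH |- *.
    cbn [count_occ]; destruct (Bool.bool_dec false true); [discriminate|lia].
  - rewrite iter_S_r; np; rewrite oddn_bits, div2_bits; cbn [hd tl].
    cbn [bits fold_right] in Hk; fold (bits l) in Hk.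
    rewrite IH by (destruct b; cbn [Nat.b2n] in Hk; lia).
    destruct b; cbn; lia.
Qed.

Definition tape_code (t : tape) : nat := npair (bits (fst t)) (bits (snd t)).

Definition marks_code (t : nat) : nat := pop (nfst t) + pop (nsnd t).

Lemma total_marks_code : total marks_code.
Proof. unfold marks_code; total_tac. Qed.
#[export] Hint Resolve total_marks_code : total.

Lemma marks_tape_code t : marks_code (tape_code t) = marks t.
Proof.
  unfold marks_code, tape_code, marks; np.
  now rewrite !pop_bits, count_occ_app.
Qed.

Definition shift_code (d l r : nat) : nat :=
  if Nat.eqb d 0 then npair (Nat.div2 l) (oddn l + (r + r))
  else if Nat.eqb (pred d) 0 then npair (oddn r + (l + l)) (Nat.div2 r)
  else npair l r.

(** A relation, because not every sequence of tapes is coded by a stream. *)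
Definition config_rep (x : nat) (c : config) : Prop :=
  nfst x = fst c /\ forall j, sget (nsnd x) j = tape_code (snd c j).

Definition opcode (e x : nat) : nat := sget (nsnd e) (nfst x).

Definition scan_next (e x : nat) : nat :=
  (fun i t =>
     (fun a =>
        npair (nsnd (nsnd a))
          (sset (nsnd x) (nfst (nsnd i))
             (shift_code (nfst (nsnd a)) (nfst t)
                (sg (nfst a) + (Nat.div2 (nsnd t) + Nat.div2 (nsnd t))))))
     (if Nat.eqb (oddn (nsnd t)) 0 then nfst (nsnd (nsnd i))
      else nsnd (nsnd (nsnd i))))
  (opcode e x) (sget (nsnd x) (nfst (nsnd (opcode e x)))).

Definition asked (e x : nat) : nat :=
  marks_code (sget (nsnd x) (nfst (nsnd (opcode e x)))).

Definition ask_next (e x b : nat) : nat :=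
  npair (if Nat.eqb b 0 then nsnd (nsnd (nsnd (opcode e x)))
         else nfst (nsnd (nsnd (opcode e x)))) (nsnd x).

Lemma total2_opcode : total2 opcode.
Proof. unfold opcode; total_tac. Qed.
#[export] Hint Resolve total2_opcode : total.

Lemma total2_asked : total2 asked.
Proof. unfold asked; total_tac. Qed.
#[export] Hint Resolve total2_asked : total.

Lemma total_ask_next e x b : total e -> total x -> total b ->
  total (fun m => ask_next (e m) (x m) (b m)).
Proof. intros; unfold ask_next; total_tac. Qed.

Lemma total_shift_code d l r : total d -> total l -> total r ->
  total (fun m => shift_code (d m) (l m) (r m)).
Proof. intros; unfold shift_code; total_tac. Qed.

Lemma total2_scan_next : total2 scan_next.
Proof.
  unfold scan_next, total2; cbv beta.
  apply total_pair; [total_tac|].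
  apply total_sset; [total_tac|total_tac|].
  apply total_shift_code; total_tac.
Qed.
#[export] Hint Resolve total2_scan_next : total.

Lemma decode_machine_nth e q :
  nth_error (decode_machine e) q =
  if Nat.ltb q (nfst e) then Some (decode_instr (sget (nsnd e) q)) else None.
Proof.
  unfold decode_machine; rewrite nth_error_map, nth_error_seq.
  destruct (Nat.ltb q (nfst e)); reflexivity.
Qed.

Definition running (e x : nat) : nat := nfst e - nfst x.

Lemma total2_running : total2 running.
Proof. unfold running; total_tac. Qed.
#[export] Hint Resolve total2_running : total.

Lemma halted_running e x c : config_rep x c ->
  nth_error (decode_machine e) (fst c) = None <-> running e x = 0.
Proof.
  intros [Hq _]; rewrite decode_machine_nth; unfold running; rewrite Hq.
  destruct (Nat.ltb_spec (fst c) (nfst e)); split; intros; try easy; lia.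
Qed.

Lemma shift_code_correct d w t :
  shift_code (match d with Left => 0 | Right => 1 | Stay => 2 end)
    (bits (fst t)) (bits (w :: tl (snd t)))
  = tape_code (shift d (write w t)).
Proof.
  destruct t as [l r]; destruct d; unfold shift_code, tape_code;
    cbn [Nat.eqb pred shift write fst snd]; rewrite ?oddn_bits, ?div2_bits;
    reflexivity.
Qed.

Lemma step_rep O e x c c' :
  config_rep x c -> step O (decode_machine e) c c' ->
  running e x <> 0 /\
  ((nfst (opcode e x) = 0 /\ config_rep (scan_next e x) c') \/
   (nfst (opcode e x) <> 0 /\ exists b, O (asked e x) b /\
      config_rep (ask_next e x (Nat.b2n b)) c')).
Proof.
  intros Hx Hs; split.
  { intros H; apply (halted_running e x c Hx) in H.
    inversion Hs; subst; cbn in H; congruence. }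
  destruct Hx as [Hq Hz].
  destruct Hs as [q ts j a0 a1 w d q' Hi Ha|q ts j qy qn b Hi Hb];
    cbn [fst snd] in Hq, Hz; rewrite decode_machine_nth, <- Hq in Hi;
    destruct (Nat.ltb (nfst x) (nfst e)); try discriminate; injection Hi as Hi;
    fold (opcode e x) in Hi; unfold decode_instr in Hi;
    destruct (Nat.eqb_spec (nfst (opcode e x)) 0) as [E|E]; try discriminate.
  - left; split; auto; injection Hi as Hj H0 H1; unfold scan_next; cbv beta.
    rewrite Hj, Hz; set (t := tape_code (ts j)).
    set (a := if Nat.eqb (oddn (nsnd t)) 0 then _ else _).
    assert (E' : decode_action a = (w, d, q')).
    { rewrite <- Ha; unfold a, t, tape_code; np; rewrite oddn_bits.
      unfold scanned; destruct (hd false (snd (ts j))); auto. }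
    unfold decode_action in E'; injection E' as Ew Ed Eq.
    split; cbn [fst snd]; np; [exact Eq|].
    intros i; rewrite sget_sset; unfold set_tape.
    destruct (Nat.eqb i j); auto.
    assert (El : nfst t = bits (fst (ts j))) by apply nfst_npair.
    assert (Er : nsnd t = bits (snd (ts j))) by apply nsnd_npair.
    rewrite El, Er.
    rewrite <- shift_code_correct, div2_bits.
    replace (sg (nfst a)) with (Nat.b2n w)
      by (rewrite <- Ew; unfold sg; now destruct (Nat.eqb (nfst a) 0)).
    cbn [bits fold_right]; fold (bits (tl (snd (ts j)))).
    rewrite <- Ed; destruct (nfst (nsnd a)) as [|[|n]]; reflexivity.
  - right; split; auto; injection Hi as Hj Hy Hn; exists b; split.
    + unfold asked; now rewrite Hj, Hz, marks_tape_code.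
    + unfold ask_next; split; cbn [fst snd]; np; auto.
      rewrite Hy, Hn; now destruct b.
Qed.

Definition ones (m : nat) : nat := Nat.iter m (fun x => S (x + x)) 0.

Lemma total_ones : total ones.
Proof. unfold ones; total_tac. Qed.
#[export] Hint Resolve total_ones : total.

Definition start_code (m : nat) : nat := npair 0 (npair (npair 0 (ones m)) 0).

Lemma total_start_code : total start_code.
Proof. unfold start_code; total_tac. Qed.
#[export] Hint Resolve total_start_code : total.

Lemma start_rep m : config_rep (start_code m) (start m).
Proof.
  unfold start_code; split; np; [reflexivity|]; intros [|j]; cbn [snd start].
  - rewrite sget_0; np; unfold tape_code; f_equal; cbn [Nat.eqb snd].
    induction m as [|m IH]; [reflexivity|].
    cbn [repeat bits fold_right Nat.b2n]; fold (bits (repeat true m)).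
    unfold ones; rewrite iter_S; fold (ones m); now rewrite IH.
  - rewrite sget_S; np; apply sget_zero.
Qed.

Definition out_code (x : nat) : nat := marks_code (sget (nsnd x) 0).

Lemma total_out_code : total out_code.
Proof. unfold out_code; total_tac. Qed.
#[export] Hint Resolve total_out_code : total.

Lemma out_rep x c : config_rep x c -> out_code x = marks (snd c 0).
Proof.
  intros [_ H]; unfold out_code; now rewrite H, marks_tape_code.
Qed.

(** One step of a machine is a total computable function of the coded
    configuration, except that a query needs the answer of the oracle. *)
Lemma universal : {u : prog |
  forall O e m k, computes O e m k -> ev O u (npair e m) k}.
Proof.
  (* The state of the loop is the pair of the index and the configuration. *)
  assert (test : total (fun s => running (nfst s) (nsnd s))) by total_tac.
  assert (isask : total (fun s => nfst (opcode (nfst s) (nsnd s))))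
    by total_tac.
  assert (scan : total (fun s =>
    npair (nfst s) (scan_next (nfst s) (nsnd s)))) by total_tac.
  assert (question : total (fun s => asked (nfst s) (nsnd s))) by total_tac.
  assert (reply : total (fun u => npair (nfst (nfst u))
    (ask_next (nfst (nfst u)) (nsnd (nfst u)) (nsnd u)))).
  { apply total_pair; [total_tac|apply total_ask_next; total_tac]. }
  assert (init : total (fun m => npair (nfst m) (start_code (nsnd m))))
    by total_tac.
  assert (out : total (fun s => out_code (nsnd s))) by total_tac.
  destruct test as [test Ht], isask as [isask Hi], scan as [scan Hs],
    question as [question Hq], reply as [reply Hr], init as [init H0],
    out as [out Ho].
  set (body := PIf isask
    (PComp reply (PPair PId (PComp PAsk question))) scan).
  exists (PComp out (PComp (PWhile test body) init)).
  intros O e m k (n & c & Hn & Hh & Hk).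
  assert (H : forall n c1 x, steps O (decode_machine e) n c1 c ->
    config_rep x c1 -> exists y,
    ev O (PWhile test body) (npair e x) (npair e y) /\ config_rep y c).
  { clear n Hn; intros n c1 x Hn; revert x; induction Hn; intros x Hx.
    - exists x; split; auto; apply ev_while_end.
      specialize (Ht O (npair e x)); rewrite nfst_npair, nsnd_npair in Ht.
      now rewrite (proj1 (halted_running e x _ Hx) Hh) in Ht.
    - destruct (step_rep _ _ _ _ _ Hx H) as [Hrun Hstep].
      assert (Hb : exists y,
        ev O body (npair e x) (npair e y) /\ config_rep y c').
      { pose proof (Hi O (npair e x)) as Hi'.
        rewrite nfst_npair, nsnd_npair in Hi'.
        destruct Hstep as [[E Hy]|(E & b & Hb & Hy)].
        - eexists; split; [|exact Hy]; apply ev_if_0; [congruence|].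
          specialize (Hs O (npair e x)).
          now rewrite nfst_npair, nsnd_npair in Hs.
        - eexists; split; [|exact Hy].
          eapply ev_if_S with (v := pred (nfst (opcode e x))).
          { replace (S _) with (nfst (opcode e x)) by lia; auto. }
          econstructor; [econstructor; [constructor|econstructor]|].
          + specialize (Hq O (npair e x)).
            rewrite nfst_npair, nsnd_npair in Hq; exact Hq.
          + constructor; exact Hb.
          + specialize (Hr O (npair (npair e x) (Nat.b2n b))).
            now rewrite !nfst_npair, !nsnd_npair in Hr. }
      destruct Hb as (y & Hb & Hy).
      destruct (IHHn Hh Hk y Hy) as (z & Hz & Hc).
      exists z; split; auto.
      eapply ev_while with (v := pred (running e x)); [|exact Hb|exact Hz].
      replace (S _) with (running e x) by lia.
      specialize (Ht O (npair e x)); now rewrite nfst_npair, nsnd_npair in Ht. }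
  destruct (H _ _ _ Hn (start_rep m)) as (y & Hy & Hc).
  econstructor; [econstructor|].
  - specialize (H0 O (npair e m)); rewrite nfst_npair, nsnd_npair in H0.
    exact H0.
  - exact Hy.
  - specialize (Ho O (npair e y)); rewrite nsnd_npair in Ho.
    rewrite (out_rep _ _ Hc), Hk in Ho; exact Ho.
Qed.

Definition univ : prog := proj1_sig universal.

Lemma ev_univ O e m k : computes O e m k -> ev O univ (npair e m) k.
Proof. apply (proj2_sig universal). Qed.

(** ** Partial application and the recursion theorem *)

(** [papply e a] is an index of [m |-> e . <a, m>]. *)
Definition papply (e a : nat) : nat :=
  smn (PComp univ (PPair (PComp PFst PFst) (PPair (PComp PSnd PFst) PSnd)))
    (npair e a).

Lemma total2_papply : total2 papply.
Proof.
  unfold papply, total2; apply (total_comp (smn _)); [apply total_smn|].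
  total_tac.
Qed.
#[export] Hint Resolve total2_papply : total.

Lemma papply_correct O e a m k :
  computes O e (npair a m) k -> computes O (papply e a) m k.
Proof.
  intros H; apply smn_correct; econstructor; [|apply ev_univ, H].
  constructor; [|constructor].
  - econstructor; [apply ev_fst_eq, nfst_npair|apply ev_fst_eq, nfst_npair].
  - econstructor; [apply ev_fst_eq, nfst_npair|apply ev_snd_eq, nsnd_npair].
  - apply ev_snd_eq, nsnd_npair.
Qed.

(** The index is [papply x0 x0], where [x0] computes
    [<x, m> |-> G <papply x x, m>]. *)
Lemma recursion_theorem G :
  {i : nat | forall O m k, ev O G (npair i m) k -> computes O i m k}.
Proof.
  assert (H : total (fun x => papply x x)) by total_tac.
  destruct H as [diag Hd].
  set (x0 := index (PComp G (PPair (PComp diag PFst) PSnd))).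
  exists (papply x0 x0); intros O m k H.
  apply papply_correct, index_correct; econstructor; [|exact H].
  constructor; [|apply ev_snd_eq, nsnd_npair].
  econstructor; [apply ev_fst_eq, nfst_npair|apply Hd].
Qed.

(** ** Relative computability *)

Definition call (e : nat) : prog := PComp univ (PPair (const e) PId).

Lemma ev_call O e m k : computes O e m k -> ev O (call e) m k.
Proof.
  intros H; econstructor; [|apply ev_univ, H].
  constructor; [apply ev_const|constructor].
Qed.

Fixpoint plug (d c : prog) : prog :=
  match c with
  | PAsk => d
  | PPair f g => PPair (plug d f) (plug d g)
  | PComp f g => PComp (plug d f) (plug d g)
  | PIf t f g => PIf (plug d t) (plug d f) (plug d g)
  | PWhile t f => PWhile (plug d t) (plug d f)
  | c => c
  end.

Lemma ev_plug O O' d :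
  (forall q b, O q b -> ev O' d q (Nat.b2n b)) ->
  forall c m k, ev O c m k -> ev O' (plug d c) m k.
Proof.
  intros Hd c m k H; induction H; cbn [plug]; eauto using ev.
Qed.

(** The universal program is run with its queries replaced by a subroutine. *)
Lemma oracle_reduction O O' d e :
  (forall q b, O q b -> ev O' d q (Nat.b2n b)) ->
  exists e', forall m k, computes O e m k -> computes O' e' m k.
Proof.
  intros Hd; exists (index (plug d (call e))); intros m k H.
  apply index_correct, (ev_plug O); auto; apply ev_call, H.
Qed.

Definition decided_by (X : Real) (c : prog) (Y : Real) : Prop :=
  forall m, ev (answers X) c m (Nat.b2n (Y m)).

Lemma computable_in_decided X Y :
  computable_in X Y -> exists c, decided_by X c Y.
Proof. intros [e He]; exists (call e); intros m; apply ev_call, He. Qed.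

Lemma decided_finite_change X Y Z :
  (exists c, decided_by X c Y) -> differ_finitely Z Y ->
  exists c, decided_by X c Z.
Proof.
  intros HY [l Hl]; revert Z Hl; induction l as [|a l IH]; intros Z Hl.
  - destruct HY as [c Hc]; exists c; intros m; replace (Z m) with (Y m); auto.
    destruct (Bool.bool_dec (Z m) (Y m)) as [|H]; auto; now destruct (Hl m H).
  - set (Z' := fun m => if Nat.eqb m a then Y m else Z m).
    destruct (IH Z') as [c Hc].
    { unfold Z'; intros m; destruct (Nat.eqb_spec m a) as [|E]; [easy|].
      intros H; destruct (Hl m H); [congruence|auto]. }
    assert (T : total (fun m => ndist m a)) by total_tac.
    destruct T as [t Ht].
    exists (PIf t c (const (Nat.b2n (Z a)))); intros m.
    specialize (Ht (answers X) m).
    destruct (ndist m a) as [|v] eqn:E; pose proof (ndist_eqb m a) as D;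
      rewrite E in D; cbn in D; symmetry in D.
    + apply ev_if_0; [exact Ht|]; apply Nat.eqb_eq in D; subst.
      apply ev_const.
    + eapply ev_if_S; [exact Ht|].
      specialize (Hc m); unfold Z' in Hc; now rewrite D in Hc.
Qed.

(** * The Kleene tree is decidable and infinite *)

Definition no_oracle : oracle := answers (fun _ => false).

(** Every query is answered no.  Halted configurations stay, so that [N] steps
    show the outcome of all computations of length at most [N]. *)
Definition step_code (e x : nat) : nat :=
  if Nat.eqb (running e x) 0 then x
  else if Nat.eqb (nfst (opcode e x)) 0 then scan_next e x
  else ask_next e x 0.

Lemma total2_step_code : total2 step_code.
Proof.
  unfold step_code, total2; cbv beta.
  apply total_if; [total_tac|total_tac|].
  apply total_if; [total_tac|total_tac|apply total_ask_next; total_tac].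
Qed.
#[export] Hint Resolve total2_step_code : total.

Lemma step_code_correct e x c c' :
  config_rep x c -> step no_oracle (decode_machine e) c c' ->
  config_rep (step_code e x) c'.
Proof.
  intros Hx Hs; destruct (step_rep _ _ _ _ _ Hx Hs) as [Hr H].
  unfold step_code; destruct (Nat.eqb_spec (running e x) 0); [easy|].
  destruct H as [[E H]|(E & b & Hb & H)];
    destruct (Nat.eqb_spec (nfst (opcode e x)) 0); try easy.
  unfold no_oracle, answers in Hb; subst b; exact H.
Qed.

Lemma step_total e c : nth_error (decode_machine e) (fst c) <> None ->
  exists c', step no_oracle (decode_machine e) c c'.
Proof.
  destruct c as [q ts]; cbn [fst]; intros H.
  destruct (nth_error (decode_machine e) q) as [[j a0 a1|j x y]|] eqn:E;
    [| |easy].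
  - destruct (if scanned (ts j) then a1 else a0) as [[w d] q'] eqn:Ea.
    eexists; eapply step_scan; eauto.
  - eexists; eapply step_query with (b := false); [exact E|reflexivity].
Qed.

Definition after (N e : nat) : nat :=
  Nat.iter N (step_code e) (start_code e).

Lemma halted_stays e x N :
  running e x = 0 -> Nat.iter N (step_code e) x = x.
Proof.
  intros H; induction N as [|N IH]; [reflexivity|].
  rewrite iter_S, IH; unfold step_code; now rewrite H.
Qed.

Lemma bounded_halting N e k :
  (exists n, n <= N /\ computes_in no_oracle n e e k) <->
  running e (after N e) = 0 /\ out_code (after N e) = k.
Proof.
  unfold after; split.
  - intros (n & Hn & c & Hs & Hh & Hk).
    assert (H : forall x c0, config_rep x c0 ->
      steps no_oracle (decode_machine e) n c0 c ->
      config_rep (Nat.iter n (step_code e) x) c).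
    { clear - e; intros x c0 Hx Hs; revert x Hx.
      induction Hs; intros x Hx; [exact Hx|].
      rewrite iter_S_r; apply IHHs; eapply step_code_correct; eauto. }
    specialize (H _ _ (start_rep e) Hs).
    assert (Hr := proj1 (halted_running _ _ _ H) Hh).
    replace N with ((N - n) + n) by lia; rewrite Nat.iter_add.
    rewrite halted_stays by exact Hr; split; auto.
    rewrite (out_rep _ _ H); exact Hk.
  - intros [Hr Hk].
    assert (H : forall N x c, config_rep x c ->
      running e (Nat.iter N (step_code e) x) = 0 ->
      exists n c', n <= N /\ steps no_oracle (decode_machine e) n c c' /\
        config_rep (Nat.iter N (step_code e) x) c').
    { clear; induction N as [|N IH]; intros x c Hx Hr.
      - exists 0, c; repeat split; auto; try constructor; apply Hx.
      - destruct (Nat.eq_dec (running e x) 0) as [E|E].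
        + exists 0, c; rewrite halted_stays by exact E.
          split; [lia|split; [constructor|exact Hx]].
        + destruct (step_total e c) as [c1 H1].
          { intros H; apply E, (halted_running e x c Hx), H. }
          rewrite iter_S_r in *.
          destruct (IH _ c1 (step_code_correct _ _ _ _ Hx H1) Hr)
            as (n & c' & Hn & Hs & Hc).
          exists (S n), c'; split; [lia|split; [econstructor; eauto|exact Hc]]. }
    destruct (H N _ _ (start_rep e) Hr) as (n & c & Hn & Hs & Hc).
    exists n; split; auto; exists c; split; auto; split.
    + apply (halted_running _ _ _ Hc), Hr.
    + rewrite <- Hk; symmetry; exact (out_rep _ _ Hc).
Qed.

(** The length is kept because the binary number forgets final zeros; single
    bits are read by halving. *)
Definition seq_code (w : list bool) : nat := npair (length w) (bits w).

Definition bit_of (B i : nat) : nat := oddn (Nat.iter i Nat.div2 B).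

Lemma total2_bit_of : total2 bit_of.
Proof.
  unfold bit_of.
  apply (total_ext (fun m =>
    oddn (Nat.iter (nsnd m) (fun x => Nat.div2 x) (nfst m)))); [reflexivity|].
  total_tac.
Qed.
#[export] Hint Resolve total2_bit_of : total.

Lemma bit_of_bits w i : bit_of (bits w) i = Nat.b2n (nth i w false).
Proof.
  unfold bit_of; revert w; induction i as [|i IH]; intros w.
  - cbn [Nat.iter nat_rect]; rewrite oddn_bits; now destruct w.
  - rewrite iter_S_r, div2_bits, IH; destruct w; [now destruct i|reflexivity].
Qed.

(** Zero exactly if program [e], within [N] steps, excludes from the Kleene tree
    the sequence with bits [B]. *)
Definition hit (N B e : nat) : nat :=
  running e (after N e) + ndist (out_code (after N e)) (bit_of B e).

Definition kleene_code (p : nat) : nat :=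
  nsnd (Nat.iter (nfst p)
    (fun s => npair (S (nfst s))
       (if Nat.eqb (hit (nfst p) (nsnd p) (nfst s)) 0 then 0 else nsnd s))
    (npair 0 1)).

Lemma total_kleene_code : total kleene_code.
Proof.
  assert (A : total2 after) by (unfold after; total_tac).
  assert (H : total (fun m =>
    hit (nfst (nfst m)) (nsnd (nfst m)) (nfst (nsnd m)))).
  { unfold hit; total_tac. }
  unfold kleene_code; apply total_nsnd, total_iter; try total_tac.
  unfold total2; apply total_pair; [total_tac|].
  apply total_if; [exact H|total_tac|total_tac].
Qed.
#[export] Hint Resolve total_kleene_code : total.

Lemma hit_spec w e : hit (length w) (bits w) e = 0 <->
  exists n, n <= length w /\
    computes_in no_oracle n e e (Nat.b2n (nth e w false)).
Proof.
  rewrite bounded_halting; unfold hit, ndist; rewrite bit_of_bits; lia.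
Qed.

Lemma kleene_code_spec w :
  (kleene_tree w /\ kleene_code (seq_code w) = 1) \/
  (~ kleene_tree w /\ kleene_code (seq_code w) = 0).
Proof.
  unfold kleene_code, seq_code; np.
  set (F := fun s => npair _ _).
  assert (H : forall k, exists v, Nat.iter k F (npair 0 1) = npair k v /\
    ((v = 1 /\ forall e, e < k -> hit (length w) (bits w) e <> 0) \/
     (v = 0 /\ exists e, e < k /\ hit (length w) (bits w) e = 0))).
  { induction k as [|k (v & Hv & H)].
    - exists 1; split; [reflexivity|left; split; [reflexivity|lia]].
    - rewrite iter_S, Hv; unfold F; np; eexists; split; [reflexivity|].
      destruct (Nat.eqb_spec (hit (length w) (bits w) k) 0) as [E|E].
      + right; split; auto; exists k; auto.
      + destruct H as [[-> H]|[-> (e & He & H)]].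
        * left; split; auto; intros e He.
          destruct (Nat.eq_dec e k) as [->|]; auto; apply H; lia.
        * right; split; auto; exists e; split; auto; lia. }
  destruct (H (length w)) as (v & -> & Hv); np; unfold kleene_tree.
  destruct Hv as [[-> Hv]|[-> (e & He & Hv)]].
  - left; split; auto; intros (e & n & He & Hn & Hc).
    apply (Hv e He), hit_spec; eauto.
  - right; split; auto; intros Hk; apply Hk.
    apply hit_spec in Hv as (n & Hn & Hc); eauto.
Qed.

Lemma kleene_prefix v w :
  length v <= length w ->
  (forall i, i < length v -> nth i v false = nth i w false) ->
  kleene_tree w -> kleene_tree v.
Proof.
  intros Hl Hn Hw (e & n & He & Hn' & Hc); apply Hw.
  exists e, n; split; [lia|split; [lia|]]; now rewrite <- Hn.
Qed.

(** Diagonalization: where program [e] answers 0 within [N] steps, take 1. *)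
Lemma kleene_infinite N : exists w, length w = N /\ kleene_tree w.
Proof.
  set (w := map (fun e =>
    (Nat.eqb (running e (after N e)) 0 && Nat.eqb (out_code (after N e)) 0)%bool)
    (seq 0 N)).
  exists w; unfold w; rewrite length_map, length_seq; split; [reflexivity|].
  intros (e & n & He & Hn & Hc); rewrite length_map, length_seq in He, Hn.
  fold w in Hc; fold no_oracle in Hc.
  assert (H := proj1 (bounded_halting N e _) (ex_intro _ n (conj Hn Hc))).
  destruct H as [Hr Hk]; revert Hk; unfold w.
  rewrite (nth_indep _ false (Nat.eqb (running 0 (after N 0)) 0 &&
    Nat.eqb (out_code (after N 0)) 0)%bool)
    by now rewrite length_map, length_seq.
  rewrite (map_nth (fun e => (Nat.eqb (running e (after N e)) 0 &&
    Nat.eqb (out_code (after N e)) 0)%bool)), seq_nth by exact He.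
  cbn [Nat.add]; rewrite Hr; cbn [Nat.eqb andb].
  destruct (Nat.eqb_spec (out_code (after N e)) 0) as [E|E]; cbn; lia.
Qed.

(** * Set theory in the Kripke model *)

Lemma extends_refl s : extends s s.
Proof. exists []; now rewrite app_nil_r. Qed.

Lemma extends_trans s t u : extends s t -> extends t u -> extends s u.
Proof. intros [a ->] [b ->]; exists (a ++ b); now rewrite app_assoc. Qed.

#[export] Hint Resolve extends_refl extends_trans : core.

Lemma elt_mono x s t h : extends s t -> elt x s h -> elt x t h.
Proof.
  destruct x as [A B Bm f]; intros Hst (a & Ha & <-); exists a; eauto.
Qed.

Lemma keq_iff f g s : keq f g s <->
  (forall t, extends s t -> forall h, elt f t h -> kin h g t) /\
  (forall t, extends s t -> forall h, elt g t h -> kin h f t).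
Proof.
  split; [intros H; destruct H; auto|intros [H1 H2]; now constructor].
Qed.

Lemma kin_iff h f s : kin h f s <-> exists h', elt f s h' /\ keq h h' s.
Proof.
  split; [intros H; destruct H; eauto|intros (h' & H1 & H2)].
  econstructor; eauto.
Qed.

Lemma keq_mono x y s t : extends s t -> keq x y s -> keq x y t.
Proof.
  intros Hst H; apply keq_iff in H as [H1 H2]; apply keq_iff.
  split; intros; [apply H1|apply H2]; eauto.
Qed.

Lemma kin_mono x y s t : extends s t -> kin x y s -> kin x y t.
Proof.
  intros Hst H; apply kin_iff in H as (h & H1 & H2); apply kin_iff.
  exists h; split; [eapply elt_mono|eapply keq_mono]; eauto.
Qed.

Lemma keq_refl x s : keq x x s.
Proof.
  revert s; induction x as [A B Bm f IH]; intros s; apply keq_iff.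
  split; intros t _ h Hh; apply kin_iff; exists h; split; auto;
    destruct Hh as (a & _ & <-); apply IH.
Qed.

Lemma keq_sym x y s : keq x y s -> keq y x s.
Proof. rewrite !keq_iff; tauto. Qed.

Lemma keq_trans x y z s : keq x y s -> keq y z s -> keq x z s.
Proof.
  revert y z s; induction x as [A B Bm f IH]; intros y z s Hxy Hyz.
  apply keq_iff in Hxy as [X1 X2]; apply keq_iff in Hyz as [Y1 Y2].
  apply keq_iff; split; intros t Ht h Hh.
  - destruct (proj1 (kin_iff _ _ _) (X1 t Ht h Hh)) as (h1 & H1 & E1).
    destruct (proj1 (kin_iff _ _ _) (Y1 t Ht h1 H1)) as (h2 & H2 & E2).
    destruct Hh as (a & _ & <-); apply kin_iff; exists h2; split; eauto.
  - destruct (proj1 (kin_iff _ _ _) (Y2 t Ht h Hh)) as (h1 & H1 & E1).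
    destruct (proj1 (kin_iff _ _ _) (X2 t Ht h1 H1)) as (h2 & H2 & E2).
    apply kin_iff; exists h2; split; auto.
    destruct H2 as (a & _ & <-); apply keq_sym; eapply IH; apply keq_sym; eauto.
Qed.

Lemma kin_keq_l x x' y s : keq x x' s -> kin x y s -> kin x' y s.
Proof.
  intros E H; apply kin_iff in H as (h & H1 & H2); apply kin_iff.
  exists h; split; auto; eapply keq_trans; [apply keq_sym|]; eauto.
Qed.

Lemma kin_keq_r x y y' s : keq y y' s -> kin x y s -> kin x y' s.
Proof.
  intros E H; apply kin_iff in H as (h & H1 & H2).
  apply keq_iff in E as [E _].
  eapply kin_keq_l; [apply keq_sym, H2|]; apply E; auto.
Qed.

Lemma kin_const {A} (f : A -> M) h s :
  kin h (const_set f) s <-> exists a, keq h (f a) s.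
Proof.
  rewrite kin_iff; split.
  - intros (h' & (a & _ & <-) & E); eauto.
  - intros (a & E); exists (f a); split; auto; exists a; split; [exact I|auto].
Qed.

Lemma kin_adjoin x y h s : kin h (adjoin x y) s <-> kin h x s \/ keq h y s.
Proof.
  rewrite !kin_iff; destruct x as [A B Bm f]; split.
  - intros (h' & ([a|] & Ha & <-) & E); [left|now right].
    exists (f a); split; auto; now exists a.
  - intros [(h' & (a & Ha & <-) & E)|E].
    + exists (f a); split; auto; now exists (Some a).
    + exists y; split; auto; now exists None.
Qed.

Lemma kin_upair x y h s : kin h (upair x y) s <-> keq h x s \/ keq h y s.
Proof.
  unfold upair; rewrite kin_const; split.
  - intros [[|] H]; auto.
  - intros [H|H]; [exists true|exists false]; auto.
Qed.

Lemma keq_ext x y s :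
  (forall t, extends s t -> forall h, kin h x t <-> kin h y t) -> keq x y s.
Proof.
  intros H; apply keq_iff; split; intros t Ht h Hh; apply H; auto;
    apply kin_iff; exists h; auto using keq_refl.
Qed.

Lemma upair_keq x y x' y' s :
  keq x x' s -> keq y y' s -> keq (upair x y) (upair x' y') s.
Proof.
  intros Hx Hy; apply keq_ext; intros t Ht h; rewrite !kin_upair.
  apply (keq_mono _ _ _ _ Ht) in Hx, Hy.
  split; intros [H|H]; [left|right|left|right];
    eauto using keq_trans, keq_sym.
Qed.

Lemma opair_keq x y x' y' s :
  keq x x' s -> keq y y' s -> keq (opair x y) (opair x' y') s.
Proof. intros; unfold opair; auto using upair_keq. Qed.

Lemma upair_inv x y a b s : keq (upair x y) (upair a b) s ->
  (keq x a s \/ keq x b s) /\ (keq y a s \/ keq y b s) /\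
  (keq x a s \/ keq y a s) /\ (keq x b s \/ keq y b s).
Proof.
  intros H.
  assert (H1 : forall h, keq h x s \/ keq h y s -> keq h a s \/ keq h b s).
  { intros h Hh; apply kin_upair in Hh; apply kin_upair.
    eapply kin_keq_r; eauto. }
  assert (H2 : forall h, keq h a s \/ keq h b s -> keq h x s \/ keq h y s).
  { intros h Hh; apply kin_upair in Hh; apply kin_upair.
    eapply kin_keq_r; [apply keq_sym|]; eauto. }
  pose proof (H1 x (or_introl (keq_refl _ _))).
  pose proof (H1 y (or_intror (keq_refl _ _))).
  pose proof (H2 a (or_introl (keq_refl _ _))) as Ha.
  pose proof (H2 b (or_intror (keq_refl _ _))) as Hb.
  repeat split; auto; [destruct Ha|destruct Hb]; auto using keq_sym.
Qed.

(** The usual argument for Kuratowski pairs, with its case distinctions, is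
    valid at each node separately: the elements of an unordered pair are the
    same at all nodes. *)
Lemma opair_inj x y a b s :
  keq (opair x y) (opair a b) s -> keq x a s /\ keq y b s.
Proof.
  intros H; apply upair_inv in H as (H1 & H2 & _ & H4).
  assert (Hx : keq x a s).
  { destruct H1 as [H1|H1]; apply upair_inv in H1; tauto. }
  split; auto.
  destruct H2 as [H2|H2]; apply upair_inv in H2 as (_ & Hy & _ & Hy').
  - assert (Hya : keq y a s) by now destruct Hy.
    destruct H4 as [H4|H4]; apply upair_inv in H4 as (_ & _ & _ & H4);
      destruct H4 as [H4|H4]; auto;
      (apply keq_trans with a; auto; apply keq_trans with x; auto;
       now apply keq_sym).
  - destruct Hy as [Hy|Hy]; auto; destruct Hy' as [Hy'|Hy']; auto.
    (* y = a = x = b *)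
    apply keq_trans with a; auto; apply keq_trans with x; auto;
      now apply keq_sym.
Qed.

Lemma empty_kin h s : ~ kin h empty s.
Proof. unfold empty; rewrite kin_const; now intros [[] _]. Qed.

Lemma kin_num h n s : kin h (num n) s <-> exists m, m < n /\ keq h (num m) s.
Proof.
  induction n as [|n IH]; cbn [num].
  - split; [intros H; now apply empty_kin in H|intros (m & Hm & _); lia].
  - rewrite kin_adjoin, IH; split.
    + intros [(m & Hm & E)|E]; [exists m|exists n]; auto.
    + intros (m & Hm & E); destruct (Nat.eq_dec m n) as [->|]; auto.
      left; exists m; split; auto; lia.
Qed.

Lemma num_irrefl n s : ~ kin (num n) (num n) s.
Proof.
  induction n as [n IH] using lt_wf_ind; intros H.
  destruct (proj1 (kin_num _ _ _) H) as (m & Hm & E).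
  apply (IH m Hm); eapply kin_keq_l; [exact E|].
  eapply kin_keq_r; [exact E|exact H].
Qed.

Lemma num_inj m n s : keq (num m) (num n) s -> m = n.
Proof.
  assert (H : forall m n, m < n -> ~ keq (num m) (num n) s).
  { intros a b Hab E; apply (num_irrefl a s).
    eapply kin_keq_r; [apply keq_sym, E|].
    apply kin_num; exists a; auto using keq_refl. }
  intros E; destruct (Nat.lt_trichotomy m n) as [Hl|[Hl|Hl]]; auto.
  - now apply H in E.
  - now apply keq_sym, H in E.
Qed.

(** ** Oracle answers *)

Lemma kin_R L k s : kin (num k) (R_set L) s <-> R_at L s k.
Proof.
  rewrite kin_iff; unfold R_set; cbn [elt]; split.
  - intros (h & (a & Ha & <-) & E); apply num_inj in E; now subst.
  - intros H; exists (num k); split; eauto using keq_refl.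
Qed.

Lemma R_at_iff L s k : R_at L s k <->
  nfst k < length s /\ L (nfst k) (nth (nfst k) s 0) (nsnd k) = true.
Proof.
  split.
  - induction 1 as [s i k H [IH1 IH2]|s i m H].
    + rewrite length_app, app_nth1 by auto; cbn; split; auto; lia.
    + rewrite nfst_npair, nsnd_npair, length_app, app_nth2, Nat.sub_diag by auto.
      cbn; split; auto; lia.
  - induction s as [|i s IH] using rev_ind; [cbn; lia|].
    rewrite length_app; cbn [length]; intros [H1 H2].
    destruct (Nat.eq_dec (nfst k) (length s)) as [E|E].
    + rewrite <- (npair_eta k), E; apply R_new.
      now rewrite E, app_nth2, Nat.sub_diag in H2 by auto.
    + apply R_old, IH; rewrite app_nth1 in H2 by lia; split; auto; lia.
Qed.

Lemma R_answers_mono L s t q b :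
  extends s t -> R_answers L s q b -> R_answers L t q b.
Proof.
  intros Hst; destruct b; cbn.
  - apply kin_mono, Hst.
  - intros H u Hu; apply H; eauto.
Qed.

(** Beyond the length of [s] no answer is available: no is excluded because
    some list entry, a finite modification of [X n], contains the queried
    number, and yes because the column is still empty. *)
Lemma R_answers_columns L X s q b :
  (forall n Y, differ_finitely Y (X n) -> exists i, forall k, L n i k = Y k) ->
  R_answers L s q b ->
  nfst q < length s /\ L (nfst q) (nth (nfst q) s 0) (nsnd q) = b.
Proof.
  intros HL H; destruct b; cbn in H; [now apply kin_R, R_at_iff in H|].
  assert (Hq : nfst q < length s).
  { destruct (Nat.lt_ge_cases (nfst q) (length s)) as [|Hq]; auto; exfalso.
    destruct (HL (nfst q) (fun k => if Nat.eqb k (nsnd q) then true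
                                    else X (nfst q) k)) as [i Hi].
    { exists [nsnd q]; intros k Hk; destruct (Nat.eqb_spec k (nsnd q)); cbn; auto;
        congruence. }
    set (r := repeat 0 (nfst q - length s) ++ [i]).
    apply (H (s ++ r)); [now exists r|].
    apply kin_R, R_at_iff; unfold r.
    rewrite !length_app, repeat_length; cbn [length]; split; [lia|].
    rewrite app_nth2, app_nth2, repeat_length, Nat.sub_diag
      by (rewrite ?repeat_length; lia).
    cbn; now rewrite Hi, Nat.eqb_refl. }
  split; auto; destruct (L _ _ _) eqn:E; auto; exfalso.
  apply (H s); auto; now apply kin_R, R_at_iff.
Qed.

Lemma decided_columns X (Z : nat -> Real) n :
  (forall m, m < n -> exists c, decided_by X c (Z m)) ->
  exists c, forall q, nfst q < n ->
    ev (answers X) c q (Nat.b2n (Z (nfst q) (nsnd q))).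
Proof.
  induction n as [|n IH]; intros H; [exists PId; intros; lia|].
  destruct IH as [c Hc]; [auto|]; destruct (H n) as [d Hd]; [lia|].
  assert (T : total (fun q => ndist (nfst q) n)) by total_tac.
  destruct T as [t Ht]; exists (PIf t c (PComp d PSnd)); intros q Hq.
  specialize (Ht (answers X) q).
  pose proof (ndist_eqb (nfst q) n) as D.
  destruct (ndist (nfst q) n) as [|v]; symmetry in D; cbn in D.
  - apply Nat.eqb_eq in D; apply ev_if_0; [exact Ht|].
    rewrite D; econstructor; [constructor|apply Hd].
  - apply Nat.eqb_neq in D; eapply ev_if_S; [exact Ht|apply Hc; lia].
Qed.

(** The columns answered at [s] are finite modifications of reals [X m] with
    [m < length s], and there are only finitely many of them. *)
Lemma R_answers_reduction X L s :
  (forall m n, m < n -> turing_lt (X m) (X n)) ->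
  (forall n Y, (exists i, forall k, L n i k = Y k) <-> differ_finitely Y (X n)) ->
  exists d, forall q b, R_answers L s q b ->
    ev (answers (X (length s))) d q (Nat.b2n b).
Proof.
  intros HX HL.
  destruct (decided_columns (X (length s)) (fun m => L m (nth m s 0))
    (length s)) as [c Hc].
  - intros m Hm; apply decided_finite_change with (X m).
    + apply computable_in_decided, HX, Hm.
    + apply HL; now exists (nth m s 0).
  - exists c; intros q b Hb.
    apply R_answers_columns with (X := X) in Hb as [Hq <-]; [now apply Hc|].
    intros n Y; apply HL.
Qed.

(** * Realizability *)

Definition sym (e : nat) : nat := npair (nsnd e) (nfst e).

Lemma total_sym : total sym.
Proof. unfold sym; total_tac. Qed.
#[export] Hint Resolve total_sym : total.

Lemma ev_mono (O O' : oracle) c m k :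
  (forall q b, O q b -> O' q b) -> ev O c m k -> ev O' c m k.
Proof. intros HO H; induction H; eauto using ev. Qed.

Section Realizability.

Context (L : nat -> nat -> Real).

Lemma rlz_in_iff e a b s : rlz_in L e a b s <->
  exists c, kin (opair (num (nfst e)) c) b s /\ rlz_eq L (nsnd e) a c s.
Proof.
  split; [intros H; destruct H as [e a b s H]; exact H|].
  intros H; constructor; exact H.
Qed.

Lemma rlz_eq_iff e a b s : rlz_eq L e a b s <->
  (forall t f c, extends s t -> kin (opair (num f) c) a t ->
     exists k, computes (R_answers L t) (nfst e) f k /\ rlz_in L k c b t) /\
  (forall t f c, extends s t -> kin (opair (num f) c) b t ->
     exists k, computes (R_answers L t) (nsnd e) f k /\ rlz_in L k c a t).
Proof.
  split.
  - intros H; destruct H as [e a b s H1 H2]; split; intros t f c Ht Hc;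
      [apply (H1 t Ht f t (extends_refl t) c t (extends_refl t) Hc)
      |apply (H2 t Ht f t (extends_refl t) c t (extends_refl t) Hc)].
  - intros [H1 H2]; constructor; intros t Ht f u Hu c v Hv Hc;
      [apply H1|apply H2]; eauto.
Qed.

Lemma rlz_eq_mono e a b s t :
  extends s t -> rlz_eq L e a b s -> rlz_eq L e a b t.
Proof.
  rewrite !rlz_eq_iff; intros Hst [H1 H2]; split; intros; eauto.
Qed.

Lemma rlz_in_mono e a b s t :
  extends s t -> rlz_in L e a b s -> rlz_in L e a b t.
Proof.
  rewrite !rlz_in_iff; intros Hst (c & H1 & H2).
  exists c; split; [eapply kin_mono|eapply rlz_eq_mono]; eauto.
Qed.

Lemma kall_mono D (P : D -> kprop) s t : extends s t -> kall P s -> kall P t.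
Proof. intros Hst H u Hu; apply H; eauto. Qed.

Lemma in_MApp_mono x s t : extends s t -> in_MApp x s -> in_MApp x t.
Proof.
  intros Hst H; destruct H as [x s H]; constructor.
  exact (kall_mono _ _ _ _ Hst H).
Qed.

Lemma realizes_mono p e s t :
  extends s t -> realizes L e p s -> realizes L e p t.
Proof.
  intros Hst; revert e; induction p as [x y|x y| |p IHp q IHq|p IHp q IHq
    |p IHp q IHq|p IHp|p IHp]; intros e; cbn [realizes].
  - now apply rlz_in_mono.
  - now apply rlz_eq_mono.
  - auto.
  - intros [H1 H2]; split; auto.
  - destruct (Nat.eqb _ _); auto.
  - exact (kall_mono _ _ _ _ Hst).
  - exact (kall_mono _ _ _ _ Hst).
  - intros (a & Ha & H); exists a; split; eauto using in_MApp_mono.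
Qed.

Lemma in_MApp_iff x s : in_MApp x s <->
  forall t h, extends s t -> kin h x t ->
    exists e a, keq h (opair (num e) a) t /\ in_MApp a t.
Proof.
  split.
  - intros [y u H] t h Ht Hh.
    apply (H t Ht h t (extends_refl t) Hh).
  - intros H; constructor; intros t Ht h u Hu Hh; apply H; eauto.
Qed.

Lemma in_MApp_keq x y s : keq x y s -> in_MApp x s -> in_MApp y s.
Proof.
  rewrite !in_MApp_iff; intros E H t h Ht Hh; apply H; auto.
  eapply kin_keq_r; [|exact Hh]; apply keq_sym; eapply keq_mono; eauto.
Qed.

Lemma in_MApp_elem x s t f c :
  in_MApp x s -> extends s t -> kin (opair (num f) c) x t -> in_MApp c t.
Proof.
  intros H Ht Hc; destruct (proj1 (in_MApp_iff x s) H t _ Ht Hc)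
    as (e & a & E & Ha).
  apply opair_inj in E as [_ E]; eapply in_MApp_keq; [|exact Ha].
  now apply keq_sym.
Qed.

(** Realized membership refers to pairs only up to equality in the Kripke
    model, so an element of [x] need not be a subterm of [x]; it is equal to
    one. *)
Lemma MApp_ind (P : M -> node -> Prop) :
  (forall x s, (forall t f c, extends s t -> kin (opair (num f) c) x t ->
     P c t) -> P x s) ->
  forall x s, P x s.
Proof.
  intros HP.
  (* The second components of the elements of [x] lie three levels below
     [x], because of the coding of pairs. *)
  assert (H : forall x s,
    (forall y, keq y x s -> P y s) /\
    (forall y, kin y x s -> P y s) /\
    (forall y z, kin y z s -> kin z x s -> P y s)).
  { induction x as [A B Bm f IH]; intros s.
    set (x := mkM A B Bm f).
    assert (Hin : forall t y, kin y x t -> exists a, keq y (f a) t).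
    { intros t y Hy; apply kin_iff in Hy as (h & (a & _ & <-) & E); eauto. }
    split; [|split].
    - intros y Hy; apply HP; intros t e c Ht Hc.
      apply (keq_mono _ _ _ _ Ht) in Hy; apply (kin_keq_r _ _ _ _ Hy) in Hc.
      destruct (Hin _ _ Hc) as [a Ha].
      apply (proj2 (proj2 (IH a t)) c (upair (num e) c)).
      + apply kin_upair; auto using keq_refl.
      + eapply kin_keq_r; [exact Ha|]; apply kin_upair; auto using keq_refl.
    - intros y Hy; destruct (Hin _ _ Hy) as [a Ha].
      exact (proj1 (IH a s) y Ha).
    - intros y z Hy Hz; destruct (Hin _ _ Hz) as [a Ha].
      apply (proj1 (proj2 (IH a s))); eapply kin_keq_r; eauto. }
  intros x s; exact (proj1 (H x s) x (keq_refl x s)).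
Qed.

Lemma rlz_in_keq_r e a b b' s :
  keq b b' s -> rlz_in L e a b s -> rlz_in L e a b' s.
Proof.
  rewrite !rlz_in_iff; intros E (c & H1 & H2).
  exists c; split; auto; eapply kin_keq_r; eauto.
Qed.

Lemma rlz_eq_keq_r e a b b' s :
  keq b b' s -> rlz_eq L e a b s -> rlz_eq L e a b' s.
Proof.
  rewrite !rlz_eq_iff; intros E [H1 H2]; split; intros t f c Ht Hc.
  - destruct (H1 t f c Ht Hc) as (k & Hk & H); exists k; split; auto.
    eapply rlz_in_keq_r; [eapply keq_mono|]; eauto.
  - apply H2; auto; eapply kin_keq_r; [apply keq_sym|exact Hc].
    eapply keq_mono; eauto.
Qed.

Lemma rlz_sym e a b s : rlz_eq L e a b s -> rlz_eq L (sym e) b a s.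
Proof. rewrite !rlz_eq_iff; unfold sym; np; tauto. Qed.

Lemma rlz_eq_keq_l e a a' b s :
  keq a a' s -> rlz_eq L e a b s -> rlz_eq L e a' b s.
Proof.
  intros E H; apply rlz_sym, (rlz_eq_keq_r _ _ _ _ _ E), rlz_sym in H.
  unfold sym in H; revert H; np; now rewrite npair_eta.
Qed.

(** ** Programs extracted from proofs *)

(** Realizers have to be uniform in the sets and nodes.  So the lemmas below
    have the form [{c | forall s x .., got s c g F}], where the tuple [g] lists
    the given realizers.  Their proofs leave [c] to unification, as a
    metavariable that is older than the variables [s], [x], .. and hence cannot
    depend on them; each rule for [got] builds one piece of [c]. *)
Definition got (s : node) (c : prog) (g : nat) (F : nat -> Prop) : Prop :=
  exists k, ev (R_answers L s) c g k /\ F k.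

Lemma got_ret s c g k (F : nat -> Prop) :
  F k -> ev (R_answers L s) c g k -> got s c g F.
Proof. exists k; auto. Qed.

Lemma got_call s c d g m F :
  got s c m F -> ev (R_answers L s) d g m -> got s (PComp c d) g F.
Proof. intros (k & H & HF) Hd; exists k; split; auto; econstructor; eauto. Qed.

Lemma got_bind s c d g (F G : nat -> Prop) :
  got s c g F -> (forall k, F k -> got s d (npair g k) G) ->
  got s (PComp d (PPair PId c)) g G.
Proof.
  intros (k & H & HF) Hd; destruct (Hd k HF) as (l & Hl & HG).
  exists l; split; auto; econstructor; [|exact Hl].
  constructor; [constructor|exact H].
Qed.

Lemma got_weaken s c g (F G : nat -> Prop) :
  got s c g F -> (forall k, F k -> G k) -> got s c g G.
Proof. intros (k & H & HF) HG; exists k; auto. Qed.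

Lemma got_run s cf ca g f a F :
  (exists k, computes (R_answers L s) f a k /\ F k) ->
  ev (R_answers L s) cf g f -> ev (R_answers L s) ca g a ->
  got s (PComp univ (PPair cf ca)) g F.
Proof.
  intros (k & H & HF) Hf Ha; exists k; split; auto.
  econstructor; [constructor; eauto|apply ev_univ, H].
Qed.

Lemma imp_elim e a p q s :
  realizes L e (Imp p q) s -> realizes L a p s ->
  exists k, computes (R_answers L s) e a k /\ realizes L k q s.
Proof.
  intros H Ha; exact (H s (extends_refl s) a s (extends_refl s) Ha).
Qed.

Lemma iff_elim_l e a p q s :
  realizes L e (Iff p q) s -> realizes L a p s ->
  exists k, computes (R_answers L s) (nfst e) a k /\ realizes L k q s.
Proof. intros [H _]; exact (imp_elim _ _ p q s H). Qed.

Lemma iff_elim_r e a p q s :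
  realizes L e (Iff p q) s -> realizes L a q s ->
  exists k, computes (R_answers L s) (nsnd e) a k /\ realizes L k p s.
Proof. intros [_ H]; exact (imp_elim _ _ q p s H). Qed.

Lemma all_elim e (p : M -> formula M) a s :
  realizes L e (All p) s -> in_MApp a s -> realizes L e (p a) s.
Proof.
  intros H Ha; exact (H s (extends_refl s) a s (extends_refl s) Ha).
Qed.

Lemma all_in_elim e (p : M -> formula M) x a m s :
  realizes L e (AllIn x p) s -> in_MApp a s -> rlz_in L m a x s ->
  exists k, computes (R_answers L s) e m k /\ realizes L k (p a) s.
Proof.
  intros H Ha Hm.
  exact (imp_elim _ _ (Mem a x) (p a) _ (all_elim _ _ _ _ H Ha) Hm).
Qed.

Definition lam (c : prog) : prog := proj1_sig (total_smn c).

Lemma ev_lam O c g : ev O (lam c) g (smn c g).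
Proof. apply (proj2_sig (total_smn c)). Qed.

Lemma got_all_imp s c g (p q : M -> formula M) :
  (forall t a f, extends s t -> in_MApp a t -> realizes L f (p a) t ->
     got t c (npair g f) (fun k => realizes L k (q a) t)) ->
  got s (lam c) g (fun k => realizes L k (All (fun a => Imp (p a) (q a))) s).
Proof.
  intros H; exists (smn c g); split; [apply ev_lam|].
  intros t Ht a u Hu Ha v Hv f w Hw Hf.
  destruct (H w a f) as (k & Hk & HF); eauto using in_MApp_mono.
  exists k; split; auto; now apply smn_correct.
Qed.

Lemma got_all_iff s c d g (p q : M -> formula M) :
  (forall t a f, extends s t -> in_MApp a t -> realizes L f (p a) t ->
     got t c (npair g f) (fun k => realizes L k (q a) t)) ->
  (forall t a f, extends s t -> in_MApp a t -> realizes L f (q a) t ->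
     got t d (npair g f) (fun k => realizes L k (p a) t)) ->
  got s (PPair (lam c) (lam d)) g
    (fun k => realizes L k (All (fun a => Iff (p a) (q a))) s).
Proof.
  intros H1 H2; exists (npair (smn c g) (smn d g)); split.
  - constructor; apply ev_lam.
  - intros t Ht a u Hu Ha; split; np; intros v Hv f w Hw Hf;
      [destruct (H1 w a f) as (k & Hk & HF)
      |destruct (H2 w a f) as (k & Hk & HF)]; eauto using in_MApp_mono;
      exists k; split; auto; now apply smn_correct.
Qed.

Lemma got_and s c d g p q :
  got s c g (fun k => realizes L k p s) ->
  got s d g (fun k => realizes L k q s) ->
  got s (PPair c d) g (fun k => realizes L k (And p q) s).
Proof.
  intros (k & Hk & Hp) (l & Hl & Hq); exists (npair k l); split.
  - now constructor.
  - split; np; auto.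
Qed.

Lemma got_eq s c d g a b :
  (forall t f x, extends s t -> kin (opair (num f) x) a t ->
     got t c (npair g f) (fun k => rlz_in L k x b t)) ->
  (forall t f x, extends s t -> kin (opair (num f) x) b t ->
     got t d (npair g f) (fun k => rlz_in L k x a t)) ->
  got s (PPair (lam c) (lam d)) g (fun k => rlz_eq L k a b s).
Proof.
  intros H1 H2; exists (npair (smn c g) (smn d g)); split.
  - constructor; apply ev_lam.
  - apply rlz_eq_iff; np; split; intros t f x Ht Hx.
    + destruct (H1 t f x Ht Hx) as (k & Hk & HF); exists k; split; auto.
      now apply smn_correct.
    + destruct (H2 t f x Ht Hx) as (k & Hk & HF); exists k; split; auto.
      now apply smn_correct.
Qed.

End Realizability.

Lemma ev_path_l O c a b k : ev O c a k -> ev O (PComp c PFst) (npair a b) k.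
Proof. intros H; econstructor; [apply ev_fst_eq, nfst_npair|exact H]. Qed.

Lemma ev_path_r O c a b k : ev O c b k -> ev O (PComp c PSnd) (npair a b) k.
Proof. intros H; econstructor; [apply ev_snd_eq, nsnd_npair|exact H]. Qed.

Lemma ev_nfst O c g k : ev O c g k -> ev O (PComp PFst c) g (nfst k).
Proof. intros H; econstructor; [exact H|constructor]. Qed.

Lemma ev_nsnd O c g k : ev O c g k -> ev O (PComp PSnd c) g (nsnd k).
Proof. intros H; econstructor; [exact H|constructor]. Qed.

Lemma ev_total O F (T : total F) c g a :
  ev O c g a -> ev O (PComp (proj1_sig T) c) g (F a).
Proof. intros H; econstructor; [exact H|apply (proj2_sig T)]. Qed.

Lemma ev_total2 O F (T : total2 F) c d g a b :
  ev O c g a -> ev O d g b ->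
  ev O (PComp (proj1_sig T) (PPair c d)) g (F a b).
Proof.
  intros Ha Hb; econstructor; [constructor; eassumption|].
  pose proof (proj2_sig T O (npair a b)) as H; cbv beta in H.
  rewrite nfst_npair, nsnd_npair in H; exact H.
Qed.

Lemma ev_if O c d e g t a b : ev O c g t -> ev O d g a -> ev O e g b ->
  ev O (PIf c e d) g (if Nat.eqb t 0 then a else b).
Proof.
  intros Hc Hd He; destruct t as [|t]; cbn.
  - now apply ev_if_0.
  - now apply ev_if_S with t.
Qed.

Lemma ev_bind O c d g k l : ev O c g k -> ev O d (npair g k) l ->
  ev O (PComp d (PPair PId c)) g l.
Proof.
  intros; econstructor; [econstructor; [constructor|eassumption]|assumption].
Qed.

Lemma ev_run O cf ca g f a k : computes O f a k ->
  ev O cf g f -> ev O ca g a -> ev O (PComp univ (PPair cf ca)) g k.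
Proof.
  intros; econstructor; [econstructor; eassumption|now apply ev_univ].
Qed.

Ltac ev_entry :=
  match goal with
  | |- ev _ _ ?g ?g => apply ev_id
  | |- ev _ _ (npair _ _) _ => apply ev_path_r; ev_entry
  | |- ev _ _ (npair _ _) _ => apply ev_path_l; ev_entry
  end.

(** Proves [ev O ?c g k], instantiating [?c], when [k] is built by total
    computable operations from constants and entries of the tuple [g]. *)
Ltac evs :=
  first
  [ ev_entry
  | lazymatch goal with
    | |- ev _ _ _ (npair _ _) => apply ev_pair; evs
    | |- ev _ _ _ (nfst _) => apply ev_nfst; evs
    | |- ev _ _ _ (nsnd _) => apply ev_nsnd; evs
    | |- ev _ _ _ (if Nat.eqb _ 0 then _ else _) => apply ev_if; evs
    | |- ev _ _ _ (?F _ _) =>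
        eapply (ev_total2 _ F ltac:(solve [auto with total])); evs
    | |- ev _ _ _ (?F _) =>
        eapply (ev_total _ F ltac:(solve [auto with total])); evs
    end
  | apply ev_const ].

(** ** Equality *)

Section Equality.

Context (L : nat -> nat -> Real).

Lemma refl_realizer : {e : nat | forall a s, rlz_eq L e a a s}.
Proof.
  (* [i . f = <f, <i, i>>] *)
  destruct (recursion_theorem (PPair PSnd (PPair PFst PFst))) as [i Hi].
  exists (npair i i); apply MApp_ind; intros x s IH.
  assert (H : forall t f c, extends s t -> kin (opair (num f) c) x t ->
    exists k, computes (R_answers L t) i f k /\ rlz_in L k c x t).
  { intros t f c Ht Hc; exists (npair f (npair i i)); split.
    - apply Hi; constructor; [|constructor].
      + apply ev_snd_eq, nsnd_npair.
      + apply ev_fst_eq, nfst_npair.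
      + apply ev_fst_eq, nfst_npair.
    - apply rlz_in_iff; np; exists c; split; eauto. }
  apply rlz_eq_iff; np; split; exact H.
Qed.

Definition rfl : nat := proj1_sig refl_realizer.

Lemma rlz_refl a s : rlz_eq L rfl a a s.
Proof. apply (proj2_sig refl_realizer). Qed.

(** The second inclusion of [a = c] is the first one for the reversed equations
    [c = b] and [b = a], so both use the index [i]. *)
Definition trans_with (i e d : nat) : nat :=
  npair (papply i (npair e d)) (papply i (npair (sym d) (sym e))).

Lemma trans_step : {G : prog | forall O i e d f k l,
  computes O (nfst e) f k -> computes O (nfst d) (nfst k) l ->
  ev O G (npair i (npair (npair e d) f))
    (npair (nfst l) (trans_with i (nsnd k) (nsnd l)))}.
Proof.
  eexists; intros O i e d f k l Hk Hl; unfold trans_with.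
  eapply ev_bind; [eapply ev_run; [exact Hk|evs|evs]|].
  eapply ev_bind; [eapply ev_run; [exact Hl|evs|evs]|].
  evs.
Qed.

(** An element of [a] equals one of [b], which equals one of [c]; these two
    equations are composed by the same realizer, by the recursion theorem. *)
Lemma trans_realizer : {i : nat | forall a b c e d s,
  rlz_eq L e a b s -> rlz_eq L d b c s -> rlz_eq L (trans_with i e d) a c s}.
Proof.
  destruct trans_step as [G HG]; destruct (recursion_theorem G) as [i Hi].
  exists i.
  set (fwd := fun e a b t => forall f c, kin (opair (num f) c) a t ->
    exists k, computes (R_answers L t) (nfst e) f k /\ rlz_in L k c b t).
  assert (Hhalf : forall t e d a b c f x,
    fwd e a b t -> fwd d b c t -> kin (opair (num f) x) a t ->
    (forall y z g e' d', kin (opair (num g) z) c t ->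
       rlz_eq L e' x y t -> rlz_eq L d' y z t ->
       rlz_eq L (trans_with i e' d') x z t) ->
    exists k, computes (R_answers L t) (papply i (npair e d)) f k /\
      rlz_in L k x c t).
  { intros t e d a b c f x He Hd Hx IH.
    destruct (He f x Hx) as (k & Hk & Hy).
    apply rlz_in_iff in Hy as (y & Hy & Hxy).
    destruct (Hd _ _ Hy) as (l & Hl & Hz).
    apply rlz_in_iff in Hz as (z & Hz & Hyz).
    eexists; split; [apply papply_correct, Hi, HG; eassumption|].
    apply rlz_in_iff; np; exists z; split; [exact Hz|]; eapply IH; eauto. }
  assert (Hfwd : forall e a b s t,
    rlz_eq L e a b s -> extends s t -> fwd e a b t).
  { intros e a b s t H Ht f c Hc; apply rlz_eq_iff in H as [H _]; eauto. }
  (* The elements of [a] come first or last, according to the direction. *)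
  enough (H : forall a s b c e d,
    (rlz_eq L e a b s -> rlz_eq L d b c s ->
     rlz_eq L (trans_with i e d) a c s) /\
    (rlz_eq L e c b s -> rlz_eq L d b a s ->
     rlz_eq L (trans_with i e d) c a s)) by (intros; eapply H; eauto).
  apply (MApp_ind (fun a s => forall b c e d, _ /\ _)).
  intros a s IH b c e d; split; intros He Hd; apply rlz_eq_iff;
    unfold trans_with; np; split; intros t f x Ht Hx;
    assert (He' := rlz_sym _ _ _ _ _ He); assert (Hd' := rlz_sym _ _ _ _ _ Hd);
    eapply Hhalf; eauto; intros y z g e' d' Hz H1 H2;
    [eapply (IH t f x)|eapply (IH t g z)|eapply (IH t g z)|eapply (IH t f x)];
    eauto.
Qed.

Definition trans : nat -> nat -> nat := trans_with (proj1_sig trans_realizer).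

Lemma total2_trans : total2 trans.
Proof. unfold trans, trans_with; total_tac. Qed.

Lemma rlz_trans e d a b c s :
  rlz_eq L e a b s -> rlz_eq L d b c s -> rlz_eq L (trans e d) a c s.
Proof. apply (proj2_sig trans_realizer). Qed.

Definition mem_subst (d e : nat) : nat :=
  npair (nfst e) (trans (sym d) (nsnd e)).

Lemma rlz_mem_subst d e x y b s :
  rlz_eq L d x y s -> rlz_in L e x b s -> rlz_in L (mem_subst d e) y b s.
Proof.
  intros Hd He; apply rlz_in_iff in He as (c & Hc & He).
  apply rlz_in_iff; unfold mem_subst; np; exists c; split; auto.
  eapply rlz_trans; [apply rlz_sym|]; eauto.
Qed.

End Equality.

#[export] Hint Resolve total2_trans : total.

Lemma total2_mem_subst L : total2 (mem_subst L).
Proof. unfold mem_subst; total_tac. Qed.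
#[export] Hint Resolve total2_mem_subst : total.

(** * Sets and sequences in M[App] *)

Section Sets.

Context (L : nat -> nat -> Real).

Lemma mem_transport : {c : prog | forall s x a b e d,
  rlz_in L e x a s -> rlz_eq L d a b s ->
  got L s c (npair e d) (fun k => rlz_in L k x b s)}.
Proof.
  eexists; intros s x a b e d He Hd.
  apply rlz_in_iff in He as (y & Hy & He).
  apply rlz_eq_iff in Hd as [Hd _].
  eapply got_bind; [eapply got_run; [eapply Hd; eauto|evs|evs]|].
  intros k Hk; eapply got_ret;
    [eapply rlz_mem_subst; [exact (rlz_sym _ _ _ _ _ He)|exact Hk]|evs].
Qed.

Definition mem_tr : prog := proj1_sig mem_transport.

Lemma got_mem_tr s c d g x a b e f :
  rlz_in L e x a s -> rlz_eq L f a b s ->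
  ev (R_answers L s) c g e -> ev (R_answers L s) d g f ->
  got L s (PComp mem_tr (PPair c d)) g (fun k => rlz_in L k x b s).
Proof.
  intros He Hf Hc Hd; eapply got_call.
  - exact (proj2_sig mem_transport _ _ _ _ _ _ He Hf).
  - now constructor.
Qed.

Lemma rlz_in_self f x a s :
  kin (opair (num f) x) a s -> rlz_in L (npair f (rfl L)) x a s.
Proof.
  intros H; apply rlz_in_iff; np; exists x; split; auto using rlz_refl.
Qed.

(** ** Unordered and ordered pairs *)

(** The realizers of membership in this unordered pair are those of the
    disjunction of the two equations. *)
Definition upairA (a b : M) : M :=
  const_set (fun k => opair (num k) (if Nat.eqb k 0 then a else b)).

Definition pairA (a b : M) : M := upairA (upairA a a) (upairA a b).

Lemma kin_upairA f c a b s :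
  kin (opair (num f) c) (upairA a b) s <->
  keq c (if Nat.eqb f 0 then a else b) s.
Proof.
  unfold upairA; rewrite kin_const; split.
  - intros (k & E); apply opair_inj in E as [E1 E2].
    apply num_inj in E1; now subst.
  - intros E; exists f; apply opair_keq; auto using keq_refl.
Qed.

Lemma rlz_in_upairA e x a b s :
  rlz_in L e x (upairA a b) s <->
  rlz_eq L (nsnd e) x (if Nat.eqb (nfst e) 0 then a else b) s.
Proof.
  rewrite rlz_in_iff; split.
  - intros (c & Hc & He); apply kin_upairA in Hc.
    eapply rlz_eq_keq_r; eauto.
  - intros He; eexists; split; [apply kin_upairA, keq_refl|exact He].
Qed.

Lemma rlz_in_upairA_or e x a b s :
  rlz_in L e x (upairA a b) s <-> realizes L e (Or (Eq x a) (Eq x b)) s.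
Proof.
  rewrite rlz_in_upairA; cbn; destruct (Nat.eqb (nfst e) 0); reflexivity.
Qed.

Lemma in_MApp_const {A} (f : A -> M) s :
  (forall t a, extends s t -> exists e c, f a = opair (num e) c /\ in_MApp c t) ->
  in_MApp (const_set f) s.
Proof.
  intros H; apply in_MApp_iff; intros t h Ht Hh.
  apply kin_const in Hh as [a E]; destruct (H t a Ht) as (e & c & Ec & Hc).
  rewrite Ec in E; eauto.
Qed.

Lemma in_MApp_upairA a b s :
  in_MApp a s -> in_MApp b s -> in_MApp (upairA a b) s.
Proof.
  intros Ha Hb; apply in_MApp_const; intros t k Ht.
  do 2 eexists; split; [reflexivity|].
  destruct (Nat.eqb k 0); eapply in_MApp_mono; eauto.
Qed.

Lemma in_MApp_pairA a b s :
  in_MApp a s -> in_MApp b s -> in_MApp (pairA a b) s.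
Proof. unfold pairA; auto using in_MApp_upairA. Qed.

Lemma rlz_keq a b s : keq a b s -> rlz_eq L (rfl L) a b s.
Proof. intros E; eapply rlz_eq_keq_r; [exact E|apply rlz_refl]. Qed.

(** The right-hand side of the description has the same realizers as
    membership in [upairA a b], so its two implications are the two halves of
    an equation. *)
Lemma eq_of_IsUpair : {c : prog | forall s z a b h,
  in_MApp z s -> in_MApp a s -> in_MApp b s ->
  realizes L h (IsUpair z a b) s ->
  got L s c h (fun k => rlz_eq L k z (upairA a b) s)}.
Proof.
  eexists; intros s z a b h Hz Ha Hb Hh.
  assert (Hiff : forall t x, extends s t -> in_MApp x t ->
    realizes L h (Iff (Mem x z) (Or (Eq x a) (Eq x b))) t).
  { intros t x Ht Hx.
    exact (all_elim L h (fun w => Iff (Mem w z) (Or (Eq w a) (Eq w b))) x t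
      (realizes_mono L (IsUpair z a b) h s t Ht Hh) Hx). }
  eapply got_eq; intros t f x Ht Hx.
  - eapply got_weaken; [eapply got_run; [eapply iff_elim_l;
      [apply Hiff; eauto using in_MApp_elem|] |evs|]|].
    + exact (rlz_in_self _ _ _ _ Hx).
    + evs.
    + intros k Hk; apply rlz_in_upairA_or; exact Hk.
  - eapply got_weaken; [eapply got_run; [eapply iff_elim_r;
      [apply Hiff; eauto using in_MApp_elem, in_MApp_upairA|] |evs|]|].
    + apply rlz_in_upairA_or; exact (rlz_in_self _ _ _ _ Hx).
    + evs.
    + auto.
Qed.

Lemma IsUpair_of_eq : {c : prog | forall s z a b h,
  rlz_eq L h z (upairA a b) s ->
  got L s c h (fun k => realizes L k (IsUpair z a b) s)}.
Proof.
  eexists; intros s z a b h Hh; apply got_all_iff; intros t x f Ht Hx Hf.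
  - eapply got_weaken; [eapply got_mem_tr;
      [exact Hf|exact (rlz_eq_mono _ _ _ _ _ _ Ht Hh)|evs|evs]|].
    intros k Hk; now apply rlz_in_upairA_or.
  - apply rlz_in_upairA_or in Hf.
    eapply got_mem_tr; [exact Hf
      |exact (rlz_sym _ _ _ _ _ (rlz_eq_mono _ _ _ _ _ _ Ht Hh))|evs|evs].
Qed.

End Sets.

Section Pairs.

Context (L : nat -> nat -> Real).

Lemma eq_of_IsPair : {c : prog | forall s p a b h,
  in_MApp p s -> in_MApp a s -> in_MApp b s ->
  realizes L h (IsPair p a b) s ->
  got L s c h (fun k => rlz_eq L k p (pairA a b) s)}.
Proof.
  destruct (eq_of_IsUpair L) as [c1 H1], (IsUpair_of_eq L) as [c2 H2].
  eexists; intros s p a b h Hp Ha Hb Hh.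
  assert (Hiff : forall t z, extends s t -> in_MApp z t ->
    realizes L h (Iff (Mem z p) (Or (IsUpair z a a) (IsUpair z a b))) t).
  { intros t z Ht Hz.
    exact (all_elim L h (fun z => Iff (Mem z p)
      (Or (IsUpair z a a) (IsUpair z a b))) z t
      (realizes_mono L (IsPair p a b) h s t Ht Hh) Hz). }
  eapply got_eq; intros t f z Ht Hz.
  - assert (Hz' : in_MApp z t) by eauto using in_MApp_elem.
    eapply got_bind; [eapply got_run; [eapply iff_elim_l;
      [exact (Hiff t z Ht Hz')|exact (rlz_in_self _ _ _ _ _ Hz)]|evs|evs]|].
    intros k Hk; cbn [realizes] in Hk.
    assert (Hu : got L t c1 (nsnd k) (fun l => rlz_eq L l z
      (if Nat.eqb (nfst k) 0 then upairA a a else upairA a b) t)).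
    { destruct (Nat.eqb (nfst k) 0); apply H1;
        eauto using in_MApp_mono. }
    eapply got_bind; [eapply got_call; [exact Hu|evs]|].
    intros l Hl; eapply got_ret with (k := npair (nfst k) l); [|evs].
    apply rlz_in_upairA; np; exact Hl.
  - apply kin_upairA in Hz.
    assert (Hz' : in_MApp z t).
    { eapply in_MApp_keq; [apply keq_sym, Hz|].
      destruct (Nat.eqb f 0); apply in_MApp_upairA;
        eauto using in_MApp_mono. }
    eapply got_bind with (F := fun l => realizes L (npair f l)
      (Or (IsUpair z a a) (IsUpair z a b)) t).
    + eapply got_weaken; [eapply got_call with (m := rfl L);
        [apply (H2 t z a (if Nat.eqb f 0 then a else b))|evs]|].
      * destruct (Nat.eqb f 0); apply rlz_keq, Hz.
      * intros l Hl; cbn [realizes]; np; destruct (Nat.eqb f 0); exact Hl.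
    + intros l Hl; eapply got_run;
        [exact (iff_elim_r _ _ _ _ _ _ (Hiff t z Ht Hz') Hl)|evs|evs].
Qed.

Lemma IsPair_of_eq : {c : prog | forall s p a b h,
  in_MApp a s -> in_MApp b s ->
  rlz_eq L h p (pairA a b) s ->
  got L s c h (fun k => realizes L k (IsPair p a b) s)}.
Proof.
  destruct (eq_of_IsUpair L) as [c1 H1], (IsUpair_of_eq L) as [c2 H2].
  eexists; intros s p a b h Ha Hb Hh.
  apply got_all_iff; intros t z f Ht Hz Hf.
  - eapply got_bind; [eapply got_mem_tr;
      [exact Hf|exact (rlz_eq_mono _ _ _ _ _ _ Ht Hh)|evs|evs]|].
    intros k Hk; apply rlz_in_upairA in Hk.
    eapply got_bind with (F := fun l => realizes L (npair (nfst k) l)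
      (Or (IsUpair z a a) (IsUpair z a b)) t).
    + eapply got_weaken; [eapply got_call with (m := nsnd k);
        [apply (H2 t z a (if Nat.eqb (nfst k) 0 then a else b))|evs]|].
      * destruct (Nat.eqb (nfst k) 0); exact Hk.
      * intros l Hl; cbn [realizes]; np; destruct (Nat.eqb (nfst k) 0);
          exact Hl.
    + intros l Hl; exists (npair (nfst k) l); split; [evs|exact Hl].
  - cbn [realizes] in Hf.
    assert (Hu : got L t c1 (nsnd f) (fun l => rlz_eq L l z
      (if Nat.eqb (nfst f) 0 then upairA a a else upairA a b) t)).
    { destruct (Nat.eqb (nfst f) 0); apply H1;
        eauto using in_MApp_mono. }
    eapply got_bind; [eapply got_call; [exact Hu|evs]|].
    intros l Hl.
    assert (Hm : rlz_in L (npair (nfst f) l) z (pairA a b) t)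
      by (apply rlz_in_upairA; np; exact Hl).
    eapply got_mem_tr; [exact Hm
      |exact (rlz_sym _ _ _ _ _ (rlz_eq_mono _ _ _ _ _ _ Ht Hh))|evs|evs].
Qed.

Lemma upairA_cong : {c : prog | forall s a b a' b' e d,
  rlz_eq L e a a' s -> rlz_eq L d b b' s ->
  got L s c (npair e d) (fun k => rlz_eq L k (upairA a b) (upairA a' b') s)}.
Proof.
  eexists; intros s a b a' b' e d He Hd.
  eapply got_eq; intros t f x Ht Hx; apply kin_upairA in Hx.
  - eapply got_ret with (k := npair f (if Nat.eqb f 0 then e else d)); [|evs].
    apply rlz_in_upairA; np; eapply rlz_eq_keq_l; [apply keq_sym, Hx|].
    destruct (Nat.eqb f 0); eapply rlz_eq_mono; eauto.
  - eapply got_ret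
      with (k := npair f (if Nat.eqb f 0 then sym e else sym d)); [|evs].
    apply rlz_in_upairA; np; eapply rlz_eq_keq_l; [apply keq_sym, Hx|].
    destruct (Nat.eqb f 0); apply rlz_sym; eapply rlz_eq_mono; eauto.
Qed.

Lemma pairA_cong : {c : prog | forall s a b a' b' e d,
  rlz_eq L e a a' s -> rlz_eq L d b b' s ->
  got L s c (npair e d) (fun k => rlz_eq L k (pairA a b) (pairA a' b') s)}.
Proof.
  destruct upairA_cong as [c Hc].
  eexists; intros s a b a' b' e d He Hd.
  eapply got_bind; [eapply got_call; [exact (Hc _ _ _ _ _ _ _ He He)|evs]|].
  intros k Hk.
  eapply got_bind; [eapply got_call; [exact (Hc _ _ _ _ _ _ _ He Hd)|evs]|].
  intros l Hl.
  eapply got_call; [exact (Hc _ _ _ _ _ _ _ Hk Hl)|evs].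
Qed.

Lemma upairA_elem e a b x s f : rlz_eq L e (upairA a b) x s ->
  exists k, computes (R_answers L s) (nfst e) f k /\
    rlz_in L k (if Nat.eqb f 0 then a else b) x s.
Proof.
  intros H; apply rlz_eq_iff in H as [H _]; apply H; auto.
  apply kin_upairA, keq_refl.
Qed.

(** [{a}] equals [{c}] or [{c, d}].  Both contain [c] with realizer 0, so
    [c = a] is obtained without distinguishing the cases. *)
Lemma pairA_inj_l : {p : prog | forall s a b c d e,
  rlz_eq L e (pairA a b) (pairA c d) s ->
  got L s p e (fun k => rlz_eq L k a c s)}.
Proof.
  eexists; intros s a b c d e He.
  eapply got_bind; [eapply got_run;
    [exact (upairA_elem _ _ _ _ _ 0 He)|evs|evs]|].
  intros k Hk; apply rlz_in_upairA in Hk; cbn [Nat.eqb] in Hk.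
  assert (Hk' : rlz_eq L (nsnd k) (upairA a a)
    (upairA c (if Nat.eqb (nfst k) 0 then c else d)) s)
    by (destruct (Nat.eqb (nfst k) 0); exact Hk).
  apply rlz_sym in Hk'.
  eapply got_bind; [eapply got_run;
    [exact (upairA_elem _ _ _ _ _ 0 Hk')|evs|evs]|].
  intros l Hl; apply rlz_in_upairA in Hl; cbn [Nat.eqb] in Hl.
  eapply got_ret with (k := sym (nsnd l)); [|evs].
  apply rlz_sym; destruct (Nat.eqb (nfst l) 0); exact Hl.
Qed.

(** [{a, b}] equals [{c}] or [{c, d}], so [b = c] or [b = d]; symmetrically
    [d = a] or [d = b].  The case [b = c], [d = a] is settled by [a = c]. *)
Lemma pairA_inj_r : {p : prog | forall s a b c d e,
  rlz_eq L e (pairA a b) (pairA c d) s ->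
  got L s p e (fun k => rlz_eq L k b d s)}.
Proof.
  destruct pairA_inj_l as [pl Hpl].
  assert (Hor : {p : prog | forall s a b c d e,
    rlz_eq L e (pairA a b) (pairA c d) s ->
    got L s p e (fun k => rlz_in L k b (upairA c d) s)}).
  { eexists; intros s a b c d e He.
    eapply got_bind; [eapply got_run;
      [exact (upairA_elem _ _ _ _ _ 1 He)|evs|evs]|].
    intros k Hk; apply rlz_in_upairA in Hk; cbn [Nat.eqb] in Hk.
    assert (Hk' : rlz_eq L (nsnd k) (upairA a b)
      (upairA c (if Nat.eqb (nfst k) 0 then c else d)) s)
      by (destruct (Nat.eqb (nfst k) 0); exact Hk).
    eapply got_bind; [eapply got_run;
      [exact (upairA_elem _ _ _ _ _ 1 Hk')|evs|evs]|].
    intros l Hl; apply rlz_in_upairA in Hl; cbn [Nat.eqb] in Hl.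
    eapply got_ret with (k := npair
      (if Nat.eqb (nfst k) 0 then 0 else nfst l) (nsnd l)); [|evs].
    apply rlz_in_upairA; np.
    destruct (Nat.eqb (nfst k) 0); [|exact Hl].
    destruct (Nat.eqb (nfst l) 0); exact Hl. }
  destruct Hor as [po Hpo].
  eexists; intros s a b c d e He.
  eapply got_bind; [eapply got_call; [exact (Hpl _ _ _ _ _ _ He)|evs]|].
  intros ac Hac.
  eapply got_bind; [eapply got_call; [exact (Hpo _ _ _ _ _ _ He)|evs]|].
  intros k Hk; apply rlz_in_upairA in Hk.
  eapply got_bind; [eapply got_call;
    [exact (Hpo _ _ _ _ _ _ (rlz_sym _ _ _ _ _ He))|evs]|].
  intros l Hl; apply rlz_in_upairA in Hl.
  eapply got_ret with (k := if Nat.eqb (nfst k) 0 then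
    if Nat.eqb (nfst l) 0
    then trans L (nsnd k) (trans L (sym ac) (sym (nsnd l)))
    else sym (nsnd l) else nsnd k); [|evs].
  destruct (Nat.eqb (nfst k) 0); [|exact Hk].
  destruct (Nat.eqb (nfst l) 0); [|exact (rlz_sym _ _ _ _ _ Hl)].
  eapply rlz_trans; [exact Hk|]; eapply rlz_trans; apply rlz_sym;
    [exact Hac|exact Hl].
Qed.

Lemma mem_of_PairIn : {c : prog | forall s i j f e,
  in_MApp i s -> in_MApp j s -> realizes L e (PairIn i j f) s ->
  got L s c e (fun k => rlz_in L k (pairA i j) f s)}.
Proof.
  destruct eq_of_IsPair as [c Hc].
  eexists; intros s i j f e Hi Hj (p & Hp & He1 & He2).
  eapply got_bind; [eapply got_call; [exact (Hc _ _ _ _ _ Hp Hi Hj He2)|evs]|].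
  intros k Hk.
  eapply got_ret; [exact (rlz_mem_subst _ _ _ _ _ _ _ Hk He1)|evs].
Qed.

Lemma PairIn_of_mem : {c : prog | forall s i j f e,
  in_MApp i s -> in_MApp j s -> rlz_in L e (pairA i j) f s ->
  got L s c e (fun k => realizes L k (PairIn i j f) s)}.
Proof.
  destruct IsPair_of_eq as [c Hc].
  eexists; intros s i j f e Hi Hj He.
  eapply got_bind; [eapply got_call;
    [exact (Hc _ _ _ _ _ Hi Hj (rlz_refl L _ _))|evs]|].
  intros k Hk; eapply got_ret with (k := npair e k); [|evs].
  exists (pairA i j); split; [now apply in_MApp_pairA|]; split; np; auto.
Qed.

End Pairs.

Section Sequences.

Context (L : nat -> nat -> Real).

(** ** Numbers *)

Lemma kin_bar f c n s :
  kin (opair (num f) c) (bar n) s <-> f < n /\ keq c (bar f) s.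
Proof.
  induction n as [|n IH]; cbn [bar].
  - split; [intros H; now apply empty_kin in H|lia].
  - rewrite kin_adjoin, IH; split.
    + intros [[H E]|E]; [auto|].
      apply opair_inj in E as [E1 E2]; apply num_inj in E1; subst; auto.
    + intros [H E]; destruct (Nat.eq_dec f n) as [->|].
      * right; apply opair_keq; auto using keq_refl.
      * left; split; auto; lia.
Qed.

Lemma kin_omega f c s :
  kin (opair (num f) c) omega_bar s <-> keq c (bar f) s.
Proof.
  unfold omega_bar; rewrite kin_const; split.
  - intros [n E]; apply opair_inj in E as [E1 E2].
    apply num_inj in E1; now subst.
  - intros E; exists f; apply opair_keq; auto using keq_refl.
Qed.

Lemma rlz_in_bar e x n s : rlz_in L e x (bar n) s <->
  nfst e < n /\ rlz_eq L (nsnd e) x (bar (nfst e)) s.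
Proof.
  rewrite rlz_in_iff; split.
  - intros (c & Hc & He); apply kin_bar in Hc as [Hn E]; split; auto.
    eapply rlz_eq_keq_r; eauto.
  - intros [Hn He]; exists (bar (nfst e)); split; auto.
    apply kin_bar; auto using keq_refl.
Qed.

Lemma rlz_in_omega e x s : rlz_in L e x omega_bar s <->
  rlz_eq L (nsnd e) x (bar (nfst e)) s.
Proof.
  rewrite rlz_in_iff; split.
  - intros (c & Hc & He); apply kin_omega in Hc.
    eapply rlz_eq_keq_r; eauto.
  - intros He; exists (bar (nfst e)); split; auto.
    apply kin_omega; auto using keq_refl.
Qed.

Lemma in_MApp_bar n s : in_MApp (bar n) s.
Proof.
  revert s; induction n as [|n IH]; intros s; apply in_MApp_iff; cbn [bar];
    intros t h Ht Hh; [now apply empty_kin in Hh|].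
  apply kin_adjoin in Hh as [Hh|Hh]; eauto.
  exact (proj1 (in_MApp_iff _ _) (IH t) t h (extends_refl t) Hh).
Qed.

Lemma rlz_bar_inj m : forall n e s, rlz_eq L e (bar m) (bar n) s -> m = n.
Proof.
  assert (Hin : forall e i a x s, rlz_eq L e (bar a) x s -> i < a ->
    exists k, rlz_in L k (bar i) x s).
  { intros e i a x s H Hi; apply rlz_eq_iff in H as [H _].
    destruct (H s i (bar i) (extends_refl s)) as (k & _ & Hk); eauto.
    apply kin_bar; auto using keq_refl. }
  induction m as [m IH] using lt_wf_ind; intros n e s H.
  destruct (Nat.lt_trichotomy m n) as [Hl|[Hl|Hl]]; auto; exfalso.
  - destruct (Hin _ m _ _ _ (rlz_sym _ _ _ _ _ H) Hl) as [k Hk].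
    apply rlz_in_bar in Hk as [Hj Hk].
    apply rlz_sym, (IH _ Hj) in Hk; lia.
  - destruct (Hin _ n _ _ _ H Hl) as [k Hk].
    apply rlz_in_bar in Hk as [Hj Hk].
    apply rlz_sym, IH in Hk; lia.
Qed.

(** ** Finite binary sequences *)

Definition entry (w : list bool) (i : nat) : M :=
  pairA (bar i) (bar (Nat.b2n (nth i w false))).

Definition seqA (w : list bool) : M :=
  const_set (fun i : {i | i < length w} =>
    opair (num (proj1_sig i)) (entry w (proj1_sig i))).

Lemma kin_seqA f c w s : kin (opair (num f) c) (seqA w) s <->
  f < length w /\ keq c (entry w f) s.
Proof.
  unfold seqA; rewrite kin_const; split.
  - intros [[i Hi] E]; apply opair_inj in E as [E1 E2]; cbn in E1, E2.
    apply num_inj in E1; now subst.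
  - intros [Hf E]; exists (exist _ f Hf); apply opair_keq; auto using keq_refl.
Qed.

Lemma rlz_in_seqA e x w s : rlz_in L e x (seqA w) s <->
  nfst e < length w /\ rlz_eq L (nsnd e) x (entry w (nfst e)) s.
Proof.
  rewrite rlz_in_iff; split.
  - intros (c & Hc & He); apply kin_seqA in Hc as [Hn E]; split; auto.
    eapply rlz_eq_keq_r; eauto.
  - intros [Hn He]; eexists; split; [|exact He].
    apply kin_seqA; auto using keq_refl.
Qed.

Lemma in_MApp_entry w i s : in_MApp (entry w i) s.
Proof. apply in_MApp_pairA; apply in_MApp_bar. Qed.

Lemma in_MApp_seqA w s : in_MApp (seqA w) s.
Proof.
  apply in_MApp_const; intros t i _; do 2 eexists; split; [reflexivity|].
  apply in_MApp_entry.
Qed.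

Lemma entry_in_seqA e i x w s : i < length w ->
  rlz_eq L e (seqA w) x s -> exists k, rlz_in L k (entry w i) x s.
Proof.
  intros Hi H; apply rlz_eq_iff in H as [H _].
  destruct (H s i (entry w i) (extends_refl s)) as (k & _ & Hk); eauto.
  apply kin_seqA; auto using keq_refl.
Qed.

Lemma entry_inv k v w i s : i < length v ->
  rlz_in L k (entry v i) (seqA w) s ->
  i < length w /\ nth i v false = nth i w false.
Proof.
  intros Hi Hk; apply rlz_in_seqA in Hk as [Hl Hk].
  destruct (pairA_inj_l L) as [cl Hcl], (pairA_inj_r L) as [cr Hcr].
  destruct (Hcl _ _ _ _ _ _ Hk) as (l & _ & E1).
  destruct (Hcr _ _ _ _ _ _ Hk) as (r & _ & E2).
  apply rlz_bar_inj in E1, E2; rewrite <- E1 in Hl, E2; split; auto.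
  destruct (nth i v false), (nth i w false); auto; discriminate.
Qed.

Lemma rlz_seqA_inj e v w s : rlz_eq L e (seqA v) (seqA w) s -> v = w.
Proof.
  intros H.
  assert (H1 : forall i, i < length v ->
    i < length w /\ nth i v false = nth i w false).
  { intros i Hi; destruct (entry_in_seqA _ _ _ _ _ Hi H) as [k Hk].
    eapply entry_inv; eauto. }
  assert (H2 : forall i, i < length w -> i < length v).
  { intros i Hi.
    destruct (entry_in_seqA _ _ _ _ _ Hi (rlz_sym _ _ _ _ _ H)) as [k Hk].
    eapply entry_inv; eauto. }
  apply nth_ext with false false; [|intros; now apply H1].
  destruct (Nat.lt_trichotomy (length v) (length w)) as [Hl|[Hl|Hl]]; auto.
  - apply H2 in Hl; lia.
  - apply H1 in Hl; lia.
Qed.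

Definition is_bit := IsBit (bar 0) (bar 1).
Definition is_bin_seq := IsBinSeq (bar 0) (bar 1) omega_bar.

Lemma bit_realizer b s :
  realizes L (npair (Nat.b2n b) (rfl L)) (is_bit (bar (Nat.b2n b))) s.
Proof.
  cbn [realizes is_bit IsBit]; np; destruct b; cbn [Nat.b2n Nat.eqb];
    apply rlz_refl.
Qed.

Lemma got_functional s c g (p : M -> M -> formula M) (q : M -> M -> formula M)
  (r : M -> M -> formula M) :
  (forall t i j j' f f', extends s t ->
     in_MApp i t -> in_MApp j t -> in_MApp j' t ->
     realizes L f (p i j) t -> realizes L f' (q i j') t ->
     got L t c (npair (npair g f) f') (fun k => realizes L k (r j j') t)) ->
  got L s (lam (lam c)) g (fun k => realizes L k (All (fun i => All (fun j =>
    All (fun j' => Imp (p i j) (Imp (q i j') (r j j')))))) s).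
Proof.
  intros H; exists (smn (lam c) g); split; [apply ev_lam|].
  intros t1 E1 i u1 F1 Hi t2 E2 j u2 F2 Hj t3 E3 j' u3 F3 Hj' t4 E4 f u4 F4 Hf.
  exists (smn c (npair g f)); split; [apply smn_correct, ev_lam|].
  intros t5 E5 f' u5 F5 Hf'.
  assert (X5 : extends u4 u5) by eauto.
  assert (X3 : extends u3 u5) by eauto.
  assert (X2 : extends u2 u5) by eauto.
  assert (X1 : extends u1 u5) by eauto.
  destruct (H u5 i j j' f f') as (k & Hk & HF).
  - eauto.
  - exact (in_MApp_mono _ _ _ X1 Hi).
  - exact (in_MApp_mono _ _ _ X2 Hj).
  - exact (in_MApp_mono _ _ _ X3 Hj').
  - exact (realizes_mono _ _ _ _ _ X5 Hf).
  - exact Hf'.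
  - exists k; split; [apply smn_correct, Hk|exact HF].
Qed.

Lemma rlz_in_keq_l e a a' b s :
  keq a a' s -> rlz_in L e a b s -> rlz_in L e a' b s.
Proof.
  rewrite !rlz_in_iff; intros E (c & Hc & H); exists c; split; auto.
  eapply rlz_eq_keq_l; eauto.
Qed.

(** The values are read off the code.  For single-valuedness, two realized pairs
    with the same first component are entries of [seqA w], at positions that
    are equal as numbers because their numerals are equal in M[App]. *)
Lemma is_bin_seq_of_code : {c : prog | forall s x w e,
  in_MApp x s -> rlz_eq L e x (seqA w) s ->
  got L s c (npair (seq_code w) e) (fun k => realizes L k (is_bin_seq x) s)}.
Proof.
  destruct (IsPair_of_eq L) as [cip Hip], (PairIn_of_mem L) as [cpi Hpi],
    (mem_of_PairIn L) as [cmp Hmp], (pairA_cong L) as [cpc Hpc],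
    (pairA_inj_l L) as [cl Hcl], (pairA_inj_r L) as [cr Hcr].
  eexists; intros s x w e Hx He; unfold seq_code.
  eapply got_bind with (F := fun k => realizes L k
    (IsFun x (bar (length w)) is_bit) s).
  2: { intros k Hk.
    exists (npair (npair (length w) (rfl L)) k); split; [evs|].
    exists (bar (length w)); split; [apply in_MApp_bar|split; np; auto].
    apply rlz_in_omega; np; apply rlz_refl. }
  apply got_and; [|apply got_and].
  - eapply got_all_imp; intros t p m Ht Hp Hm.
    eapply got_bind; [eapply got_mem_tr;
      [exact Hm|exact (rlz_eq_mono _ _ _ _ _ _ Ht He)|evs|evs]|].
    intros k Hk; apply rlz_in_seqA in Hk as [Hi Hk].
    eapply got_bind; [eapply got_call; [exact (Hip _ _ _ _ _
      (in_MApp_bar _ _) (in_MApp_bar _ _) Hk)|evs]|].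
    intros l Hl.
    exists (npair (npair (nfst k) (rfl L))
      (npair (npair (bit_of (bits w) (nfst k)) (rfl L)) l)); split; [evs|].
    exists (bar (nfst k)); split; [apply in_MApp_bar|split; np].
    + apply rlz_in_bar; np; split; [exact Hi|apply rlz_refl].
    + exists (bar (Nat.b2n (nth (nfst k) w false))).
      split; [apply in_MApp_bar|split; np; [|exact Hl]].
      rewrite bit_of_bits; apply bit_realizer.
  - eapply got_all_imp; intros t i m Ht Hi Hm.
    cbn [realizes] in Hm; apply rlz_in_bar in Hm as [Hlt Hm].
    eapply got_bind; [eapply got_call;
      [exact (Hpc _ _ _ _ _ _ _ Hm
        (rlz_refl L (bar (Nat.b2n (nth (nfst m) w false))) t))|evs]|].
    intros k Hk.
    assert (Hin : rlz_in L (npair (nfst m) k)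
      (pairA i (bar (Nat.b2n (nth (nfst m) w false)))) (seqA w) t)
      by (apply rlz_in_seqA; np; auto).
    eapply got_bind; [eapply got_mem_tr; [exact Hin
      |exact (rlz_sym _ _ _ _ _ (rlz_eq_mono _ _ _ _ _ _ Ht He))|evs|evs]|].
    intros l Hl.
    eapply got_bind; [eapply got_call;
      [exact (Hpi _ _ _ _ _ Hi (in_MApp_bar _ _) Hl)|evs]|].
    intros q Hq.
    exists (npair (npair (bit_of (bits w) (nfst m)) (rfl L)) q); split; [evs|].
    exists (bar (Nat.b2n (nth (nfst m) w false))).
    split; [apply in_MApp_bar|split; np; [|exact Hq]].
    rewrite bit_of_bits; apply bit_realizer.
  - eapply got_functional; intros t i j j' f f' Ht Hi Hj Hj' Hf Hf'.
    assert (He' := rlz_eq_mono _ _ _ _ _ _ Ht He).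
    eapply got_bind; [eapply got_call; [exact (Hmp _ _ _ _ _ Hi Hj Hf)|evs]|].
    intros k0 Hk0.
    eapply got_bind; [eapply got_mem_tr; [exact Hk0|exact He'|evs|evs]|].
    intros k Hk; apply rlz_in_seqA in Hk as [_ Hk].
    eapply got_bind; [eapply got_call; [exact (Hcr _ _ _ _ _ _ Hk)|evs]|].
    intros l Hl.
    eapply got_bind; [eapply got_call; [exact (Hmp _ _ _ _ _ Hi Hj' Hf')|evs]|].
    intros k1 Hk1.
    eapply got_bind; [eapply got_mem_tr; [exact Hk1|exact He'|evs|evs]|].
    intros k' Hk'; apply rlz_in_seqA in Hk' as [_ Hk'].
    eapply got_bind; [eapply got_call; [exact (Hcr _ _ _ _ _ _ Hk')|evs]|].
    intros l' Hl'.
    (* both pairs have the same first component, so they are the same entry *)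
    assert (E : nfst k = nfst k').
    { destruct (Hcl _ _ _ _ _ _ Hk) as (u & _ & Hu).
      destruct (Hcl _ _ _ _ _ _ Hk') as (u' & _ & Hu').
      exact (rlz_bar_inj _ _ _ _
        (rlz_trans _ _ _ _ _ _ _ (rlz_sym _ _ _ _ _ Hu) Hu')). }
    rewrite <- E in Hl'.
    exists (trans L l (sym l')); split; [evs|].
    exact (rlz_trans _ _ _ _ _ _ _ Hl (rlz_sym _ _ _ _ _ Hl')).
Qed.

(** A realizer of totality is an algorithm for the values: the realizer of the
    disjunction [j = 0] or [j = 1] begins with the bit. *)
Lemma read_entry : {c : prog | forall s x d i m r,
  rlz_in L m (bar i) d s ->
  realizes L r (AllIn d (fun i => Ex (fun j =>
    And (is_bit j) (PairIn i j x)))) s ->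
  got L s c (npair r m) (fun k => exists b, nfst k = Nat.b2n b /\
    rlz_in L (nsnd k) (pairA (bar i) (bar (Nat.b2n b))) x s)}.
Proof.
  destruct (mem_of_PairIn L) as [cmp Hmp], (pairA_cong L) as [cpc Hpc].
  eexists; intros s x d i m r Hm Hr.
  eapply got_bind; [eapply got_run;
    [exact (all_in_elim _ _ _ _ _ _ _ Hr (in_MApp_bar i s) Hm)|evs|evs]|].
  intros k (j & Hj & Hbit & Hpair).
  assert (Hb : exists b, sg (nfst (nfst k)) = Nat.b2n b /\
    rlz_eq L (nsnd (nfst k)) j (bar (Nat.b2n b)) s).
  { cbn [realizes is_bit IsBit] in Hbit; unfold sg.
    destruct (Nat.eqb (nfst (nfst k)) 0);
      [exists false|exists true]; split; auto. }
  destruct Hb as (b & Hb & Ej).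
  eapply got_bind; [eapply got_call;
    [exact (Hmp _ _ _ _ _ (in_MApp_bar i s) Hj Hpair)|evs]|].
  intros l Hl.
  eapply got_bind; [eapply got_call;
    [exact (Hpc _ _ _ _ _ _ _ (rlz_refl L (bar i) s) Ej)|evs]|].
  intros q Hq.
  exists (npair (sg (nfst (nfst k))) (mem_subst L q l)); split; [evs|].
  exists b; np; split; [exact Hb|].
  exact (rlz_mem_subst _ _ _ _ _ _ _ Hq Hl).
Qed.

Lemma bits_skipn w i : i < length w ->
  bits (skipn i w) =
  Nat.b2n (nth i w false) + (bits (skipn (S i) w) + bits (skipn (S i) w)).
Proof.
  revert i; induction w as [|b w IH]; intros [|i] Hi; cbn [length] in Hi;
    try lia; [reflexivity|].
  cbn [skipn nth]; apply IH; lia.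
Qed.

(** From the last bit to the first, so that each step is a doubling. *)
Lemma collect_bits c : {d : prog | forall O r w,
  (forall i, i < length w -> exists k, ev O c (npair r i) k /\
     nfst k = Nat.b2n (nth i w false)) ->
  ev O d (npair r (length w)) (seq_code w)}.
Proof.
  (* state: argument [r], position [i], number [B] of the bits from [i] on *)
  assert (Hbody : {p : prog | forall O r i B k,
    ev O c (npair r (pred i)) k -> ev O p (npair r (npair i B))
      (npair r (npair (pred i) (nfst k + (B + B))))}).
  { eexists; intros O r i B k Hk.
    eapply ev_bind; [econstructor; [|exact Hk]; evs|evs]. }
  destruct Hbody as [body Hbody].
  assert (Hloop : {p : prog | forall O r w,
    (forall i, i < length w -> exists k, ev O c (npair r i) k /\
       nfst k = Nat.b2n (nth i w false)) ->
    ev O p (npair r (length w)) (npair r (npair 0 (bits w)))}).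
  { exists (PComp (PWhile (PComp PFst PSnd) body)
      (PPair PFst (PPair PSnd PZero))).
    intros O r w H; econstructor.
    { constructor; [apply ev_fst_eq, nfst_npair|].
      constructor; [apply ev_snd_eq, nsnd_npair|constructor]. }
    enough (Hi : forall i, i <= length w ->
      ev O (PWhile (PComp PFst PSnd) body)
        (npair r (npair i (bits (skipn i w)))) (npair r (npair 0 (bits w)))).
    { specialize (Hi _ (le_n _)); now rewrite skipn_all in Hi. }
    assert (Htest : forall i B, ev O (PComp PFst PSnd)
      (npair r (npair i B)) i).
    { intros i B; econstructor; [apply ev_snd_eq, nsnd_npair|].
      apply ev_fst_eq, nfst_npair. }
    induction i as [|i IH]; intros Hi.
    - apply ev_while_end, Htest.
    - destruct (H i Hi) as (k & Hk & Hb).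
      eapply ev_while; [apply Htest|apply (Hbody O r (S i) _ k Hk)|].
      cbn [pred]; rewrite Hb, <- bits_skipn by exact Hi; apply IH; lia. }
  destruct Hloop as [loop Hloop].
  eexists; intros O r w H; unfold seq_code.
  eapply ev_bind; [exact (Hloop O r w H)|].
  assert (E : bits w = nsnd (nsnd (npair r (npair 0 (bits w))))) by (np; auto).
  rewrite E at 2; evs.
Qed.

(** The bits are obtained by evaluating the realizer of totality below the
    length.  Every element of [x] is a pair of a position and a value, and
    single-valuedness identifies this value with the bit that was computed. *)
Lemma code_of_is_bin_seq : {c : prog | forall s x r,
  in_MApp x s -> realizes L r (is_bin_seq x) s ->
  exists w, got L s c r (fun k => nfst k = seq_code w /\
    rlz_eq L (nsnd k) x (seqA w) s)}.
Proof.
  destruct (eq_of_IsPair L) as [cep Hep], (PairIn_of_mem L) as [cpi Hpi],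
    (pairA_cong L) as [cpc Hpc], read_entry as [cre Hre].
  assert (Hent : {c : prog | forall s x r N n i,
    rlz_eq L (nsnd (nfst r)) n (bar N) s -> i < N ->
    realizes L (nfst (nsnd (nsnd r))) (AllIn n (fun i => Ex (fun j =>
      And (is_bit j) (PairIn i j x)))) s ->
    got L s c (npair r i) (fun k => exists b, nfst k = Nat.b2n b /\
      rlz_in L (nsnd k) (pairA (bar i) (bar (Nat.b2n b))) x s)}).
  { eexists; intros s x r N n i Hn Hi Hr.
    assert (Hm : rlz_in L (npair i (rfl L)) (bar i) (bar N) s)
      by (apply rlz_in_bar; np; split; [exact Hi|apply rlz_refl]).
    eapply got_bind; [eapply got_mem_tr;
      [exact Hm|exact (rlz_sym _ _ _ _ _ Hn)|evs|evs]|].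
    intros m Hm'.
    eapply got_call; [exact (Hre _ _ _ _ _ _ Hm' Hr)|evs]. }
  destruct Hent as [cent Hent].
  destruct (collect_bits cent) as [ccode Hcode].
  assert (Heq : {c : prog | forall s x r n w,
    in_MApp x s -> in_MApp n s ->
    rlz_eq L (nsnd (nfst r)) n (bar (length w)) s ->
    realizes L (nsnd r) (IsFun x n is_bit) s ->
    (forall i, i < length w -> got L s cent (npair r i) (fun k =>
       rlz_in L (nsnd k) (entry w i) x s)) ->
    got L s c r (fun k => rlz_eq L k x (seqA w) s)}).
  { eexists; intros s x r n w Hx Hn En Hf Hw; destruct Hf as (F1 & F2 & F3).
    assert (Hw' : forall t i, extends s t -> i < length w ->
      got L t cent (npair r i) (fun k =>
        rlz_in L (nsnd k) (entry w i) x t)).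
    { intros t i Ht Hi; destruct (Hw i Hi) as (k & Hk & HF).
      exists k; split; [|exact (rlz_in_mono _ _ _ _ _ _ Ht HF)].
      eapply ev_mono; [|exact Hk]; intros q b; now apply R_answers_mono. }
    eapply got_eq; intros t f p Ht Hp.
    - assert (Hm := rlz_in_self L _ _ _ _ Hp).
      assert (Hp' : in_MApp p t) by eauto using in_MApp_elem.
      assert (F1' := realizes_mono _ _ _ _ _ Ht F1).
      eapply got_bind; [eapply got_run;
        [exact (all_in_elim _ _ _ _ _ _ _ F1' Hp' Hm)|evs|evs]|].
      intros k (i & Hi & Hin & j & Hj & Hbit & Hpair).
      eapply got_bind; [eapply got_mem_tr;
        [exact Hin|exact (rlz_eq_mono _ _ _ _ _ _ Ht En)|evs|evs]|].
      intros l Hl; apply rlz_in_bar in Hl as [Hlt Hl].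
      eapply got_bind; [eapply got_call; [exact (Hw' _ _ Ht Hlt)|evs]|].
      intros v Hv; unfold entry in Hv.
      set (b := bar (Nat.b2n (nth (nfst l) w false))) in *.
      assert (Hb : in_MApp b t) by apply in_MApp_bar.
      eapply got_bind; [eapply got_call; [exact (Hpc _ _ _ _ _ _ _
        (rlz_sym _ _ _ _ _ Hl) (rlz_refl L b t))|evs]|].
      intros q Hq; apply (fun H => rlz_mem_subst _ _ _ _ _ _ _ H Hv) in Hq.
      eapply got_bind; [eapply got_call; [exact (Hpi _ _ _ _ _ Hi Hb Hq)|evs]|].
      intros u1 Hu1.
      eapply got_bind; [eapply got_call;
        [exact (Hep _ _ _ _ _ Hp' Hi Hj Hpair)|evs]|].
      intros pi Hpi'.
      assert (Hm2 := rlz_mem_subst _ _ _ _ _ _ _ Hpi' Hm).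
      eapply got_bind; [eapply got_call;
        [exact (Hpi _ _ _ _ _ Hi Hj Hm2)|evs]|].
      intros u2 Hu2.
      assert (F3' := realizes_mono _ _ _ _ _ Ht F3).
      apply (fun H => all_elim _ _ _ _ _ H Hi) in F3'.
      apply (fun H => all_elim _ _ _ _ _ H Hj) in F3'.
      apply (fun H => all_elim _ _ _ _ _ H Hb) in F3'.
      eapply got_bind; [eapply got_run;
        [exact (imp_elim _ _ _ _ _ _ F3' Hu2)|evs|evs]|].
      intros g Hg.
      eapply got_bind; [eapply got_run;
        [exact (imp_elim _ _ _ _ _ _ Hg Hu1)|evs|evs]|].
      intros de Hde; cbn [realizes] in Hde.
      eapply got_bind; [eapply got_call; [exact (Hpc _ _ _ _ _ _ _ Hl Hde)|evs]|].
      intros y Hy.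
      exists (npair (nfst l) (trans L pi y)); split; [evs|].
      apply rlz_in_seqA; np; split; [exact Hlt|].
      exact (rlz_trans _ _ _ _ _ _ _ Hpi' Hy).
    - apply kin_seqA in Hp as [Hlt E].
      eapply got_bind; [eapply got_call; [exact (Hw' _ _ Ht Hlt)|evs]|].
      intros v Hv; exists (nsnd v); split; [evs|].
      eapply rlz_in_keq_l; [apply keq_sym, E|exact Hv]. }
  destruct Heq as [ceq Heq].
  eexists (PPair (PComp ccode (PPair PId (PComp PFst PFst))) ceq).
  intros s x r Hx (n & Hn & Hom & Hfun).
  apply rlz_in_omega in Hom; set (N := nfst (nfst r)) in *.
  (* The bits are chosen along with their computations, since different
     computations of the same bit are not known to agree. *)
  assert (Hw : forall m, m <= N -> exists w, length w = m /\
    forall i, i < m -> got L s cent (npair r i) (fun k =>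
      nfst k = Nat.b2n (nth i w false) /\ rlz_in L (nsnd k) (entry w i) x s)).
  { induction m as [|m IH]; intros Hm; [exists []; split; [auto|lia]|].
    destruct IH as (w & Hlen & Hw); [lia|].
    destruct (Hent s x r N n m Hom Hm (proj1 (proj2 Hfun)))
      as (k & Hk & b & Hb & Hin).
    exists (w ++ [b]); rewrite length_app; cbn [length]; split; [lia|].
    intros i Hi; unfold entry; destruct (Nat.eq_dec i m) as [->|].
    - rewrite app_nth2, Hlen, Nat.sub_diag by lia; exists k; auto.
    - rewrite app_nth1 by lia; apply Hw; lia. }
  destruct (Hw N (le_n N)) as (w & Hlen & Hbits); exists w.
  destruct (Heq s x r n w Hx Hn) as (k & Hk & HF).
  - rewrite Hlen; exact Hom.
  - exact Hfun.
  - intros i Hi; rewrite Hlen in Hi.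
    eapply got_weaken; [exact (Hbits i Hi)|intros ? []; auto].
  - exists (npair (seq_code w) k); np; split; [|auto].
    constructor; [|exact Hk]; econstructor.
    + constructor; [constructor|].
      econstructor; constructor.
    + fold N; rewrite <- Hlen; apply Hcode; intros i Hi; rewrite Hlen in Hi.
      destruct (Hbits i Hi) as (l & Hl & H1 & _); eauto.
Qed.

End Sequences.

(** * The Kleene tree in M[App] *)

Section Kleene.

Context (L : nat -> nat -> Real).

(** The realizers are the codes; so a realizer of membership need only compute
    the code and prove the equation. *)
Definition kleeneA : M :=
  const_set (fun w : {w | kleene_tree w} =>
    opair (num (seq_code (proj1_sig w))) (seqA (proj1_sig w))).

Lemma rlz_in_kleeneA e x s : rlz_in L e x kleeneA s <->
  exists w, kleene_tree w /\ nfst e = seq_code w /\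
    rlz_eq L (nsnd e) x (seqA w) s.
Proof.
  rewrite rlz_in_iff; unfold kleeneA; split.
  - intros (c & Hc & He); apply kin_const in Hc as [[w Hw] E].
    cbn [proj1_sig] in E; apply opair_inj in E as [E1 E2].
    exists w; split; [exact Hw|split]; [now apply num_inj in E1|].
    eapply rlz_eq_keq_r; eauto.
  - intros (w & Hw & E & He); exists (seqA w); split; [|exact He].
    apply kin_const; exists (exist _ w Hw); rewrite E; apply keq_refl.
Qed.

Lemma in_MApp_kleeneA s : in_MApp kleeneA s.
Proof.
  apply in_MApp_const; intros t w _; do 2 eexists; split; [reflexivity|].
  apply in_MApp_seqA.
Qed.

(** A sequence included in a member of the tree is equal to some [seqA v] with
    [v] a prefix; that [v] is in the Kleene tree requires no realizer. *)
Lemma kleeneA_tree : {c : prog | forall s g, got L s c g (fun k =>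
  realizes L k (IsBinTree (bar 0) (bar 1) omega_bar kleeneA) s)}.
Proof.
  destruct (is_bin_seq_of_code L) as [cis His],
    (code_of_is_bin_seq L) as [ccode Hcode].
  eexists; intros s g; apply got_and.
  - eapply got_all_imp; intros t x m Ht Hx Hm.
    apply rlz_in_kleeneA in Hm as (w & _ & Hc & He).
    pose proof (His t x w _ Hx He) as H.
    rewrite <- Hc, npair_eta in H; eapply got_call; [exact H|evs].
  - eapply got_all_imp; intros t x m Ht Hx Hm.
    eapply got_all_imp; intros u y f Hu Hy (Hseq & Hsub).
    destruct (Hcode u y (nfst f) Hy Hseq) as [v Hv].
    eapply got_weaken; [eapply got_call; [exact Hv|evs]|].
    intros k [Hk1 Hk2]; apply rlz_in_kleeneA; exists v; split; [|auto].
    (* [v] is a prefix of the member [w] of the tree *)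
    apply (realizes_mono _ (Mem x kleeneA) _ _ _ Hu) in Hm.
    apply rlz_in_kleeneA in Hm as (w & Hw & _ & He).
    destruct (mem_transport L) as [cm Hcm].
    assert (Hpre : forall i, i < length v ->
      i < length w /\ nth i v false = nth i w false).
    { intros i Hi.
      destruct (entry_in_seqA L _ _ _ _ _ Hi (rlz_sym _ _ _ _ _ Hk2)) as [a Ha].
      destruct (all_in_elim _ _ _ _ _ _ _ Hsub (in_MApp_entry v i u) Ha)
        as (b & _ & Hb).
      destruct (Hcm _ _ _ _ _ _ Hb He) as (d & _ & Hd).
      eapply entry_inv; eauto. }
    apply (kleene_prefix v w); auto.
    + destruct (Nat.le_gt_cases (length v) (length w)) as [|Hl]; auto.
      apply Hpre in Hl; lia.
    + intros i Hi; apply Hpre; exact Hi.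
Qed.

(** A negation that holds at all later nodes is realized by any number, so the
    decision consists of one bit and of a realizer for the positive case. *)
Lemma kleeneA_decidable : {c : prog | forall s g, got L s c g (fun k =>
  realizes L k (IsDecidable (bar 0) (bar 1) omega_bar kleeneA) s)}.
Proof.
  destruct (code_of_is_bin_seq L) as [ccode Hcode].
  eexists; intros s g; eapply got_all_imp; intros t x r Ht Hx Hr.
  destruct (Hcode t x r Hx Hr) as [w Hw].
  eapply got_bind; [eapply got_call; [exact Hw|evs]|].
  intros k [Hk1 Hk2].
  exists (npair (if Nat.eqb (kleene_code (nfst k)) 0 then 1 else 0) k).
  split; [evs|]; cbn [realizes]; np; rewrite Hk1.
  destruct (kleene_code_spec w) as [[Hin E]|[Hout E]]; rewrite E; cbn [Nat.eqb].
  - apply rlz_in_kleeneA; eauto.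
  - intros u1 H1 f u2 H2 Hf; exfalso.
    apply rlz_in_kleeneA in Hf as (v & Hv & _ & He).
    assert (E' : w = v).
    { eapply rlz_seqA_inj, rlz_trans; [apply rlz_sym|exact He].
      eapply rlz_eq_mono; [|exact Hk2]; eauto. }
    now subst.
Qed.

Lemma pigeonhole N (P : nat -> nat -> Prop) :
  (forall n, exists i, i < N /\ P n i) ->
  exists n m i, n <> m /\ P n i /\ P m i.
Proof.
  intros H.
  assert (Hl : forall k, exists l, length l = k /\ forall j, j < k ->
    nth j l 0 < N /\ P j (nth j l 0)).
  { induction k as [|k (l & Hlen & Hl)]; [exists []; split; [auto|lia]|].
    destruct (H k) as (i & Hi & Hp); exists (l ++ [i]).
    rewrite length_app; cbn [length]; split; [lia|]; intros j Hj.
    destruct (Nat.eq_dec j k) as [->|].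
    - rewrite app_nth2, Hlen, Nat.sub_diag by lia; auto.
    - rewrite app_nth1 by lia; apply Hl; lia. }
  destruct (Hl (S N)) as (l & Hlen & Hl').
  apply NNPP; intros Hno.
  assert (Hnd : NoDup l).
  { apply (NoDup_nth l 0); intros i j Hi Hj E; apply NNPP; intros Hij.
    apply Hno; exists i, j, (nth i l 0); split; [exact Hij|].
    rewrite Hlen in *; split; [|rewrite E]; apply Hl'; auto. }
  assert (Hincl : incl l (seq 0 N)).
  { intros a Ha; apply (In_nth l a 0) in Ha as (j & Hj & <-).
    apply in_seq; rewrite Hlen in Hj; specialize (Hl' j Hj); lia. }
  apply (NoDup_incl_length Hnd) in Hincl; rewrite length_seq in Hincl; lia.
Qed.

(** Surjectivity of the enumeration [f] assigns to each [w] in the Kleene tree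
    an index below the bound [N], and [f] is single-valued. *)
Lemma kleeneA_not_finite e s : ~ realizes L e (IsFinite omega_bar kleeneA) s.
Proof.
  intros (n & Hn & Hom & f & Hf & Hfun & Hinj & Hsurj).
  cbn [realizes] in Hom; apply rlz_in_omega in Hom.
  destruct Hfun as (_ & _ & Hfun).
  destruct (PairIn_of_mem L) as [cpi Hpi], (mem_of_PairIn L) as [cmp Hmp],
    (pairA_cong L) as [cpc Hpc], (mem_transport L) as [cm Hcm].
  set (N := nfst (nfst e)) in *.
  assert (H : forall w, kleene_tree w -> exists i, i < N /\
    exists q, realizes L q (PairIn (bar i) (seqA w) f) s).
  { intros w Hw.
    assert (Hm : rlz_in L (npair (seq_code w) (rfl L)) (seqA w) kleeneA s).
    { apply rlz_in_kleeneA; np; exists w; auto using rlz_refl. }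
    destruct (all_in_elim _ _ _ _ _ _ _ Hsurj (in_MApp_seqA w s) Hm)
      as (k & _ & i & Hi & Hin & Hpair).
    destruct (Hcm _ _ _ _ _ _ Hin Hom) as (l & _ & Hl).
    apply rlz_in_bar in Hl as [Hlt Hl]; exists (nfst l); split; auto.
    destruct (Hmp _ _ _ _ _ Hi (in_MApp_seqA w s) Hpair) as (p & _ & Hp).
    destruct (Hpc _ _ _ _ _ _ _ Hl (rlz_refl L (seqA w) s)) as (q & _ & Hq).
    destruct (Hpi _ _ _ _ _ (in_MApp_bar (nfst l) s) (in_MApp_seqA w s)
      (rlz_mem_subst _ _ _ _ _ _ _ Hq Hp)) as (r & _ & Hr); eauto. }
  destruct (pigeonhole N (fun m i => exists w, length w = m /\
    exists q, realizes L q (PairIn (bar i) (seqA w) f) s))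
    as (a & b & i & Hab & (v & Hv & q & Hq) & (w & Hw & r & Hr)).
  { intros m; destruct (kleene_infinite m) as (w & Hlen & Hw).
    destruct (H w Hw) as (i & Hi & Hq); eauto 6. }
  apply Hab; rewrite <- Hv, <- Hw; f_equal.
  apply (fun H => all_elim _ _ _ _ _ H (in_MApp_bar i s)) in Hfun.
  apply (fun H => all_elim _ _ _ _ _ H (in_MApp_seqA v s)) in Hfun.
  apply (fun H => all_elim _ _ _ _ _ H (in_MApp_seqA w s)) in Hfun.
  destruct (imp_elim _ _ _ _ _ _ Hfun Hq) as (k & _ & Hk).
  destruct (imp_elim _ _ _ _ _ _ Hk Hr) as (l & _ & Hl).
  exact (rlz_seqA_inj _ _ _ _ _ Hl).
Qed.

(** The bits [y] are those computed by the realizer of totality of [x].  Each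
    initial segment of [y] is realized to be one of [x], hence equal to some
    member of the tree, and realized equality of sequences is equality. *)
Lemma kleeneA_path e x s : in_MApp x s ->
  realizes L e (IsPath (bar 0) (bar 1) omega_bar kleeneA x) s ->
  exists (y : Real) (i : nat), path kleene_tree y /\
    forall m, computes (R_answers L s) i m (Nat.b2n (y m)).
Proof.
  intros Hx [Hfun Hinit]; destruct Hfun as (_ & Htot & _).
  set (r := nfst (nsnd (nfst e))) in *.
  destruct (read_entry L) as [cre Hre], (is_bin_seq_of_code L) as [cis His].
  set (P := fun i b => exists k,
    ev (R_answers L s) cre (npair r (npair i (rfl L))) k /\
    nfst k = Nat.b2n b /\
    rlz_in L (nsnd k) (pairA (bar i) (bar (Nat.b2n b))) x s).
  assert (HP : forall i, exists b, P i b).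
  { intros i.
    assert (Hm : rlz_in L (npair i (rfl L)) (bar i) omega_bar s)
      by (apply rlz_in_omega; np; apply rlz_refl).
    destruct (Hre _ _ _ _ _ _ Hm Htot) as (k & Hk & b & Hb & Hin).
    exists b, k; auto. }
  set (y := fun i => if excluded_middle_informative (P i true) then true
                     else false).
  assert (Hy : forall i, P i (y i)).
  { intros i; unfold y; destruct (excluded_middle_informative _); auto.
    destruct (HP i) as [[|] Hb]; easy. }
  exists y; eexists; split.
  - intros n; set (w := initial y n).
    assert (Hlen : length w = n)
      by (unfold w, initial; now rewrite length_map, length_seq).
    assert (Hnth : forall i, i < n -> nth i w false = y i).
    { intros i Hi; unfold w, initial.
      rewrite (nth_indep _ false (y 0)) by now rewrite length_map, length_seq.
      now rewrite map_nth, seq_nth. }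
    destruct (His s (seqA w) w _ (in_MApp_seqA w s) (rlz_refl L _ _))
      as (a & _ & Ha).
    assert (Hsub : exists b, realizes L b (Sub (seqA w) x) s).
    { enough (H : exists c, got L s c r (fun k =>
        realizes L k (Sub (seqA w) x) s))
        by (destruct H as (c & k & _ & H); eauto).
      eexists; eapply got_all_imp; intros t z m Ht Hz Hm.
      apply rlz_in_seqA in Hm as [Hi Hm]; rewrite Hlen in Hi.
      destruct (Hy (nfst m)) as (k & Hk & _ & Hin).
      rewrite <- (Hnth _ Hi) in Hin.
      apply (rlz_in_mono _ _ _ _ _ _ Ht) in Hin.
      eapply ev_mono in Hk; [|intros q b; apply (R_answers_mono L s t q b Ht)].
      assert (Hg : got L t cre (npair r (npair (nfst m) (rfl L)))
        (fun k => rlz_in L (nsnd k) (entry w (nfst m)) x t))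
        by (exists k; auto).
      eapply got_bind; [eapply got_call; [exact Hg|evs]|].
      intros l Hl; exists (mem_subst L (sym (nsnd m)) (nsnd l)).
      split; [evs|].
      exact (rlz_mem_subst _ _ _ _ _ _ _ (rlz_sym _ _ _ _ _ Hm) Hl). }
    destruct Hsub as [b Hb].
    assert (Hseg : realizes L (npair a b)
      (IsInitSeg (bar 0) (bar 1) omega_bar (seqA w) x) s)
      by (split; np; assumption).
    apply (fun H => all_elim _ _ _ _ _ H (in_MApp_seqA w s)) in Hinit.
    destruct (imp_elim _ _ _ _ _ _ Hinit Hseg) as (k & _ & Hk).
    apply rlz_in_kleeneA in Hk as (v & Hv & _ & He).
    apply rlz_seqA_inj in He; now rewrite He.
  - intros m; destruct (Hy m) as (k & Hk & Hb & _); apply index_correct.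
    rewrite <- Hb.
    apply ev_nfst; econstructor; [|exact Hk].
    constructor; [apply ev_const|].
    constructor; [constructor|apply ev_const].
Qed.

End Kleene.

Theorem lemma4
  (X : nat -> Real)
  (X_increasing : forall m n, m < n -> turing_lt (X m) (X n))
  (X_paths : forall (n : nat) (T : list bool -> Prop),
     binary_tree T -> tree_computable_in (X n) T ->
     Rbar_lt (Finite 0) (coin_measure (path T)) ->
     exists x : Real, path T x /\ computable_in (X (S n)) x)
  (X_kleene : forall (n : nat) (x : Real),
     path kleene_tree x -> ~ computable_in (X n) x)
  (L : nat -> nat -> Real)
  (L_lists : forall (n : nat) (Y : Real),
     (exists i, forall s, L n i s = Y s) <-> differ_finitely Y (X n)) :
  models_App L (Neg (D_FAN (bar 0) (bar 1) omega_bar)) [].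
Proof.
  exists 0; intros t _ f s _ Hfan; exfalso.
  set (no_path := Neg (Ex (IsPath (bar 0) (bar 1) omega_bar kleeneA))).
  assert (Hpath : realizes L 0 no_path s).
  { intros u _ e v _ (x & Hx & He); exfalso.
    destruct (kleeneA_path L e x v Hx He) as (y & i & Hy & Hi).
    destruct (R_answers_reduction X L v X_increasing L_lists) as [d Hd].
    destruct (oracle_reduction _ _ d i Hd) as [j Hj].
    apply (X_kleene (length v) y Hy); exists j; auto. }
  destruct (kleeneA_tree L) as [ct Ht], (kleeneA_decidable L) as [cd Hd].
  destruct (Ht s 0) as (a & _ & Ha), (Hd s 0) as (b & _ & Hb).
  assert (Hall : realizes L (npair a (npair b 0))
    (And (IsBinTree (bar 0) (bar 1) omega_bar kleeneA)
      (And (IsDecidable (bar 0) (bar 1) omega_bar kleeneA) no_path)) s)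
    by (split; np; [exact Ha|split; np; [exact Hb|exact Hpath]]).
  apply (fun H => all_elim _ _ _ _ _ H (in_MApp_kleeneA s)) in Hfan.
  destruct (imp_elim _ _ _ _ _ _ Hfan Hall) as (k & _ & Hk).
  exact (kleeneA_not_finite L k s Hk).
Qed.
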